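(* Let $\mathfrak g=\mathfrak{sl}(3)$ and let $\mathfrak k\simeq\mathfrak{sl}(2)$ be the root subalgebra generated by $\mathfrak g^{\pm\alpha_1}$, with $L^{\pm}_{a,b}$ as defined in the context. (a) Any simple infinite-dimensional bounded $(\mathfrak g,\mathfrak k)$-module is isomorphic either to $L^+_{a,b}$ for some $a\in\mathbb Z_{\ge0}$, $b\in\mathbb C\setminus\mathbb Z_{\ge0}$, or to $L^-_{a,b}$ for some $a\in\mathbb Z_{\ge0}$ and $b\in\mathbb C$ with $-a-b\in\mathbb C\setminus\mathbb Z_{\ge0}$. (b) For $(a,b)$ in the ranges of (a), $$c(L^{\pm}_{a,b})=1+2z+\dots+az^{a-1}+(a+1)(z^a+z^{a+1}+\cdots)$$ for all $a\ge0$ and all those $b$ which do not satisfy the conditions $-b\in\mathbb Z_{\ge2}$, $a+b\in\mathbb Z_{\ge-1}$ in the case of $L^+_{a,b}$, respectively the conditions $a+b\in\mathbb Z_{\ge2}$, $-b\in\mathbb Z_{\ge-1}$ in the case of $L^-_{a,b}$. (c) If $-b\in\mathbb Z_{\ge2}$ and $a+b\in\mathbb Z_{\ge-1}$, then $$c(L^+_{a,b})=z^{-b-1}+2z^{-b}+\dots+(a+b+1)z^{a-1}+(a+b+2)(z^a+z^{a+1}+\cdots),$$ and if $a+b\in\mathbb Z_{\ge2}$ and $-b\in\mathbb Z_{\ge-1}$, then $$c(L^-_{a,b})=z^{a+b-1}+2z^{a+b}+\dots+(1-b)z^{a-1}+(2-b)(z^a+z^{a+1}+\cdots).$$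
   Context: Fix a Cartan subalgebra $\mathfrak h\subset\mathfrak g=\mathfrak{sl}(3)$ (over $\mathbb C$) and simple roots $\alpha_1,\alpha_2$; let $\mathfrak b^+$ be the corresponding Borel subalgebra and $\mathfrak b^-$ the Borel subalgebra containing $\mathfrak h$ with simple roots $\alpha_1,-\alpha_1-\alpha_2$. Let $h_i\in[\mathfrak g^{\alpha_i},\mathfrak g^{-\alpha_i}]$ be the coroots and $\omega_1,\omega_2$ the dual basis of $\mathfrak h^*$. Put $\mathfrak p^+=(\mathfrak h+\mathfrak k)\oplus\mathfrak g^{\alpha_2}\oplus\mathfrak g^{\alpha_1+\alpha_2}$ and $\mathfrak p^-=(\mathfrak h+\mathfrak k)\oplus\mathfrak g^{-\alpha_2}\oplus\mathfrak g^{-\alpha_1-\alpha_2}$. For $a\in\mathbb Z_{\ge0}$, $b\in\mathbb C$, $F^\pm_{a,b}$ is the simple finite-dimensional $\mathfrak p^\pm$-module with $\mathfrak b^\pm$-highest weight $a\omega_1+b\omega_2$, and $L^\pm_{a,b}$ is the unique simple quotient of $U(\mathfrak g)\otimes_{U(\mathfrak p^\pm)}F^\pm_{a,b}$. A $(\mathfrak g,\mathfrak k)$-module is a $\mathfrak g$-module on which $\mathfrak k$ acts locally finitely and semisimply; it is bounded if the dimensions $\dim\mathrm{Hom}_{\mathfrak k}(V,M)$, $V$ simple finite dimensional, are uniformly bounded. $V_k$ is the simple $(k+1)$-dimensional $\mathfrak{sl}(2)$-module and $c(M)=\sum_{k\ge0}\dim\mathrm{Hom}_{\mathfrak k}(V_k,M)\,z^k$.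 *)

(* Defs.v *)
From HB Require Import structures.
From mathcomp Require Import all_boot all_order all_algebra.
From mathcomp Require Import generic_quotient.
From mathcomp Require Import boolp classical_sets functions reals.
From mathcomp Require Import complex ring.

Set Implicit Arguments.
Unset Strict Implicit.
Unset Printing Implicit Defensive.

Import GRing.Theory.
Local Open Scope classical_set_scope.
Local Open Scope ring_scope.
Local Open Scope quotient_scope.

(** ** Vector spaces of arbitrary dimension *)

Section Linear.
Variables (K : fieldType) (V : lmodType K).

Definition subspace (S : set V) : Prop :=
  S 0 /\ forall (a : K) u v, S u -> S v -> S (a *: u + v).

Definition lspan (G : set V) : set V := smallest subspace G.

(* For a subspace [W] this says that [W] has a basis with [n] elements. *)
Definition has_dim (W : set V) (n : nat) : Prop :=
  exists e : 'I_n -> V, (forall i, W (e i)) /\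
    forall w, W w -> exists! c : {ffun 'I_n -> K}, w = \sum_(i < n) c i *: e i.

Definition finite_dim (W : set V) : Prop := exists n, has_dim W n.

End Linear.

(** ** Lie algebras *)

HB.mixin Record Lmodule_isLieAlgebra (K : fieldType) L of GRing.Lmodule K L := {
  lie : L -> L -> L;
  lie_linearl : forall y, linear (lie^~ y);
  lie_linearr : forall x, linear (lie x);
  liexx : forall x, lie x x = 0;
  lie_jacobi : forall x y z,
    lie x (lie y z) + lie y (lie z x) + lie z (lie x y) = 0
}.

#[short(type="lieAlgType")]
HB.structure Definition LieAlgebra (K : fieldType) :=
  {L of GRing.Lmodule K L & Lmodule_isLieAlgebra K L}.

(** ** The universal enveloping algebra

    [uea L] is the unital associative algebra presented by the generators
    [x : L] and the relations saying that [x |-> uGen x] is linear and that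
    [uGen x * uGen y - uGen y * uGen x = uGen (lie x y)]: formal expressions
    modulo the congruence [ueq] generated by these relations and by the axioms
    of associative [K]-algebras. *)

Section Enveloping.
Variables (K : fieldType) (L : lieAlgType K).

Inductive uterm : Type :=
| uGen of L
| uScal of K
| uAdd of uterm & uterm
| uMul of uterm & uterm.

HB.instance Definition _ := gen_eqMixin uterm.
HB.instance Definition _ := gen_choiceMixin uterm.

Inductive ueq : uterm -> uterm -> Prop :=
| ueq_refl s : ueq s s
| ueq_sym s t : ueq s t -> ueq t s
| ueq_trans s t r : ueq s t -> ueq t r -> ueq s r
| ueq_add s s' t t' : ueq s s' -> ueq t t' -> ueq (uAdd s t) (uAdd s' t')
| ueq_mul s s' t t' : ueq s s' -> ueq t t' -> ueq (uMul s t) (uMul s' t')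
| ueq_addA s t r : ueq (uAdd s (uAdd t r)) (uAdd (uAdd s t) r)
| ueq_addC s t : ueq (uAdd s t) (uAdd t s)
| ueq_add0 s : ueq (uAdd (uScal 0) s) s
| ueq_addN s : ueq (uAdd (uMul (uScal (- 1)) s) s) (uScal 0)
| ueq_mulA s t r : ueq (uMul s (uMul t r)) (uMul (uMul s t) r)
| ueq_mul1 s : ueq (uMul (uScal 1) s) s
| ueq_mulDl s t r : ueq (uMul (uAdd s t) r) (uAdd (uMul s r) (uMul t r))
| ueq_mulDr s t r : ueq (uMul s (uAdd t r)) (uAdd (uMul s t) (uMul s r))
| ueq_scalD a b : ueq (uScal (a + b)) (uAdd (uScal a) (uScal b))
| ueq_scalM a b : ueq (uScal (a * b)) (uMul (uScal a) (uScal b))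
| ueq_scalC a s : ueq (uMul (uScal a) s) (uMul s (uScal a))
| ueq_gen a x y :
    ueq (uGen (a *: x + y)) (uAdd (uMul (uScal a) (uGen x)) (uGen y))
| ueq_lie x y :
    ueq (uMul (uGen x) (uGen y))
        (uAdd (uMul (uGen y) (uGen x)) (uGen (lie x y))).

Definition ueqb : rel uterm := fun s t => `[< ueq s t >].

Fact ueqb_equiv : equiv_class_of ueqb.
Proof.
split=> [s|s t|s t r].
- exact/asboolP/ueq_refl.
- by apply/asboolP/asboolP; exact: ueq_sym.
- by move=> /asboolP h1 /asboolP h2; apply/asboolP; exact: ueq_trans h1 h2.
Qed.

Canonical ueqb_equiv_rel := EquivRelPack ueqb_equiv.

Definition uea := {eq_quot ueqb}.
HB.instance Definition _ := Choice.on uea.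

Definition uclass (s : uterm) : uea := \pi_uea s.

Lemma uclassP s t : uclass s = uclass t <-> ueq s t.
Proof.
by split=> [/eqmodP/asboolP//|st]; apply/eqmodP; exact/asboolP.
Qed.

Lemma uclassK (q : uea) : uclass (repr q) = q.
Proof. exact: reprK. Qed.

Lemma ueq_repr s : ueq (repr (uclass s)) s.
Proof. by apply/uclassP; rewrite uclassK. Qed.

Lemma uclass_ind (P : uea -> Prop) : (forall s, P (uclass s)) -> forall q, P q.
Proof. by move=> Ps q; rewrite -[q]uclassK. Qed.

Definition uea_zero : uea := uclass (uScal 0).
Definition uea_one : uea := uclass (uScal 1).
Definition uea_add (p q : uea) : uea := uclass (uAdd (repr p) (repr q)).
Definition uea_mul (p q : uea) : uea := uclass (uMul (repr p) (repr q)).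
Definition uea_scale (a : K) (q : uea) : uea := uclass (uMul (uScal a) (repr q)).
Definition uea_opp : uea -> uea := uea_scale (- 1).

Lemma uea_addE s t : uea_add (uclass s) (uclass t) = uclass (uAdd s t).
Proof. by apply/uclassP/ueq_add; exact: ueq_repr. Qed.
Lemma uea_mulE s t : uea_mul (uclass s) (uclass t) = uclass (uMul s t).
Proof. by apply/uclassP/ueq_mul; exact: ueq_repr. Qed.
Lemma uea_scaleE a s : uea_scale a (uclass s) = uclass (uMul (uScal a) s).
Proof. by apply/uclassP/ueq_mul; [exact: ueq_refl|exact: ueq_repr]. Qed.

Definition uea_opE := (uea_addE, uea_mulE, uea_scaleE).

Ltac uea_ax := do ?[elim/uclass_ind => ?]; rewrite ?/uea_opp ?uea_opE;
  apply/uclassP.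

Fact uea_addA : associative uea_add.
Proof. by uea_ax; exact: ueq_addA. Qed.
Fact uea_addC : commutative uea_add.
Proof. by uea_ax; exact: ueq_addC. Qed.
Fact uea_add0 : left_id uea_zero uea_add.
Proof. by uea_ax; exact: ueq_add0. Qed.
Fact uea_addN : left_inverse uea_zero uea_opp uea_add.
Proof. by uea_ax; exact: ueq_addN. Qed.

HB.instance Definition _ :=
  GRing.isZmodule.Build uea uea_addA uea_addC uea_add0 uea_addN.

Fact uea_mulA : associative uea_mul.
Proof. by uea_ax; exact: ueq_mulA. Qed.
Fact uea_mul1l : left_id uea_one uea_mul.
Proof. by uea_ax; exact: ueq_mul1. Qed.
Fact uea_mul1r : right_id uea_one uea_mul.
Proof. by uea_ax; exact: ueq_trans (ueq_sym (ueq_scalC _ _)) (ueq_mul1 _). Qed.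
Fact uea_mulDl : left_distributive uea_mul +%R.
Proof. by do 3![elim/uclass_ind => ?]; rewrite /+%R /= !uea_opE; apply/uclassP; exact: ueq_mulDl. Qed.
Fact uea_mulDr : right_distributive uea_mul +%R.
Proof. by do 3![elim/uclass_ind => ?]; rewrite /+%R /= !uea_opE; apply/uclassP; exact: ueq_mulDr. Qed.

(* The augmentation, used to see that [uea] is not the zero ring. *)
Fixpoint uaug (s : uterm) : K :=
  match s with
  | uGen _ => 0
  | uScal a => a
  | uAdd s t => uaug s + uaug t
  | uMul s t => uaug s * uaug t
  end.

Lemma uaugP s t : ueq s t -> uaug s = uaug t.
Proof.
elim=> {s t} //=.
- by move=> s t r _ -> _ ->.
- by move=> s s' t t' _ -> _ ->.
- by move=> s s' t t' _ -> _ ->.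
- by move=> *; rewrite addrA.
- by move=> *; rewrite addrC.
- by move=> *; rewrite add0r.
- by move=> *; rewrite mulN1r addNr.
- by move=> *; rewrite mulrA.
- by move=> *; rewrite mul1r.
- by move=> *; rewrite mulrDl.
- by move=> *; rewrite mulrDr.
- by move=> *; rewrite mulrC.
- by move=> *; rewrite mulr0 addr0.
- by move=> *; rewrite !mulr0 addr0.
Qed.

Fact uea_1neq0 : uea_one != 0.
Proof. by apply/eqP => /uclassP/uaugP/eqP; rewrite /= oner_eq0. Qed.

HB.instance Definition _ := GRing.Zmodule_isNzRing.Build uea
  uea_mulA uea_mul1l uea_mul1r uea_mulDl uea_mulDr uea_1neq0.

Fact uea_scaleA a b q : uea_scale a (uea_scale b q) = uea_scale (a * b) q.
Proof.
elim/uclass_ind: q => s; rewrite !uea_opE; apply/uclassP.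
apply: ueq_trans (ueq_mulA _ _ _) _.
by apply: ueq_mul (ueq_refl _); exact/ueq_sym/ueq_scalM.
Qed.
Fact uea_scale1 : left_id 1 uea_scale.
Proof. by uea_ax; exact: ueq_mul1. Qed.
Fact uea_scaleDr : right_distributive uea_scale +%R.
Proof.
move=> a; do 2![elim/uclass_ind => ?]; rewrite /+%R /= !uea_opE.
by apply/uclassP; exact: ueq_mulDr.
Qed.
Fact uea_scaleDl q : {morph uea_scale^~ q : a b / a + b}.
Proof.
elim/uclass_ind: q => s a b; rewrite /= [in RHS]/+%R /= !uea_opE.
apply/uclassP; apply: ueq_trans (ueq_mulDl _ _ _).
by apply: ueq_mul (ueq_refl _); exact: ueq_scalD.
Qed.

HB.instance Definition _ := GRing.Zmodule_isLmodule.Build K uea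
  uea_scaleA uea_scale1 uea_scaleDr uea_scaleDl.

Fact uea_scaleAl a (p q : uea) : a *: (p * q) = (a *: p) * q.
Proof.
elim/uclass_ind: p => s; elim/uclass_ind: q => t.
rewrite /*:%R /*%R /= !uea_opE; apply/uclassP; exact: ueq_mulA.
Qed.

HB.instance Definition _ := GRing.Lmodule_isLalgebra.Build K uea uea_scaleAl.

Fact uea_scaleAr a (p q : uea) : a *: (p * q) = p * (a *: q).
Proof.
elim/uclass_ind: p => s; elim/uclass_ind: q => t.
rewrite /*:%R /*%R /= !uea_opE; apply/uclassP.
apply: ueq_trans (ueq_mulA _ _ _) _.
apply: ueq_trans (ueq_sym (ueq_mulA _ _ _)).
exact: ueq_mul (ueq_scalC _ _) (ueq_refl _).
Qed.

HB.instance Definition _ := GRing.Lalgebra_isAlgebra.Build K uea uea_scaleAr.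

Definition iota (x : L) : uea := uclass (uGen x).

Lemma iota_linear : linear iota.
Proof.
move=> a x y; rewrite /*:%R /+%R /= /iota !uea_opE.
by apply/uclassP; exact: ueq_gen.
Qed.

Lemma iota_lie x y : iota (lie x y) = iota x * iota y - iota y * iota x.
Proof.
apply/esym/eqP; rewrite subr_eq addrC; apply/eqP.
rewrite /*%R /+%R /= /iota !uea_opE.
by apply/uclassP; exact: ueq_lie.
Qed.

End Enveloping.

Arguments iota {K L} x.

(** ** Modules over Lie subalgebras *)

Section Modules.
Variables (K : fieldType) (L : lieAlgType K).
Implicit Types (p q : set L).

Definition lie_subalg (S : set L) : Prop :=
  subspace S /\ forall x y, S x -> S y -> S (lie x y).

(* The action is a function on the whole of [L], but only its values on [p]
   are constrained, and only these are ever used. *)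
Definition lie_action p (V : lmodType K) (act : L -> V -> V) : Prop :=
  [/\ forall x, p x -> linear (act x),
      forall a x y v, p x -> p y -> act (a *: x + y) v = a *: act x v + act y v
    & forall x y v, p x -> p y ->
        act (lie x y) v = act x (act y v) - act y (act x v)].

Record liemod p := LieMod {
  carrier :> lmodType K;
  act : L -> carrier -> carrier;
  actP : lie_action p act
}.

Fact res_subproof p q (qp : q `<=` p) (M : liemod p) : lie_action q (@act p M).
Proof.
by have [h1 h2 h3] := actP M; split=> *; [apply: h1|apply: h2|apply: h3]; exact: qp.
Qed.

Definition res p q (qp : q `<=` p) (M : liemod p) : liemod q :=
  LieMod (res_subproof qp M).

Definition lie_hom p (M N : liemod p) : set (M -> N) :=
  [set f | linear f /\ forall x v, p x -> f (act x v) = act x (f v)].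

Arguments lie_hom {p} M N.

Definition iso p (M N : liemod p) : Prop :=
  exists2 f, lie_hom M N f & bijective f.

Definition submodule p (M : liemod p) (W : set M) : Prop :=
  subspace W /\ forall x v, p x -> W v -> W (act x v).

Definition simple_submodule p (M : liemod p) (W : set M) : Prop :=
  [/\ submodule W, W <> [set 0]
    & forall W', submodule W' -> W' `<=` W -> W' = [set 0] \/ W' = W].

Definition simple_mod p (M : liemod p) : Prop := simple_submodule (@setT M).

Definition semisimple_mod p (M : liemod p) : Prop :=
  forall v : M, exists (n : nat) (w : 'I_n -> M),
    v = \sum_(i < n) w i /\
    forall i, exists2 W, simple_submodule W & W (w i).

Definition locally_finite p (M : liemod p) : Prop :=
  forall v : M, exists W : set M, [/\ submodule W, finite_dim W & W v].

Fact zero_action p : @lie_action p 'rV[K]_0 (fun _ _ => 0).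
Proof.
have rV0 (u v : 'rV[K]_0) : u = v by rewrite [u]thinmx0 [v]thinmx0.
by split=> [x _ a u v|a x y v _ _|x y v _ _]; exact: rV0.
Qed.

Definition zero_mod p : liemod p := LieMod (zero_action p).

(* "The module with property [P]"; meant for properties that determine a
   module up to isomorphism, the default value being irrelevant. *)
Definition the_mod p (P : liemod p -> Prop) : liemod p :=
  if pselect (exists M, P M) is left h then projT1 (cid h) else zero_mod p.

End Modules.

Arguments lie_hom {K L p} M N.
Arguments iso {K L p} M N.

(** ** Induced modules

    [ind F] is the left [uea L]-module U(L) (x)_{U(p)} F, seen as an
    [L]-module: formal sums of tensors [u (x) f] modulo bilinearity, the
    relations (u x) (x) f = u (x) (x f) for [x] in [p] (which is enough since
    [p] generates the algebra U(p)) and the axioms of vector spaces. *)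

Section Induced.
Variables (K : fieldType) (L : lieAlgType K) (p : set L) (F : liemod p).

Inductive tterm : Type :=
| tPure of uea L & F
| tZero
| tAdd of tterm & tterm
| tScale of K & tterm.

HB.instance Definition _ := gen_eqMixin tterm.
HB.instance Definition _ := gen_choiceMixin tterm.

Inductive teq : tterm -> tterm -> Prop :=
| teq_refl s : teq s s
| teq_sym s t : teq s t -> teq t s
| teq_trans s t r : teq s t -> teq t r -> teq s r
| teq_add s s' t t' : teq s s' -> teq t t' -> teq (tAdd s t) (tAdd s' t')
| teq_scale a s s' : teq s s' -> teq (tScale a s) (tScale a s')
| teq_addA s t r : teq (tAdd s (tAdd t r)) (tAdd (tAdd s t) r)
| teq_addC s t : teq (tAdd s t) (tAdd t s)
| teq_add0 s : teq (tAdd tZero s) s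
| teq_addN s : teq (tAdd (tScale (- 1) s) s) tZero
| teq_scaleA a b s : teq (tScale a (tScale b s)) (tScale (a * b) s)
| teq_scale1 s : teq (tScale 1 s) s
| teq_scaleDr a s t : teq (tScale a (tAdd s t)) (tAdd (tScale a s) (tScale a t))
| teq_scaleDl a b s : teq (tScale (a + b) s) (tAdd (tScale a s) (tScale b s))
| teq_linl a u v f :
    teq (tPure (a *: u + v) f) (tAdd (tScale a (tPure u f)) (tPure v f))
| teq_linr a u f g :
    teq (tPure u (a *: f + g)) (tAdd (tScale a (tPure u f)) (tPure u g))
| teq_bal u x f : p x -> teq (tPure (u * iota x) f) (tPure u (act x f)).

Definition teqb : rel tterm := fun s t => `[< teq s t >].

Fact teqb_equiv : equiv_class_of teqb.
Proof.
split=> [s|s t|s t r].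
- exact/asboolP/teq_refl.
- by apply/asboolP/asboolP; exact: teq_sym.
- by move=> /asboolP h1 /asboolP h2; apply/asboolP; exact: teq_trans h1 h2.
Qed.

Canonical teqb_equiv_rel := EquivRelPack teqb_equiv.

Definition ind_space := {eq_quot teqb}.
HB.instance Definition _ := Choice.on ind_space.

Definition tclass (s : tterm) : ind_space := \pi_ind_space s.

Lemma tclassP s t : tclass s = tclass t <-> teq s t.
Proof.
by split=> [/eqmodP/asboolP//|st]; apply/eqmodP; exact/asboolP.
Qed.

Lemma tclassK (q : ind_space) : tclass (repr q) = q.
Proof. exact: reprK. Qed.

Lemma teq_repr s : teq (repr (tclass s)) s.
Proof. by apply/tclassP; rewrite tclassK. Qed.

Lemma tclass_ind (P : ind_space -> Prop) :
  (forall s, P (tclass s)) -> forall q, P q.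
Proof. by move=> Ps q; rewrite -[q]tclassK. Qed.

Definition ind_zero : ind_space := tclass tZero.
Definition ind_add (r s : ind_space) := tclass (tAdd (repr r) (repr s)).
Definition ind_scale a (s : ind_space) := tclass (tScale a (repr s)).
Definition ind_opp : ind_space -> ind_space := ind_scale (- 1).

Lemma ind_addE s t : ind_add (tclass s) (tclass t) = tclass (tAdd s t).
Proof. by apply/tclassP/teq_add; exact: teq_repr. Qed.
Lemma ind_scaleE a s : ind_scale a (tclass s) = tclass (tScale a s).
Proof. by apply/tclassP/teq_scale; exact: teq_repr. Qed.

Definition ind_opE := (ind_addE, ind_scaleE).

Ltac ind_ax := do ?[elim/tclass_ind => ?]; rewrite ?/ind_opp ?ind_opE;
  apply/tclassP.

Fact ind_addA : associative ind_add.
Proof. by ind_ax; exact: teq_addA. Qed.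
Fact ind_addC : commutative ind_add.
Proof. by ind_ax; exact: teq_addC. Qed.
Fact ind_add0 : left_id ind_zero ind_add.
Proof. by ind_ax; exact: teq_add0. Qed.
Fact ind_addN : left_inverse ind_zero ind_opp ind_add.
Proof. by ind_ax; exact: teq_addN. Qed.

HB.instance Definition _ :=
  GRing.isZmodule.Build ind_space ind_addA ind_addC ind_add0 ind_addN.

Fact ind_scaleA a b q : ind_scale a (ind_scale b q) = ind_scale (a * b) q.
Proof. by elim/tclass_ind: q => s; rewrite !ind_opE; apply/tclassP/teq_scaleA. Qed.
Fact ind_scale1 : left_id 1 ind_scale.
Proof. by ind_ax; exact: teq_scale1. Qed.
Fact ind_scaleDr : right_distributive ind_scale +%R.
Proof.
move=> a; do 2![elim/tclass_ind => ?]; rewrite /+%R /= !ind_opE.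
by apply/tclassP; exact: teq_scaleDr.
Qed.
Fact ind_scaleDl q : {morph ind_scale^~ q : a b / a + b}.
Proof.
elim/tclass_ind: q => s a b; rewrite /= [in RHS]/+%R /= !ind_opE.
by apply/tclassP; exact: teq_scaleDl.
Qed.

HB.instance Definition _ := GRing.Zmodule_isLmodule.Build K ind_space
  ind_scaleA ind_scale1 ind_scaleDr ind_scaleDl.

Fixpoint tlmul (w : uea L) (s : tterm) : tterm :=
  match s with
  | tPure u f => tPure (w * u) f
  | tZero => tZero
  | tAdd s t => tAdd (tlmul w s) (tlmul w t)
  | tScale a s => tScale a (tlmul w s)
  end.

Lemma tlmul_teq w s t : teq s t -> teq (tlmul w s) (tlmul w t).
Proof.
elim=> {s t} /=; try by constructor.
- by move=> s t r _ h1 _ h2; exact: teq_trans h1 h2.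
- by move=> a u v f; rewrite mulrDr -scalerAr; exact: teq_linl.
- by move=> u x f px; rewrite mulrA; exact: teq_bal.
Qed.

Definition ind_lmul (w : uea L) (q : ind_space) : ind_space :=
  tclass (tlmul w (repr q)).

Lemma ind_lmulE w s : ind_lmul w (tclass s) = tclass (tlmul w s).
Proof. by apply/tclassP/tlmul_teq; exact: teq_repr. Qed.

Lemma ind_lmul_linear w : linear (ind_lmul w).
Proof.
move=> a; do 2![elim/tclass_ind => ?].
by rewrite /*:%R /+%R /= !(ind_opE, ind_lmulE).
Qed.

Lemma tclassD s t : tclass (tAdd s t) = tclass s + tclass t.
Proof. by rewrite /+%R /= ind_opE. Qed.
Lemma tclassZ a s : tclass (tScale a s) = a *: tclass s.
Proof. by rewrite /*:%R /= ind_opE. Qed.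

Lemma ind_lmulDl a w w' q :
  ind_lmul (a *: w + w') q = a *: ind_lmul w q + ind_lmul w' q.
Proof.
elim/tclass_ind: q => s; rewrite !ind_lmulE -tclassZ -tclassD.
elim: s => [u f||s IHs t IHt|b s IHs] /=.
- by rewrite mulrDl -scalerAl; apply/tclassP; exact: teq_linl.
- by rewrite tclassD tclassZ (_ : tclass tZero = 0) // scaler0 addr0.
- rewrite !(tclassD, tclassZ) in IHs IHt *.
  by rewrite IHs IHt scalerDr addrACA.
- rewrite !(tclassD, tclassZ) in IHs *.
  by rewrite IHs scalerDr !scalerA mulrC.
Qed.

Lemma ind_lmulA w w' q : ind_lmul (w * w') q = ind_lmul w (ind_lmul w' q).
Proof.
elim/tclass_ind: q => s; rewrite !ind_lmulE; congr tclass.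
by elim: s => //= [u f|s -> t ->|a s ->]; rewrite ?mulrA.
Qed.

Fact ind_action :
  @lie_action K L setT ind_space (fun x => ind_lmul (iota x)).
Proof.
split=> [x _|a x y v _ _|x y v _ _]; first exact: ind_lmul_linear.
- by rewrite iota_linear ind_lmulDl.
- rewrite iota_lie -!ind_lmulA addrC -scaleN1r ind_lmulDl scaleN1r.
  by rewrite addrC.
Qed.

Definition ind : liemod [set: L] := LieMod ind_action.

End Induced.

(** ** Cartan subalgebras and roots

    Linear forms on a Cartan subalgebra [h] of [L] are represented by functions
    [L -> K], of which only the restrictions to [h] matter. *)

Section Cartan.
Variables (K : fieldType) (L : lieAlgType K).
Implicit Types (h : set L) (al be : L -> K).

Fixpoint lower_central h (n : nat) : set L :=
  if n is m.+1 then lspan [set lie x y | x in h & y in lower_central h m]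
  else h.

Definition cartan_subalg h : Prop :=
  [/\ lie_subalg h,
      exists n, lower_central h n = [set 0]
    & forall x, (forall t, h t -> h (lie x t)) -> h x].

Definition linear_on h al : Prop :=
  forall a x y, h x -> h y -> al (a *: x + y) = a * al x + al y.

Definition root_space h al : set L :=
  [set x | forall t, h t -> lie t x = al t *: x].

Definition root h al : Prop :=
  [/\ linear_on h al,
      exists2 t, h t & al t != 0
    & exists2 x, root_space h al x & x != 0].

Definition simple_roots2 h al1 al2 : Prop :=
  [/\ root h al1, root h al2,
      forall a b : K, (forall t, h t -> a * al1 t + b * al2 t = 0) ->
        a = 0 /\ b = 0
    & forall be, root h be -> exists m n : nat,
        (forall t, h t -> be t = al1 t *+ m + al2 t *+ n) \/
        (forall t, h t -> be t = - (al1 t *+ m + al2 t *+ n))].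

Definition coroot h al (x : L) : Prop :=
  lspan [set lie u v | u in root_space h al & v in root_space h (- al)] x
  /\ al x = 2%:R.

Record cartan_data := CartanData {
  cartan : set L;
  alpha1 : L -> K;
  alpha2 : L -> K;
  h1 : L;
  h2 : L;
  omega1 : L -> K;
  omega2 : L -> K;
  cartanP : cartan_subalg cartan;
  alphaP : simple_roots2 cartan alpha1 alpha2;
  h1P : coroot cartan alpha1 h1;
  h2P : coroot cartan alpha2 h2;
  omega_linear : linear_on cartan omega1 /\ linear_on cartan omega2;
  omega1P : omega1 h1 = 1 /\ omega1 h2 = 0;
  omega2P : omega2 h1 = 0 /\ omega2 h2 = 1
}.

(* Highest weight vectors with respect to the Borel subalgebra
   h + sum_(be in pos) g^be. *)
Definition highest_weight_vector h (pos : set (L -> K)) (lam : L -> K)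
    (p : set L) (M : liemod p) (v : M) : Prop :=
  [/\ v != 0,
      forall t, h t -> act t v = lam t *: v
    & forall be x, pos be -> root_space h be x -> act x v = 0].

(* The simple finite-dimensional [p]-module of highest weight [lam]. *)
Definition fin_simple h pos lam (p : set L) : liemod p :=
  the_mod (fun F : liemod p =>
    [/\ simple_mod F, finite_dim [set: F]
      & exists v, highest_weight_vector h pos lam (v : F)]).

Definition simple_quotient (M : liemod [set: L]) : liemod [set: L] :=
  the_mod (fun Q => simple_mod Q /\
    exists2 f, lie_hom M Q f & range f = [set: Q]).

End Cartan.

Section Modules_gk.
Variables (K : fieldType) (L : lieAlgType K) (D : cartan_data L).

Let h := cartan D.
Let a1 := alpha1 D.
Let a2 := alpha2 D.
Let g (al : L -> K) : set L := root_space h al.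

Definition k_sub : set L := smallest (@lie_subalg K L) (g a1 `|` g (- a1)).

Definition pos_plus : set (L -> K) := [set a1; a2; a1 + a2].
Definition pos_minus : set (L -> K) := [set a1; - a1 - a2; - a2].

(* A sum of subspaces is the span of their union. *)
Definition p_plus : set L := lspan (h `|` k_sub `|` g a2 `|` g (a1 + a2)).
Definition p_minus : set L := lspan (h `|` k_sub `|` g (- a2) `|` g (- a1 - a2)).

Definition weight (a : nat) (b : K) : L -> K :=
  fun t => a%:R * omega1 D t + b * omega2 D t.

Definition F_plus a b : liemod p_plus :=
  fin_simple h pos_plus (weight a b) p_plus.
Definition F_minus a b : liemod p_minus :=
  fin_simple h pos_minus (weight a b) p_minus.

Definition L_plus a b : liemod [set: L] := simple_quotient (ind (F_plus a b)).
Definition L_minus a b : liemod [set: L] := simple_quotient (ind (F_minus a b)).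

Definition res_k (M : liemod [set: L]) : liemod k_sub := res (@subsetT L k_sub) M.

Definition gk_module (M : liemod [set: L]) : Prop :=
  locally_finite (res_k M) /\ semisimple_mod (res_k M).

Definition bounded (M : liemod [set: L]) : Prop :=
  exists N : nat, forall V : liemod k_sub, simple_mod V -> finite_dim [set: V] ->
    exists2 n, (n <= N)%N & has_dim (lie_hom V (res_k M)) n.

(* The simple module of dimension [n + 1] over [k_sub], which is sl(2). *)
Definition V_k (n : nat) : liemod k_sub :=
  the_mod (fun V => simple_mod V /\ has_dim [set: V] n.+1).

(* [c] is the sequence of coefficients of the formal power series c(M). *)
Definition c_eq (M : liemod [set: L]) (c : nat -> nat) : Prop :=
  forall n, has_dim (lie_hom (V_k n) (res_k M)) (c n).

End Modules_gk.

(* The coefficients of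
   z^p + 2 z^(p+1) + ... + (q-p) z^(q-1) + (q-p+1) (z^q + z^(q+1) + ...),
   for p <= q. *)
Definition stairs (p q : nat) : nat -> nat := fun n =>
  if (n < p)%N then 0%N else if (n < q)%N then (n - p).+1 else (q - p).+1.

(* The set of integers >= m, inside [K]. *)
Definition int_ge (K : fieldType) (m : int) : set K :=
  [set x | exists2 z : int, m <= z & x = z%:~R].

(** ** The Lie algebra sl(n) *)

Section Sl.
Variables (K : fieldType) (n : nat).

Definition traceless : {pred 'M[K]_n} := fun A => \tr A == 0.

Fact traceless_submod : submod_closed traceless.
Proof.
split=> [|a A B /eqP A0 /eqP B0]; apply/eqP; first exact: mxtrace0.
by rewrite mxtraceD mxtraceZ A0 B0 mulr0 addr0.
Qed.

HB.instance Definition _ :=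
  GRing.isSubmodClosed.Build K 'M[K]_n traceless traceless_submod.

Record sl := Sl { slval :> 'M[K]_n; slvalP : slval \in traceless }.

HB.instance Definition _ := [isSub for slval].
HB.instance Definition _ := [Choice of sl by <:].
HB.instance Definition _ := [SubChoice_isSubLmodule of sl by <:].

Fact sl_lie_subproof (A B : 'M[K]_n) : A *m B - B *m A \in traceless.
Proof. by apply/eqP; rewrite linearB /= mxtrace_mulC subrr. Qed.

Definition sl_lie (A B : sl) : sl := Sl (sl_lie_subproof A B).

Fact sl_lie_linearl B : linear (sl_lie^~ B).
Proof.
move=> a A A'; apply/val_inj => /=.
rewrite mulmxDl mulmxDr -scalemxAl -scalemxAr scalerBr opprD.
by rewrite addrACA.
Qed.
Fact sl_lie_linearr A : linear (sl_lie A).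
Proof.
move=> a B B'; apply/val_inj => /=.
rewrite mulmxDl mulmxDr -scalemxAl -scalemxAr scalerBr opprD.
by rewrite addrACA.
Qed.
Fact sl_liexx A : sl_lie A A = 0.
Proof. by apply/val_inj => /=; rewrite subrr. Qed.
Fact sl_lie_jacobi A B C :
  sl_lie A (sl_lie B C) + sl_lie B (sl_lie C A) + sl_lie C (sl_lie A B) = 0.
Proof.
apply/val_inj => /=; rewrite !mulmxBl !mulmxBr !mulmxA !opprB.
set u := (A : 'M_n) *m B *m C; set v := (A : 'M_n) *m C *m B.
set w := (B : 'M_n) *m C *m A; set x := (C : 'M_n) *m B *m A.
set y := (B : 'M_n) *m A *m C; set z := (C : 'M_n) *m A *m B.
move: u v w x y z => u v w x y z.
by apply/matrixP => i j; rewrite !mxE; ring.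
Qed.

HB.instance Definition _ := Lmodule_isLieAlgebra.Build K sl
  sl_lie_linearl sl_lie_linearr sl_liexx sl_lie_jacobi.

End Sl.

(* Main.v *)
From HB Require Import structures.
Require Import Defs.
From mathcomp Require Import all_boot all_order all_algebra.
From mathcomp Require Import fingroup perm generic_quotient.
From mathcomp Require Import boolp classical_sets functions reals.
From mathcomp Require Import complex ring zify.

(** Write [e, f, h] for the basis of k, [x+, x-] and [y+, y-] for the weight
   vectors of the two k-stable nilradicals, and [g] for the second coroot.
   On vectors [v] with [e v = 0] and [h v = n v], the operators [x+],
   [(n + 1) x- - f x+], [y+] and [(n + 1) y- + f y+] preserve [e v = 0]
   and change [n] by 1, -1, 1 and -1. Applied to a highest weight vector of
   weight (a, b), the last two give vectors [v_(j,i)] (lower [j] times with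
   [y-], raise [i] times with [y+]) whose images under powers of [f] span, and
   the first two satisfy
     [x+ v_(j+1,i) = (j + 1) (a - j) (a + b + 1 - j) v_(j,i)],
     [((n + 1) x- - f x+) v_(j,i+1) = (i + 1) (b - i) (a + i + 2) v_(j,i)].
   Hence in a simple module [v_(j,i)] vanishes exactly when one of these
   factors has vanished before, and the multiplicities are obtained by counting
   the remaining [v_(j,i)] with [n = a + i - j].

   If [M] is bounded and [v] is a k-singular vector, the vectors
   [x+^i y+^(N-i) v], [0 <= i <= N], have the same [h]-weight and distinct
   [g]-weights, so one of them is zero for large [N]. The last nonzero vector
   before it is killed by [x+] or by [y+]; in the first case applying [x-]
   until it gives zero leads to a highest weight vector. The second case, and
   everything about L^-, is the first one for the simple roots [alpha1] and
   [- alpha1 - alpha2].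

   An arbitrary Cartan subalgebra reduces to the diagonal one since it contains
   some [t] with [alpha1 t = 1] and [alpha2 t = 2], and such a [t] must have
   three distinct eigenvalues. *)

Set Implicit Arguments.
Unset Strict Implicit.
Unset Printing Implicit Defensive.

Import Order.TTheory GRing.Theory Num.Theory.
Local Open Scope classical_set_scope.
Local Open Scope ring_scope.
Local Open Scope quotient_scope.

(** * Linear algebra *)

(** The modules F, L and V_k are selected by [the_mod], whose default is the zero module, so each
    needs an existence proof, for every complex b. Inside U(g) (x) F this would call for a PBW
    theorem; instead a coinduced module is written down explicitly, and one vector of it generates a
    simple module with highest weight (a, b). This module is the required quotient of the induced
    module, its string of f through the highest weight vector is F, and for a = k, b = 0 the same
    string is V_k.

    That v_(j,i) vanishes after a zero factor rests on [height], the action of E11 - E33, which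
    every lowering operator decreases. A zero factor a + b + 1 - j or b - i makes the next vector
    with i = 0, resp. j = 0, a highest weight vector of smaller height, whereas in a simple module
    two highest weight vectors generate each other and so have equal height. The factor a - j needs
    another reason: v_(a+1,0) would be k-singular of weight -1. Comparing heights also shows that
    two simple quotients of an induced module agree, without a weight decomposition of the induced
    module. *)

Section VectorExpr.
Variables (K : fieldType) (V : lmodType K).

Inductive vexpr : Type :=
| VAtom of nat
| VZero
| VAdd of vexpr & vexpr
| VOpp of vexpr
| VScale of K & vexpr.

Fixpoint veval (env : seq V) (x : vexpr) : V :=
  match x with
  | VAtom i => nth 0 env i
  | VZero => 0
  | VAdd x y => veval env x + veval env y
  | VOpp x => - veval env x
  | VScale a x => a *: veval env x
  end.

(** [eqn] rather than [==], so that [cbn] evaluates the Kronecker symbols when [vect] runs. *)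
Fixpoint vcoef (i : nat) (x : vexpr) : K :=
  match x with
  | VAtom j => (eqn i j)%:R
  | VZero => 0
  | VAdd x y => vcoef i x + vcoef i y
  | VOpp x => - vcoef i x
  | VScale a x => a * vcoef i x
  end.

Lemma veval_coef env x :
  veval env x = \sum_(i < size env) vcoef i x *: nth 0 env i.
Proof.
elim: x => /= [j||x -> y ->|x ->|a x ->].
- have [js|sj] := ltnP j (size env); last first.
    rewrite nth_default // big1 // => i _; rewrite eqnE; case: eqP => [ij|_]; rewrite ?scale0r //.
    by have := ltn_ord i; rewrite ij ltnNge sj.
  rewrite (bigD1 (Ordinal js)) //= eqnE eqxx scale1r big1 ?addr0 // => i /eqP ij.
  by case: eqP => [e|_]; rewrite ?scale0r //; case: ij; exact: ord_inj.
- by rewrite big1 // => i _; rewrite scale0r.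
- by rewrite -big_split; apply: eq_bigr => i _; rewrite /= scalerDl.
- by rewrite -sumrN; apply: eq_bigr => i _; rewrite /= scaleNr.
- by rewrite scaler_sumr; apply: eq_bigr => i _; rewrite scalerA.
Qed.

Fixpoint veq_coefs (n : nat) (x y : vexpr) : Prop :=
  if n is m.+1 then vcoef m x = vcoef m y /\ veq_coefs m x y else True.

Lemma veval_eq env x y :
  veq_coefs (size env) x y -> veval env x = veval env y.
Proof.
move=> h; rewrite !veval_coef; apply: eq_bigr => i _; congr (_ *: _).
move: h (ltn_ord i); move: (size env) (nat_of_ord i) => n k.
elim: n k => // n IHn k /= [h1 h2]; rewrite ltnS leq_eqVlt => /orP[/eqP->//|].
exact: IHn.
Qed.

End VectorExpr.

(* Syntactic comparison, completed by a conversion test if [b] is [true]. *)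
Ltac vsame b x y :=
  lazymatch x with
  | y => constr:(true)
  | _ =>
    lazymatch b with
    | true =>
      match constr:(Set) with
      | _ => let _ := constr:(erefl x : x = y) in constr:(true)
      | _ => constr:(false)
      end
    | false => constr:(false)
    end
  end.
Ltac vmem b x l :=
  lazymatch l with
  | nil => constr:(false)
  | cons ?y ?l' =>
    lazymatch vsame b x y with true => constr:(true) | _ => vmem b x l' end
  end.
Ltac vatoms b t env :=
  lazymatch t with
  | (?x + ?y)%R => let env := vatoms b x env in vatoms b y env
  | (- ?x)%R => vatoms b x env
  | (?a *: ?x)%R => vatoms b x env
  | 0%R => env
  | _ => lazymatch vmem b t env with true => env | _ => constr:(cons t env) end
  end.
Ltac vindex b x l :=
  lazymatch l with
  | cons ?y ?l' =>
    lazymatch vsame b x y with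
    | true => constr:(O)
    | _ => let n := vindex b x l' in constr:(S n)
    end
  end.
Ltac vreify b K t env :=
  lazymatch t with
  | (?x + ?y)%R =>
    let x' := vreify b K x env in let y' := vreify b K y env in
    constr:(VAdd x' y')
  | (- ?x)%R => let x' := vreify b K x env in constr:(VOpp x')
  | (?a *: ?x)%R => let x' := vreify b K x env in constr:(@VScale K a x')
  | 0%R => constr:(VZero K)
  | _ => let n := vindex b t env in constr:(VAtom K n)
  end.
Ltac vect_with b K V :=
  lazymatch goal with
  | |- ?s = ?s => reflexivity
  | |- ?s = ?t =>
    let env := vatoms b s (@nil V) in
    let env := vatoms b t env in
    let s' := vreify b K s env in
    let t' := vreify b K t env in
    change (@veval K V env s' = @veval K V env t');
    apply: veval_eq; cbn [veq_coefs size vcoef eqn nat_of_bool];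
    repeat (split; [by ring|]); exact: I
  end.
(* Decides an equality of vectors by comparing the coefficients of each atom. *)
Ltac vect K V := vect_with true K V.

(* Same as [linearD], ..., but not altering the instances in the statement,
   as [vect] identifies atoms syntactically. *)
Section LinearMaps.
Variables (K : fieldType) (V W : lmodType K) (T : {linear V -> W}).
Fact lin0 : T 0 = 0. Proof. exact: linear0. Qed.
Fact linD u v : T (u + v) = T u + T v. Proof. exact: linearD. Qed.
Fact linN v : T (- v) = - T v. Proof. exact: linearN. Qed.
Fact linZ a v : T (a *: v) = a *: T v. Proof. exact: linearZ. Qed.
Definition linE := (lin0, linD, linN, linZ).
End LinearMaps.

Section LinearAlgebra.
Variables (K : fieldType).
Implicit Types V W : lmodType K.

Lemma linear0_fun V W (f : V -> W) : linear f -> f 0 = 0.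
Proof. by move=> fl; have := fl (- 1) 0 0; rewrite !scaleN1r oppr0 addr0 addNr. Qed.
Lemma linearD_fun V W (f : V -> W) : linear f -> {morph f : u v / u + v}.
Proof. by move=> fl u v; rewrite -[u]scale1r fl !scale1r. Qed.
Lemma linearZ_fun V W (f : V -> W) : linear f -> forall a, {morph f : u / a *: u}.
Proof. by move=> fl a u; rewrite -[a *: u]addr0 fl linear0_fun ?addr0. Qed.
Lemma linearB_fun V W (f : V -> W) : linear f -> {morph f : u v / u - v}.
Proof. by move=> fl u v; rewrite addrC -scaleN1r fl scaleN1r addrC. Qed.
Lemma linear_sum_fun V W (f : V -> W) (n : nat) (c : 'I_n -> K) (e : 'I_n -> V) :
  linear f -> f (\sum_i c i *: e i) = \sum_i c i *: f (e i).
Proof.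
move=> fl; rewrite (big_morph f (linearD_fun fl) (linear0_fun fl)).
by apply: eq_bigr => i _; rewrite linearZ_fun.
Qed.

Definition free_family V n (e : 'I_n -> V) : Prop :=
  forall c : 'I_n -> K, \sum_i c i *: e i = 0 -> forall i, c i = 0.

Definition generates V (S : set V) n (e : 'I_n -> V) : Prop :=
  (forall i, S (e i)) /\ forall w, S w -> exists c : 'I_n -> K, w = \sum_i c i *: e i.

(** [S 0] is what turns uniqueness of coefficients into freeness: it is applied to the expansions of
    0. *)
Lemma has_dimP V (S : set V) n : S 0 ->
  has_dim S n <-> exists2 e : 'I_n -> V, generates S e & free_family e.
Proof.
move=> S0; split=> [[e [Se h]]|[e [Se g] fe]].
  exists e; first by split=> // w /h[c [-> _]]; exists c.
  move=> c c0 i; have [d [_ du]] := h _ S0.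
  have e1 : d = 0 by apply: du; rewrite big1 // => j _; rewrite ffunE scale0r.
  have e2 : d = [ffun j => c j].
    by apply: du; rewrite -[LHS]c0; apply: eq_bigr => j _; rewrite ffunE.
  by move: e1; rewrite e2 => /ffunP/(_ i); rewrite !ffunE.
exists e; split=> // w /g[c ->]; exists [ffun j => c j]; split.
  by apply: eq_bigr => j _; rewrite ffunE.
move=> d /eqP; rewrite -subr_eq0 -sumrB => /eqP h; apply/ffunP => i.
rewrite ffunE; apply/subr0_eq; apply: (fe (fun i => c i - d i)).
by rewrite -[RHS]h; apply: eq_bigr => j _; rewrite scalerBl.
Qed.

(** A vector in the left kernel of the coefficient matrix of [f] in terms of [e] is a relation
    between the [f i]; so the matrix has rank [m], at most its number [n] of columns. *)
Lemma free_generates_leq V (S : set V) n (e : 'I_n -> V) m (f : 'I_m -> V) :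
  generates S e -> (forall i, S (f i)) -> free_family f -> (m <= n)%N.
Proof.
move=> [_ g] Sf ff.
have /choice[c fc] : forall i, exists c : 'I_n -> K, f i = \sum_j c j *: e j.
  by move=> i; apply: g.
pose A : 'M[K]_(m, n) := \matrix_(i, j) c i j.
apply: leq_trans (rank_leq_col A); rewrite row_leq_rank -kermx_eq0.
apply/eqP/row_matrixP => i; apply/rowP => j.
rewrite row0 [RHS]mxE; apply: (ff (fun j => row i (kermx A) 0 j)) => {j}.
have kA : row i (kermx A) *m A = 0 by rewrite -row_mul mulmx_ker row0.
under eq_bigr => j _ do rewrite fc scaler_sumr.
rewrite exchange_big big1 //= => k _.
under eq_bigr => j _ do rewrite scalerA.
rewrite -scaler_suml; move/rowP/(_ k): kA; rewrite !mxE => kA.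
by under eq_bigr do [have -> : forall j, c j k = A j k by move=> ?; rewrite mxE]; rewrite kA scale0r.
Qed.

Lemma has_dim_uniq V (S : set V) m n : S 0 -> has_dim S m -> has_dim S n -> m = n.
Proof.
move=> S0 /(has_dimP _ S0)[e ge fe] /(has_dimP _ S0)[f gf ff].
apply/eqP; rewrite eqn_leq (free_generates_leq gf ge.1 fe).
exact: free_generates_leq ge gf.1 ff.
Qed.

(** Serves to replace a space of homomorphisms by the space of their values at one vector. *)
Lemma has_dim_transport V W (S : set V) (T : set W) (f : V -> W) n :
  subspace S -> linear f -> (forall v, S v -> T (f v)) ->
  (forall v, S v -> f v = 0 -> v = 0) ->
  (forall w, T w -> exists2 v, S v & f v = w) ->
  has_dim S n <-> has_dim T n.
Proof.
move=> sS fl ST inj surj; have S0 := sS.1.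
have T0 : T 0 by rewrite -(linear0_fun fl); apply: ST.
have S_sum (c : 'I_n -> K) (e : 'I_n -> V) : (forall i, S (e i)) -> S (\sum_i c i *: e i).
  move=> Se; elim/big_ind: _ => // [u v Su Sv|i _]; last by rewrite -[_ *: _]addr0; apply: sS.2.
  by rewrite -[u]scale1r; apply: sS.2.
split=> [/(has_dimP _ S0)[e [Se g] fe]|/(has_dimP _ T0)[e [Te g] fe]]; apply/has_dimP => //.
  exists (f \o e).
    split=> [i|w /surj[v /g[c ->] <-]]; first exact/ST/Se.
    by exists c; rewrite linear_sum_fun.
  by move=> c; rewrite -linear_sum_fun // => /inj h; apply: fe; apply/h/S_sum.
have /choice[s sE] : forall i, exists v, S v /\ f v = e i.
  by move=> i; have [v Sv fv] := surj _ (Te i); exists v.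
have s_sum c : f (\sum_i c i *: s i) = \sum_i c i *: e i.
  by rewrite linear_sum_fun //; apply: eq_bigr => i _; rewrite (sE i).2.
have Ss i : S (s i) := (sE i).1.
exists s; last by move=> c c0; apply: fe; rewrite -s_sum c0 linear0_fun.
split=> // w Sw; have [c fw] := g _ (ST _ Sw); exists c; apply/subr0_eq/inj.
  by rewrite addrC -scaleN1r; apply: sS.2 => //; apply: S_sum.
by rewrite addrC -scaleN1r fl s_sum fw scaleN1r addNr.
Qed.

Lemma generates_finite_dim V (S : set V) n (e : 'I_n -> V) :
  subspace S -> generates S e -> finite_dim S.
Proof.
move=> sS; elim: n e => [|n IHn] e ge.
  by exists 0%N; apply/(has_dimP _ sS.1); exists e => // c _ [].
have [fe|] := pselect (free_family e).
  by exists n.+1; apply/(has_dimP _ sS.1); exists e.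
move=> /existsNP[c /not_implyP[c0 /existsNP[i /eqP ci]]].
apply: (IHn (e \o lift i)); split=> [j|w /ge.2[d ->]]; first exact: ge.1.
have ei : e i = \sum_j (- (c i)^-1 * c (lift i j)) *: e (lift i j).
  move: c0; rewrite (bigD1_ord i) //= => /eqP; rewrite addr_eq0 => /eqP h.
  rewrite -[e i]scale1r -(mulVf ci) -scalerA h scalerN -scaleNr scaler_sumr.
  by apply: eq_bigr => j _; rewrite scalerA.
exists (fun j => d i * (- (c i)^-1 * c (lift i j)) + d (lift i j)).
rewrite (bigD1_ord i) //= {1}ei scaler_sumr -big_split.
by apply: eq_bigr => j _; rewrite /= scalerDl scalerA.
Qed.

End LinearAlgebra.

Lemma has_dim_eigenvector (C : numClosedFieldType) (V : lmodType C) (S : set V)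
    (T : V -> V) n :
  subspace S -> has_dim S n -> (exists2 v, S v & v != 0) ->
  (forall v, S v -> S (T v)) -> linear T ->
  exists c v, [/\ S v, v != 0 & T v = c *: v].
Proof.
move=> sS /(has_dimP _ sS.1)[e ge fe] [v Sv v0] ST Tl.
have n0 : (0 < n)%N.
  by case: n e ge {fe} => [|//] e ge; have [c vE] := ge.2 _ Sv; rewrite vE big_ord0 eqxx in v0.
have /choice[c Tc] : forall i, exists c : 'I_n -> C, T (e i) = \sum_j c j *: e j.
  by move=> i; apply: ge.2; apply: ST; apply: ge.1.
have [a /eigenvalueP[u uA u0]] := eigenvalue_closed (\matrix_(i, j) c i j) n0.
exists a, (\sum_i u 0 i *: e i); split.
- elim/big_ind: _ => [|x y Sx Sy|i _]; first exact: sS.1.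
    by rewrite -[x]scale1r; apply: sS.2.
  by rewrite -[_ *: _]addr0; apply: sS.2 => //; [apply: ge.1|apply: sS.1].
- apply: contra_neq u0 => /fe u0; apply/rowP => i; by rewrite u0 mxE.
rewrite linear_sum_fun //; under eq_bigr => i _ do rewrite Tc scaler_sumr.
rewrite exchange_big scaler_sumr; apply: eq_bigr => j _ /=.
under eq_bigr => i _ do rewrite scalerA.
rewrite -scaler_suml scalerA; congr (_ *: _).
by move/rowP/(_ j): uA; rewrite !mxE => <-; apply: eq_bigr => i _; rewrite mxE.
Qed.

Section Eigenvectors.
Variables (K : fieldType) (V : lmodType K) (T : {linear V -> V}).

(** Apply [T - c i] for the first index [i]: it kills [w i], rescales the other summands and
    multiplies [x] by [d - c i], which is not zero. *)
Lemma eigen_sum0 (I : eqType) (s : seq I) (w : I -> V) (c : I -> K) d x :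
  (forall i, i \in s -> T (w i) = c i *: w i /\ c i != d) ->
  T x = d *: x -> x = \sum_(i <- s) w i -> x = 0.
Proof.
elim: s w x => [|i s IHs] w x wE xd; first by rewrite big_nil.
rewrite big_cons => xE.
have [wi ci] := wE i (mem_head _ _).
suff : (d - c i) *: x = 0.
  by move/eqP; rewrite scaler_eq0 subr_eq0 eq_sym (negPf ci) => /eqP.
apply: (IHs (fun j => (c j - c i) *: w j)).
- move=> j js; have [wj cj] := wE j (mem_behead (s := i :: s) js); split=> //.
  by rewrite linearZ /= wj; vect K V.
- by rewrite linearZ /= xd; vect K V.
set y := \sum_(j <- s) w j in xE.
have -> : \sum_(j <- s) (c j - c i) *: w j = T y - c i *: y.
  rewrite linear_sum scaler_sumr -sumrB !big_seq; apply: eq_bigr => j js /=.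
  by have [-> _] := wE j (mem_behead (s := i :: s) js); rewrite scalerBl.
by rewrite scalerBl -xd xE linearD /= wi; vect K V.
Qed.

Lemma eigen_filter (I : eqType) (s : seq I) (w : I -> V) (c : I -> K) d x :
  (forall i, T (w i) = c i *: w i) ->
  T x = d *: x -> x = \sum_(i <- s) w i ->
  x = \sum_(i <- s | c i == d) w i.
Proof.
move=> wE xd xE; apply/subr0_eq.
apply: (@eigen_sum0 _ [seq i <- s | c i != d] w c d).
- by move=> i; rewrite mem_filter => /andP[].
- rewrite linearB /= xd scalerBr; congr (_ - _).
  by rewrite linear_sum scaler_sumr; apply: eq_bigr => i /eqP <-; rewrite wE.
- by rewrite xE (bigID (fun i => c i == d)) /= addrAC subrr add0r big_filter.
Qed.

Lemma eigen_free n (w : 'I_n -> V) (c : 'I_n -> K) :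
  injective c -> (forall i, w i != 0) -> (forall i, T (w i) = c i *: w i) ->
  free_family w.
Proof.
move=> ci w0 wE a a0 i; apply/eqP; move/eqP: (w0 i); apply: contra_notT => ai.
suff : a i *: w i = 0 by move/eqP; rewrite scaler_eq0 (negPf ai) => /eqP.
apply: (@eigen_sum0 _ [seq j <- index_enum 'I_n | j != i]
  (fun j => - (a j *: w j)) c (c i)).
- move=> j; rewrite mem_filter => /andP[ji _].
  by rewrite linearN linearZ /= wE (inj_eq ci) ji; split=> //; vect K V.
- by rewrite linearZ /= wE; vect K V.
- rewrite big_filter sumrN; apply/eqP; rewrite -addr_eq0; apply/eqP.
  by rewrite -[RHS]a0 [RHS](bigD1 i).
Qed.

Definition locally_nilpotent : set V := [set v | exists r, iter r T v = 0].

Lemma iter_linear r : linear (iter r T).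
Proof. by elim: r => [|r IHr] a u v //=; rewrite IHr linearP. Qed.

Lemma locally_nilpotent_subspace : subspace locally_nilpotent.
Proof.
split=> [|a u v [r ur] [s vs]]; first by exists 0%N.
exists (r + s)%N; rewrite iter_linear {1}addnC !iterD ur vs.
by rewrite !(linear0_fun (@iter_linear _)) scaler0 addr0.
Qed.

(** Since [T (c v)] is the commutator at [v] plus [c (T v)], and [T v] dies one step earlier, only
    the commutator has to be controlled. *)
Lemma locally_nilpotent_closed (c : V -> V) :
  (forall v, locally_nilpotent v -> locally_nilpotent (T (c v) - c (T v))) ->
  c 0 = 0 ->
  forall v, locally_nilpotent v -> locally_nilpotent (c v).
Proof.
move=> h c0 v [r]; elim: r v => [|r IHr] v; first by move=> /= ->; rewrite c0; exists 0%N.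
rewrite iterSr => vr; have Tv : locally_nilpotent (T v) by exists r.
have cTv := IHr _ vr.
have vN : locally_nilpotent v by exists r.+1; rewrite iterSr.
have : locally_nilpotent (T (c v)).
  rewrite -[T (c v)](subrK (c (T v))) -[_ - _]scale1r.
  exact: locally_nilpotent_subspace.2 (h _ vN) cTv.
by case=> s sE; exists s.+1; rewrite iterSr.
Qed.

End Eigenvectors.

(** * Representations of sl(2) *)

Section Sl2.
Variables (K : numFieldType) (V : lmodType K) (e f h : {linear V -> V}).
Hypothesis he : forall v, h (e v) = e (h v) + 2%:R *: e v.
Hypothesis hf : forall v, h (f v) = f (h v) - 2%:R *: f v.
Hypothesis ef : forall v, e (f v) = f (e v) + h v.

Lemma h_iter_f c v k : h v = c *: v -> h (iter k f v) = (c - (2 * k)%:R) *: iter k f v.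
Proof.
move=> hv; elim: k => [|k IHk] /=; first by rewrite subr0.
by rewrite hf IHk linearZ /= mulnS natrD; vect K V.
Qed.

Lemma h_iter_e c v k : h v = c *: v -> h (iter k e v) = (c + (2 * k)%:R) *: iter k e v.
Proof.
move=> hv; elim: k => [|k IHk] /=; first by rewrite addr0.
by rewrite he IHk linearZ /= mulnS natrD; vect K V.
Qed.

Lemma e_iter_f c v k : e v = 0 -> h v = c *: v ->
  e (iter k.+1 f v) = (k.+1%:R * (c - k%:R)) *: iter k f v.
Proof.
move=> ev hv; elim: k => [|k IHk]; first by rewrite /= ef ev linear0 add0r hv subr0 mul1r.
rewrite (iterS k.+1) ef IHk linearZ (h_iter_f k.+1 hv) /= -(nat1r k.+1) -(nat1r k) natrM.
by rewrite -iterS -nat1r; vect K V.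
Qed.

(** If [f^(n+1) v] is the first vanishing iterate, applying [e] to it gives
    [(n + 1) (c - n) f^n v = 0], hence [c = n]. *)
Lemma singular_weight c v r : v != 0 -> e v = 0 -> h v = c *: v ->
  iter r f v = 0 ->
  exists n, [/\ c = n%:R, iter n.+1 f v = 0 & forall k, (k <= n)%N -> iter k f v != 0].
Proof.
move=> v0 ev hv fr.
have ex : exists r, iter r f v == 0 by exists r; apply/eqP.
case: (ex_minnP ex) => -[|n]; first by rewrite /= (negPf v0).
move=> /eqP fn mn.
have nz k : (k <= n)%N -> iter k f v != 0.
  by move=> kn; apply/negP => /mn; rewrite ltnNge kn.
exists n; split=> //; have := e_iter_f n ev hv; rewrite fn linear0 => /esym/eqP.
rewrite scaler_eq0 (negPf (nz n _)) // orbF mulf_eq0 pnatr_eq0 /= subr_eq0.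
by move/eqP.
Qed.

Lemma iter_f_neq0 n v k : v != 0 -> e v = 0 -> h v = n%:R *: v ->
  (k <= n)%N -> iter k f v != 0.
Proof.
move=> v0 ev hv; elim: k => // k IHk kn.
apply: contra_neq (IHk (ltnW kn)) => fk0.
have := e_iter_f k ev hv; rewrite fk0 linear0 => /esym/eqP.
rewrite scaler_eq0 mulf_eq0 pnatr_eq0 /= subr_eq0 eqr_nat eq_sym ltn_eqF //.
by move/eqP.
Qed.

Lemma iter_f_free n v m : v != 0 -> e v = 0 -> h v = n%:R *: v -> (m <= n.+1)%N ->
  free_family (fun i : 'I_m => iter i f v).
Proof.
move=> v0 ev hv mn.
apply: (@eigen_free _ _ h _ _ (fun i => n%:R - (2 * i)%:R)).
- move=> i j /= /addrI/oppr_inj/eqP; rewrite eqr_nat eqn_mul2l /= => /eqP.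
  exact: ord_inj.
- by move=> i; apply: (iter_f_neq0 v0 ev hv); rewrite -ltnS (leq_trans (ltn_ord i)).
- by move=> i; apply: h_iter_f.
Qed.

(** Nonzero iterates have distinct [h]-eigenvalues, so [d + 1] of them would be independent in a
    space of dimension [d]. *)
Lemma has_dim_nilpotent (S : set V) d (T : {linear V -> V}) c s v :
  subspace S -> has_dim S d -> s != 0 ->
  S v -> (forall v, S v -> S (T v)) ->
  (forall k, h (iter k T v) = (c + s * k%:R) *: iter k T v) ->
  exists r, iter r T v = 0.
Proof.
move=> sS /(has_dimP _ sS.1)[b gb fb] s0 Sv ST hT; apply/not_existsP => nz.
have ST' k : S (iter k T v) by elim: k => //= k; apply: ST.
suff /(free_generates_leq gb (fun i => ST' i)) :
  free_family (fun i : 'I_d.+1 => iter i T v) by rewrite ltnn.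
apply: (@eigen_free _ _ h _ _ (fun i => c + s * i%:R)) => [i j|i|i]; last 1 first.
- exact: hT.
- move=> /addrI/(mulfI s0)/eqP; rewrite eqr_nat => /eqP; exact: ord_inj.
- by apply/eqP; apply: nz.
Qed.

Lemma has_dim_singular_weight (S : set V) d c v :
  subspace S -> has_dim S d -> (forall v, S v -> S (f v)) ->
  S v -> v != 0 -> e v = 0 -> h v = c *: v ->
  exists2 n, c = n%:R & iter n.+1 f v = 0.
Proof.
move=> sS dS Sf Sv v0 ev hv.
have s0 : - 2%:R != 0 :> K by rewrite oppr_eq0 pnatr_eq0.
have hk k : h (iter k f v) = (c + (- 2%:R) * k%:R) *: iter k f v.
  by rewrite (h_iter_f k hv) natrM mulNr.
have [r fr] := has_dim_nilpotent sS dS s0 Sv Sf hk.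
by have [n [-> ? _]] := singular_weight v0 ev hv fr; exists n.
Qed.

(** Applying [e] shortens the combination. If the result is 0, all coefficients except that of [v]
    vanish, because the factors [(i + 1) (n - i)] do not, and the vector is already a multiple of
    [v]. *)
Lemma iter_f_span_simple n v (W : set V) (c : nat -> K) m : v != 0 -> e v = 0 -> h v = n%:R *: v ->
  (m <= n)%N -> subspace W -> (forall w, W w -> W (e w)) ->
  W (\sum_(i < m.+1) c i *: iter i f v) -> \sum_(i < m.+1) c i *: iter i f v != 0 -> W v.
Proof.
move=> v0 ev hv mn sW We; elim: m mn c => [|m IHm] mn c.
  rewrite big_ord1 /= => Wv; have [->|c0 _] := eqVneq (c 0%N) 0; first by rewrite scale0r eqxx.
  rewrite -[v]scale1r -(mulVf c0) -scalerA -[_ *: (c _ *: _)]addr0.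
  by apply: sW.2 => //; apply: sW.1.
set w := \sum_(i < _) _ => Ww w0.
have ewE : e w = \sum_(i < m.+1) (c i.+1 * (i.+1%:R * (n%:R - i%:R))) *: iter i f v.
  rewrite /w big_ord_recl /= linearD linearZ /= ev scaler0 add0r linear_sum.
  by apply: eq_bigr => i _; rewrite linearZZ -iterS (e_iter_f i ev hv) scalerA.
have [ew0|] := eqVneq (e w) 0; last first.
  by rewrite ewE => ?; apply: (IHm (ltnW mn) (fun i => c i.+1 * (i.+1%:R * (n%:R - i%:R)))) => //; rewrite -ewE; apply: We.
have cE i : (i < m.+1)%N -> c i.+1 = 0.
  move=> im; move: ew0; rewrite ewE => /(iter_f_free v0 ev hv (leqW mn)).
  move=> /(_ (Ordinal im)) /= /eqP; rewrite !mulf_eq0 pnatr_eq0 /= subr_eq0 eqr_nat.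
  by rewrite [n == i]gtn_eqF ?orbF ?(leq_trans im) // => /eqP.
have wE : w = c 0%N *: v.
  by rewrite /w big_ord_recl big1 ?addr0 // => i _; rewrite /= cE ?scale0r ?ltn_ord.
have c0 : c 0%N != 0 by apply: contra_neq w0; rewrite wE => ->; rewrite scale0r.
rewrite -[v]scale1r -(mulVf c0) -scalerA -wE -[_ *: w]addr0.
by apply: sW.2 => //; apply: sW.1.
Qed.

End Sl2.

Lemma has_dim_singular (C : numClosedFieldType) (V : lmodType C)
    (e f h : {linear V -> V}) (S : set V) d :
  (forall v, h (e v) = e (h v) + 2%:R *: e v) ->
  (forall v, h (f v) = f (h v) - 2%:R *: f v) ->
  (forall v, e (f v) = f (e v) + h v) ->
  subspace S -> has_dim S d -> (forall v, S v -> S (e v)) ->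
  (forall v, S v -> S (f v)) -> (forall v, S v -> S (h v)) ->
  (exists2 v, S v & v != 0) ->
  exists n v, [/\ S v, v != 0, e v = 0, h v = n%:R *: v & iter n.+1 f v = 0].
Proof.
move=> he hf ef sS dS Se Sf Sh nS.
have [c [v [Sv v0 hv]]] := has_dim_eigenvector sS dS nS Sh (linearP h).
have s0 : 2%:R != 0 :> C by rewrite pnatr_eq0.
have hk k : h (iter k e v) = (c + 2%:R * k%:R) *: iter k e v.
  by rewrite (h_iter_e he k hv) natrM.
have [r er] := has_dim_nilpotent sS dS s0 Sv Se hk.
have ex : exists r, iter r e v == 0 by exists r; apply/eqP.
case: (ex_minnP ex) => -[|n]; first by rewrite /= (negPf v0).
move=> /eqP en mn; set w := iter n e v.
have w0 : w != 0 by apply/negP => /mn; rewrite ltnn.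
have Sw : S w by rewrite /w; elim: (n) => //= k; apply: Se.
have ew : e w = 0 by [].
have [m cE fm] := has_dim_singular_weight hf ef sS dS Sf Sw w0 ew (hk n).
by exists m, w; split=> //; rewrite -cE; apply: hk.
Qed.

(** * Representations of sl(3) *)

(* A representation of sl(3) in terms of the matrix units
   [e = E12], [f = E21], [xp = E13], [xm = E23], [yp = E32], [ym = E31]
   and of [h = E11 - E22], [g = E22 - E33]. The signs in [xp], ..., [ym] are
   those of the [h]-weights: [xp, xm] span the nilradical of the parabolic
   subalgebra and [yp, ym] that of the opposite one. *)
Record sl3_rep (K : fieldType) (V : lmodType K) := Sl3Rep {
  e_ : {linear V -> V}; f_ : {linear V -> V};
  h_ : {linear V -> V}; g_ : {linear V -> V};
  xp_ : {linear V -> V}; xm_ : {linear V -> V};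
  yp_ : {linear V -> V}; ym_ : {linear V -> V};
  r_he : forall v, h_ (e_ v) = e_ (h_ v) + 2%:R *: e_ v;
  r_hf : forall v, h_ (f_ v) = f_ (h_ v) - 2%:R *: f_ v;
  r_hxp : forall v, h_ (xp_ v) = xp_ (h_ v) + xp_ v;
  r_hxm : forall v, h_ (xm_ v) = xm_ (h_ v) - xm_ v;
  r_hyp : forall v, h_ (yp_ v) = yp_ (h_ v) + yp_ v;
  r_hym : forall v, h_ (ym_ v) = ym_ (h_ v) - ym_ v;
  r_ge : forall v, g_ (e_ v) = e_ (g_ v) - e_ v;
  r_gf : forall v, g_ (f_ v) = f_ (g_ v) + f_ v;
  r_gxp : forall v, g_ (xp_ v) = xp_ (g_ v) + xp_ v;
  r_gxm : forall v, g_ (xm_ v) = xm_ (g_ v) + 2%:R *: xm_ v;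
  r_gyp : forall v, g_ (yp_ v) = yp_ (g_ v) - 2%:R *: yp_ v;
  r_gym : forall v, g_ (ym_ v) = ym_ (g_ v) - ym_ v;
  r_gh : forall v, g_ (h_ v) = h_ (g_ v);
  r_ef : forall v, e_ (f_ v) = f_ (e_ v) + h_ v;
  r_exp : forall v, e_ (xp_ v) = xp_ (e_ v);
  r_exm : forall v, e_ (xm_ v) = xm_ (e_ v) + xp_ v;
  r_eyp : forall v, e_ (yp_ v) = yp_ (e_ v);
  r_eym : forall v, e_ (ym_ v) = ym_ (e_ v) - yp_ v;
  r_xpf : forall v, xp_ (f_ v) = f_ (xp_ v) - xm_ v;
  r_xmf : forall v, xm_ (f_ v) = f_ (xm_ v);
  r_ypf : forall v, yp_ (f_ v) = f_ (yp_ v) + ym_ v;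
  r_ymf : forall v, ym_ (f_ v) = f_ (ym_ v);
  r_xpxm : forall v, xp_ (xm_ v) = xm_ (xp_ v);
  r_ypym : forall v, yp_ (ym_ v) = ym_ (yp_ v);
  r_xpyp : forall v, xp_ (yp_ v) = yp_ (xp_ v) + e_ v;
  r_xpym : forall v, xp_ (ym_ v) = ym_ (xp_ v) + h_ v + g_ v;
  r_xmyp : forall v, xm_ (yp_ v) = yp_ (xm_ v) + g_ v;
  r_xmym : forall v, xm_ (ym_ v) = ym_ (xm_ v) + f_ v
}.

Section Rep.
Variables (K : numFieldType) (V : lmodType K) (rho : sl3_rep V).
Local Notation e := (e_ rho).
Local Notation f := (f_ rho).
Local Notation h := (h_ rho).
Local Notation g := (g_ rho).
Local Notation xp := (xp_ rho).
Local Notation xm := (xm_ rho).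
Local Notation yp := (yp_ rho).
Local Notation ym := (ym_ rho).

(** Used from left to right, the relations bring every monomial to the order f, ym, yp, xm, xp, e,
    h, g. Applied to a singular vector, both sides of an identity then become combinations of the
    same atoms, which [vect] compares. *)
Definition pbwE := ((r_he rho, r_hf rho, r_hxp rho, r_hxm rho, r_hyp rho, r_hym rho),
  (r_ge rho, r_gf rho, r_gxp rho, r_gxm rho, r_gyp rho, r_gym rho, r_gh rho),
  (r_ef rho, r_exp rho, r_exm rho, r_eyp rho, r_eym rho),
  (r_xpf rho, r_xmf rho, r_ypf rho, r_ymf rho, r_xpxm rho, r_ypym rho),
  (r_xpyp rho, r_xpym rho, r_xmyp rho, r_xmym rho)).

Definition rep_linE := ((linE e, linE f, linE h, linE g), (linE xp, linE xm, linE yp, linE ym)).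

Definition singular n c v := [/\ e v = 0, h v = n *: v & g v = c *: v].

(** The projection [1 - f e / (h + 2)] to the vectors killed by [e], applied to [xm v] and
    multiplied by [n + 1] to clear the denominator; [lower_y] is the same for [ym v]. *)
Definition lower_x n v := (n + 1) *: xm v - f (xp v).
Definition lower_y n v := (n + 1) *: ym v + f (yp v).

Ltac normal_on ev hv gv :=
  rewrite /lower_x /lower_y ?(rep_linE, pbwE, ev, hv, gv).

Lemma singular_xp n c v : singular n c v -> singular (n + 1) (c + 1) (xp v).
Proof. by move=> [ev hv gv]; split; normal_on ev hv gv; vect K V. Qed.

Lemma singular_yp n c v : singular n c v -> singular (n + 1) (c - 2%:R) (yp v).
Proof. by move=> [ev hv gv]; split; normal_on ev hv gv; vect K V. Qed.

Lemma singular_lower_y n c v : singular n c v -> singular (n - 1) (c - 1) (lower_y n v).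
Proof. by move=> [ev hv gv]; split; normal_on ev hv gv; vect K V. Qed.

Lemma xp_yp n c v : singular n c v -> xp (yp v) = yp (xp v).
Proof. by move=> [ev hv gv]; normal_on ev hv gv; vect K V. Qed.

Lemma yp_lower_y n c v : singular n c v -> yp (lower_y n v) = lower_y (n + 1) (yp v).
Proof. by move=> [ev hv gv]; normal_on ev hv gv; vect K V. Qed.

Lemma lower_x_lower_y n c v : singular n c v ->
  lower_x (n - 1) (lower_y n v) = lower_y (n - 1) (lower_x n v).
Proof. by move=> [ev hv gv]; normal_on ev hv gv; vect K V. Qed.

(** The right-hand side uses only operators that preserve singular vectors. Along the vectors below
    this becomes a recursion whose scalar terms add up to the factor of [xp]; [lower_x_yp] plays
    this role for the other direction. *)
Lemma xp_lower_y n c v : singular n c v ->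
  (n + 1) *: xp (lower_y n v) = ((n + 1) * ((n + 1) * (n + c) - c)) *: v
    + n *: lower_y (n + 1) (xp v) - yp (lower_x n v).
Proof. by move=> [ev hv gv]; normal_on ev hv gv; vect K V. Qed.

Lemma lower_x_yp n c v : singular n c v ->
  (n + 1) *: lower_x (n + 1) (yp v) = ((n + 1) * (n + 2%:R) * c) *: v
    + (n + 2%:R) *: yp (lower_x n v) + lower_y (n + 1) (xp v).
Proof. by move=> [ev hv gv]; normal_on ev hv gv; vect K V. Qed.

End Rep.

Section Subspace.
Variables (K : fieldType) (V : lmodType K) (S : set V).
Hypothesis sS : subspace S.
Lemma subspaceD u v : S u -> S v -> S (u + v).
Proof. by move=> Su Sv; rewrite -[u]scale1r; apply: sS.2. Qed.
Lemma subspaceZ a u : S u -> S (a *: u).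
Proof. by move=> Su; rewrite -[_ *: _]addr0; apply: sS.2 => //; apply: sS.1. Qed.
Lemma subspaceN u : S u -> S (- u).
Proof. by rewrite -scaleN1r; apply: subspaceZ. Qed.
Lemma subspaceB u v : S u -> S v -> S (u - v).
Proof. by move=> Su /subspaceN; apply: subspaceD. Qed.
Lemma subspace_sum (I : Type) (r : seq I) (P : pred I) (F : I -> V) :
  (forall i, P i -> S (F i)) -> S (\sum_(i <- r | P i) F i).
Proof.
move=> h; elim/big_ind: _ => //; first exact: sS.1.
exact: subspaceD.
Qed.
End Subspace.

Section FamilySpan.
Variables (K : fieldType) (V : lmodType K) (I : eqType) (w : I -> V).

Definition family_span : set V :=
  [set m | exists s : seq (K * I), m = \sum_(x <- s) x.1 *: w x.2].

Lemma family_span_subspace : subspace family_span.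
Proof.
split=> [|a u v [s ->] [t ->]]; first by exists [::]; rewrite big_nil.
exists ([seq (a * x.1, x.2) | x <- s] ++ t).
rewrite big_cat big_map /= scaler_sumr; congr (_ + _).
by apply: eq_bigr => x _; rewrite scalerA.
Qed.

Lemma family_span_mem i : family_span (w i).
Proof. by exists [:: (1, i)]; rewrite big_seq1 scale1r. Qed.

Lemma family_span_stable (T : {linear V -> V}) :
  (forall i, family_span (T (w i))) -> forall v, family_span v -> family_span (T v).
Proof.
move=> h v [s ->]; rewrite linear_sum; apply: (subspace_sum family_span_subspace) => x _.
by rewrite (linZ T); apply: subspaceZ (h _); apply: family_span_subspace.
Qed.

End FamilySpan.

(** * Weights below a highest weight and the submodules generated by lowering *)

Section WeightsBelow.
Variables (K : numFieldType) (V : lmodType K) (T : {linear V -> V}).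

(** Takes the place of a weight decomposition: sums of eigenvectors of [T] with eigenvalues in
    [mu - nat], as lists because the number of summands is not fixed. *)
Definition below (mu : K) : set V :=
  [set m | exists2 s : seq (nat * V),
     forall x, x \in s -> T x.2 = (mu - x.1%:R) *: x.2
   & m = \sum_(x <- s) x.2].

Lemma below_subspace mu : subspace (below mu).
Proof.
split=> [|a u v [s sE ->] [t tE ->]]; first by exists [::]; rewrite ?big_nil.
exists ([seq (x.1, a *: x.2) | x <- s] ++ t).
  move=> x; rewrite mem_cat => /orP[/mapP[y ys ->]|/tE//] /=.
  by rewrite (linZ T) sE // !scalerA mulrC.
by rewrite big_cat big_map /= scaler_sumr.
Qed.

Lemma below_eigen mu m : T m = mu *: m -> below mu m.
Proof.
move=> Tm; exists [:: (0%N, m)]; last by rewrite big_seq1.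
by move=> x; rewrite inE => /eqP -> /=; rewrite subr0.
Qed.

Lemma below_lower mu k (c : {linear V -> V}) :
  (forall v, T (c v) = c (T v) - k%:R *: c v) ->
  forall m, below mu m -> below (mu - k%:R) (c m).
Proof.
move=> cT m [s sE ->]; exists [seq (x.1, c x.2) | x <- s].
  move=> x /mapP[y ys ->] /=; rewrite cT sE // (linZ c); vect K V.
by rewrite big_map linear_sum.
Qed.

Lemma below_le mu k m : below (mu - k%:R) m -> below mu m.
Proof.
move=> [s sE ->]; exists [seq ((x.1 + k)%N, x.2) | x <- s]; last by rewrite big_map.
by move=> x /mapP[y ys ->] /=; rewrite sE // natrD; vect K V.
Qed.

Lemma below_weight mu nu m : below mu m -> T m = nu *: m -> m != 0 ->
  exists k : nat, nu = mu - k%:R.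
Proof.
move=> [s sE mE] Tm m0; apply/not_existsP => h; case/eqP: m0.
apply: (@eigen_sum0 _ _ T _ s snd (fun x => mu - x.1%:R) nu) => // x xs.
by rewrite sE //; split=> //; apply/eqP => /esym; apply: h.
Qed.

End WeightsBelow.

Section LowerHull.
Variables (K : numFieldType) (V : lmodType K) (rho : sl3_rep V).
Local Notation e := (e_ rho).
Local Notation f := (f_ rho).
Local Notation h := (h_ rho).
Local Notation g := (g_ rho).
Local Notation xp := (xp_ rho).
Local Notation xm := (xm_ rho).
Local Notation yp := (yp_ rho).
Local Notation ym := (ym_ rho).

Inductive rep_op : {linear V -> V} -> Prop :=
| op_e : rep_op e | op_f : rep_op f | op_h : rep_op h | op_g : rep_op g
| op_xp : rep_op xp | op_xm : rep_op xm | op_yp : rep_op yp | op_ym : rep_op ym.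

Definition rep_stable (W : set V) : Prop :=
  subspace W /\ forall T v, rep_op T -> W v -> W (T v).

Definition rep_simple : Prop :=
  forall W, rep_stable W -> (exists2 w, W w & w != 0) -> forall v, W v.

Definition hw_vector n c v := [/\ singular rho n c v, xp v = 0 & xm v = 0].

(** This is U(n^-) w, described by closure so that no PBW basis is needed. For a highest weight
    vector it is the submodule generated by [w]. *)
Inductive lower_hull (w : V) : set V :=
| hull_base : lower_hull w w
| hull_lin a u v : lower_hull w u -> lower_hull w v -> lower_hull w (a *: u + v)
| hull_f v : lower_hull w v -> lower_hull w (f v)
| hull_yp v : lower_hull w v -> lower_hull w (yp v)
| hull_ym v : lower_hull w v -> lower_hull w (ym v).

Lemma lower_hull_subspace w : subspace (lower_hull w).
Proof.
split; last exact: hull_lin.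
rewrite (_ : 0 = (-1) *: w + w); first by apply: hull_lin; apply: hull_base.
by rewrite scaleN1r addNr.
Qed.

Lemma lower_hull_sub w (W : set V) : rep_stable W -> W w -> lower_hull w `<=` W.
Proof.
move=> [sW Wop] Ww m; elim=> // {m} [a u v _ Wu _ Wv|m _|m _|m _]; first exact: sW.2.
- by apply: Wop; apply: op_f.
- by apply: Wop; apply: op_yp.
- by apply: Wop; apply: op_ym.
Qed.

Lemma lower_hull_stable n c w : hw_vector n c w -> rep_stable (lower_hull w).
Proof.
move=> [[ew hw gw] xpw xmw]; have sX := lower_hull_subspace w.
pose X := lower_hull w.
(* Brackets with the lowering operators mix the remaining ones ([xp] with [yp] gives [e], with [ym]
   gives [h + g]), so all closure properties go into one induction. *)
pose good m := [/\ X m, X (e m), X (h m) & [/\ X (g m), X (xp m) & X (xm m)]].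
suff Xgood m : X m -> good m.
  split=> // T m opT Xm; have [? ? ? [? ? ?]] := Xgood _ Xm.
  by case: opT => //; [apply: hull_f|apply: hull_yp|apply: hull_ym].
have X0 : X 0 by apply: sX.1.
have XD := subspaceD sX; have XB := subspaceB sX; have XZ := subspaceZ sX.
rewrite /X; elim=> {m} [|a u v _ [? ? ? [? ? ?]] _ [? ? ? [? ? ?]]|m _|m _|m _].
- split; rewrite ?ew ?hw ?gw ?xpw ?xmw //; first exact: hull_base.
    by apply: XZ; apply: hull_base.
  by split=> //; apply: XZ; apply: hull_base.
- by do ![split]; rewrite ?linearP; apply: hull_lin.
- move=> [Xm Xe Xh [Xg Xxp Xxm]]; have Xf := hull_f Xm.
  split; rewrite ?r_ef ?r_hf; [by []|exact/XD/Xh/hull_f|exact/XB/XZ/Xf/hull_f|].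
  split; rewrite ?r_gf ?r_xpf ?r_xmf; [exact/XD/Xf/hull_f|exact/XB/Xxm/hull_f|exact: hull_f].
- move=> [Xm Xe Xh [Xg Xxp Xxm]]; have Xy := hull_yp Xm.
  split; rewrite ?r_eyp ?r_hyp; [by []|exact: hull_yp|exact/XD/Xy/hull_yp|].
  by split; rewrite ?r_gyp ?r_xpyp ?r_xmyp;
    [exact/XB/XZ/Xy/hull_yp|exact/XD/Xe/hull_yp|exact/XD/Xg/hull_yp].
- move=> [Xm Xe Xh [Xg Xxp Xxm]]; have Xy := hull_ym Xm.
  split; rewrite ?r_eym ?r_hym; [by []|exact/XB/hull_yp/Xm/hull_ym|exact/XB/Xy/hull_ym|].
  split; rewrite ?r_gym ?r_xpym ?r_xmym; first exact/XB/Xy/hull_ym.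
    by apply/XD => //; apply/XD => //; apply: hull_ym.
  exact/XD/hull_f/Xm/hull_ym.
Qed.

(** The action of E11 - E33, which [f] and [yp] lower by 1 and [ym] by 2. *)
Definition height : {linear V -> V} := (h \+ g)%R.

Lemma hw_height n c w : hw_vector n c w -> height w = (n + c) *: w.
Proof. by move=> [[_ hw gw] _ _]; rewrite /= hw gw; vect K V. Qed.

Lemma lower_hull_below n c w m : hw_vector n c w -> lower_hull w m ->
  exists k q, below height (n + c - 1) q /\ m = k *: w + q.
Proof.
move=> hww; have wE := hw_height hww.
have sB := below_subspace height (n + c - 1).
have low k (T : {linear V -> V}) v : (0 < k)%N -> (forall v, height (T v) = T (height v) - k%:R *: T v) ->
    (exists k q, below height (n + c - 1) q /\ v = k *: w + q) ->
    exists k q, below height (n + c - 1) q /\ T v = k *: w + q.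
  move=> k0 hT [d [q [Bq ->]]]; exists 0, (d *: T w + T q); split; last first.
    by rewrite (linD T) (linZ T) scale0r add0r.
  apply: sB.2; last exact/(@below_le _ _ _ _ k)/below_lower.
  apply: (@below_le _ _ _ _ k.-1); rewrite -addrA -opprD nat1r prednK //.
  by apply: below_lower hT _ _; apply: below_eigen.
elim=> {m} [|d u v _ [k [q [Bq ->]]] _ [k' [q' [Bq' ->]]]|m _|m _|m _].
- by exists 1, 0; split; [apply: sB.1|rewrite scale1r addr0].
- exists (d * k + k'), (d *: q + q'); split; first exact: sB.2.
  by vect K V.
- by apply: (low 1%N) => // v; rewrite /= r_hf r_gf (linD (f_ rho)); vect K V.
- by apply: (low 1%N) => // v; rewrite /= r_hyp r_gyp (linD (yp_ rho)); vect K V.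
- by apply: (low 2) => // v; rewrite /= r_hym r_gym (linD (ym_ rho)); vect K V.
Qed.

(** [ad f] is nilpotent on sl(3): in the order used here the bracket of [f] with each operator is 0
    or a combination of operators already treated. The same scheme gives the three lemmas that
    follow. *)
Lemma locally_nilpotent_f : rep_stable (locally_nilpotent f).
Proof.
have sL := locally_nilpotent_subspace f; split=> // T v opT; move: T opT v.
have cl (T : {linear V -> V}) : (forall v, locally_nilpotent f v -> locally_nilpotent f (f (T v) - T (f v))) ->
    forall v, locally_nilpotent f v -> locally_nilpotent f (T v).
  by move=> hT; apply: locally_nilpotent_closed => //; apply: linear0.
have cf : forall v, locally_nilpotent f v -> locally_nilpotent f (f v).
  by apply: cl => v _; rewrite subrr; apply: sL.1.
have cym : forall v, locally_nilpotent f v -> locally_nilpotent f (ym v).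
  by apply: cl => v _; rewrite r_ymf subrr; apply: sL.1.
have cxm : forall v, locally_nilpotent f v -> locally_nilpotent f (xm v).
  by apply: cl => v _; rewrite r_xmf subrr; apply: sL.1.
have ch : forall v, locally_nilpotent f v -> locally_nilpotent f (h v).
  by apply: cl => v /cf /(subspaceZ sL 2%:R); rewrite r_hf opprB addrC subrK.
move=> T; case=> //.
- by apply: cl => v /ch /(subspaceN sL); rewrite r_ef opprD addrA subrr add0r.
- by apply: cl => v /cf /(subspaceN sL); rewrite r_gf opprD addrA subrr add0r.
- by apply: cl => v /cxm; rewrite r_xpf opprB addrC subrK.
- by apply: cl => v /cym /(subspaceN sL); rewrite r_ypf opprD addrA subrr add0r.
Qed.

Lemma locally_nilpotent_e : rep_stable (locally_nilpotent e).
Proof.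
have sL := locally_nilpotent_subspace e; split=> // T v opT; move: T opT v.
have cl (T : {linear V -> V}) : (forall v, locally_nilpotent e v -> locally_nilpotent e (e (T v) - T (e v))) ->
    forall v, locally_nilpotent e v -> locally_nilpotent e (T v).
  by move=> hT; apply: locally_nilpotent_closed => //; apply: linear0.
have ce : forall v, locally_nilpotent e v -> locally_nilpotent e (e v).
  by apply: cl => v _; rewrite subrr; apply: sL.1.
have cxp : forall v, locally_nilpotent e v -> locally_nilpotent e (xp v).
  by apply: cl => v _; rewrite r_exp subrr; apply: sL.1.
have cyp : forall v, locally_nilpotent e v -> locally_nilpotent e (yp v).
  by apply: cl => v _; rewrite r_eyp subrr; apply: sL.1.
have ch : forall v, locally_nilpotent e v -> locally_nilpotent e (h v).
  apply: cl => v /ce /(subspaceZ sL 2%:R) /(subspaceN sL).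
  by rewrite r_he opprD addrA subrr add0r.
move=> T; case=> //.
- by apply: cl => v /ch; rewrite r_ef addrC addKr.
- by apply: cl => v /ce; rewrite r_ge opprB addrC subrK.
- by apply: cl => v /cxp; rewrite r_exm addrC addKr.
- by apply: cl => v /cyp /(subspaceN sL); rewrite r_eym addrC addKr.
Qed.

Lemma locally_nilpotent_xp : rep_stable (locally_nilpotent xp).
Proof.
have sL := locally_nilpotent_subspace xp; split=> // T v opT; move: T opT v.
have cl (T : {linear V -> V}) : (forall v, locally_nilpotent xp v -> locally_nilpotent xp (xp (T v) - T (xp v))) ->
    forall v, locally_nilpotent xp v -> locally_nilpotent xp (T v).
  by move=> hT; apply: locally_nilpotent_closed => //; apply: linear0.
have cxp : forall v, locally_nilpotent xp v -> locally_nilpotent xp (xp v).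
  by apply: cl => v _; rewrite subrr; apply: sL.1.
have ce : forall v, locally_nilpotent xp v -> locally_nilpotent xp (e v).
  by apply: cl => v _; rewrite r_exp subrr; apply: sL.1.
have cxm : forall v, locally_nilpotent xp v -> locally_nilpotent xp (xm v).
  by apply: cl => v _; rewrite r_xpxm subrr; apply: sL.1.
have ch : forall v, locally_nilpotent xp v -> locally_nilpotent xp (h v).
  by apply: cl => v /cxp /(subspaceN sL); rewrite r_hxp opprD addrA subrr add0r.
have cg : forall v, locally_nilpotent xp v -> locally_nilpotent xp (g v).
  by apply: cl => v /cxp /(subspaceN sL); rewrite r_gxp opprD addrA subrr add0r.
move=> T; case=> //.
- by apply: cl => v /cxm /(subspaceN sL); rewrite r_xpf addrC addKr.
- by apply: cl => v /ce; rewrite r_xpyp addrC addKr.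
- apply: cl => v Lv.
  have -> : xp (ym v) - ym (xp v) = h v + g v by rewrite r_xpym; vect K V.
  by apply: (subspaceD sL); [apply: ch|apply: cg].
Qed.

Lemma locally_nilpotent_xm : rep_stable (locally_nilpotent xm).
Proof.
have sL := locally_nilpotent_subspace xm; split=> // T v opT; move: T opT v.
have cl (T : {linear V -> V}) : (forall v, locally_nilpotent xm v -> locally_nilpotent xm (xm (T v) - T (xm v))) ->
    forall v, locally_nilpotent xm v -> locally_nilpotent xm (T v).
  by move=> hT; apply: locally_nilpotent_closed => //; apply: linear0.
have cxm : forall v, locally_nilpotent xm v -> locally_nilpotent xm (xm v).
  by apply: cl => v _; rewrite subrr; apply: sL.1.
have cxp : forall v, locally_nilpotent xm v -> locally_nilpotent xm (xp v).
  by apply: cl => v _; rewrite r_xpxm subrr; apply: sL.1.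
have cf : forall v, locally_nilpotent xm v -> locally_nilpotent xm (f v).
  by apply: cl => v _; rewrite r_xmf subrr; apply: sL.1.
have cg : forall v, locally_nilpotent xm v -> locally_nilpotent xm (g v).
  apply: cl => v /cxm /(subspaceZ sL 2%:R) /(subspaceN sL).
  by rewrite r_gxm opprD addrA subrr add0r.
move=> T; case=> //.
- by apply: cl => v /cxp /(subspaceN sL); rewrite r_exm opprD addrA subrr add0r.
- by apply: cl => v /cxm; rewrite r_hxm opprB addrC subrK.
- by apply: cl => v /cg; rewrite r_xmyp addrC addKr.
- by apply: cl => v /cf; rewrite r_xmym addrC addKr.
Qed.

End LowerHull.

(** * Highest weight vectors *)

Section HighestWeight.
Variables (K : numFieldType) (V : lmodType K) (rho : sl3_rep V).
Local Notation e := (e_ rho).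
Local Notation f := (f_ rho).
Local Notation h := (h_ rho).
Local Notation g := (g_ rho).
Local Notation xp := (xp_ rho).
Local Notation xm := (xm_ rho).
Local Notation yp := (yp_ rho).
Local Notation ym := (ym_ rho).

Variables (a : nat) (b : K) (u : V).
Hypothesis u_hw : hw_vector rho a%:R b u.

(* The analogue of the Gelfand-Tsetlin basis: singular vectors, obtained from
   [u] by lowering the two entries of the gl(2)-highest weight [j], resp. [i]
   times. *)
Fixpoint gt (j i : nat) : V :=
  if j is j'.+1 then lower_y rho (a%:R + i%:R - j'%:R) (gt j' i) else iter i yp u.

Lemma gt_singular j i :
  singular rho (a%:R + i%:R - j%:R) (b - (2 * i)%:R - j%:R) (gt j i).
Proof.
elim: j => [|j IHj] /=.
  have [us _ _] := u_hw; elim: i => [|i /singular_yp IHi]; first by rewrite addr0 !subr0.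
  rewrite iterS; move: IHi; congr (singular _ _ _ _).
    by rewrite -(nat1r i); ring.
  by rewrite mulnS natrD; ring.
have := singular_lower_y IHj; congr (singular _ _ _ _); rewrite -(nat1r j); ring.
Qed.

Lemma yp_gt j i : yp (gt j i) = gt j i.+1.
Proof.
elim: j => //= j IHj; rewrite (yp_lower_y (gt_singular j i)) IHj.
by congr (lower_y _ _ _); rewrite -(nat1r i); ring.
Qed.

Lemma lower_y_lin n c v : lower_y rho n (c *: v) = c *: lower_y rho n v.
Proof. by rewrite /lower_y (linZ ym) (linZ yp) (linZ f); vect K V. Qed.
Lemma lower_y0 n : lower_y rho n 0 = 0.
Proof. by rewrite /lower_y (lin0 ym) (lin0 yp) (lin0 f) scaler0 addr0. Qed.
Lemma lower_x0 n : lower_x rho n 0 = 0.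
Proof. by rewrite /lower_x (lin0 xm) (lin0 xp) (lin0 f) scaler0 subr0. Qed.

Lemma xp_gt0 i : xp (gt 0 i) = 0.
Proof.
elim: i => [|i IHi]; first by have [] := u_hw.
by rewrite -yp_gt (xp_yp (gt_singular 0 i)) IHi linear0.
Qed.

Lemma lower_x_gt0 j : lower_x rho (a%:R - j%:R) (gt j 0) = 0.
Proof.
elim: j => [|j IHj].
  by have [_ xpu xmu] := u_hw; rewrite /lower_x /= xpu xmu (lin0 f) scaler0 subr0.
have := lower_x_lower_y (gt_singular j 0); rewrite addr0 IHj lower_y0.
by rewrite /= -(nat1r j) opprD addrCA addrC addr0.
Qed.

Lemma natr_addS m : m%:R + 1 != 0 :> K.
Proof. by rewrite natr1 pnatr_eq0. Qed.

(** The factor does not depend on [i] because [xp] commutes with [yp] on singular vectors. For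
    [i = 0] the term of [xp_lower_y] with [lower_x] vanishes and the rest is a recursion in [j];
    [j <= a] keeps the divisor [n + 1] nonzero. *)
Lemma xp_gt j i : (j <= a)%N ->
  xp (gt j.+1 i) = (j.+1%:R * (a%:R - j%:R) * (a%:R + b + 1 - j%:R)) *: gt j i.
Proof.
move=> ja; elim: i => [|i IHi]; last first.
  by rewrite -yp_gt (xp_yp (gt_singular j.+1 i)) IHi (linZ yp) yp_gt.
elim: j ja => [|j IHj] ja.
  have [us _ _] := u_hw; have := xp_lower_y us.
  have -> : lower_y rho a%:R u = gt 1 0 by rewrite /= addr0 subr0.
  have -> : lower_x rho a%:R u = 0 by have := lower_x_gt0 0; rewrite subr0.
  have -> : xp u = 0 := xp_gt0 0.
  rewrite lower_y0 (lin0 yp) scaler0 addr0 subr0 => eq1.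
  apply: (@scalerI _ _ (a%:R + 1)); first exact: natr_addS.
  by rewrite eq1 scalerA; congr (_ *: _); ring.
set n : K := a%:R - j.+1%:R.
have n1 : n + 1 != 0.
  by rewrite /n -natrB // natr_addS.
have := xp_lower_y (gt_singular j.+1 0).
have -> : a%:R + 0%:R - j.+1%:R = n by rewrite /n; ring.
rewrite /n lower_x_gt0 (lin0 yp) subr0 -/n IHj ?(ltnW ja) // lower_y_lin.
have -> : lower_y rho (n + 1) (gt j 0) = gt j.+1 0.
  by rewrite /=; congr (lower_y _ _ _); rewrite /n -(nat1r j); ring.
have -> : lower_y rho n (gt j.+1 0) = gt j.+2 0.
  by rewrite [in RHS]/=; congr (lower_y _ _ _); rewrite /n; ring.
move=> eq1; apply: (scalerI n1); rewrite eq1 !scalerA -scalerDl; congr (_ *: _).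
by rewrite mulr0n /n -!(nat1r j.+1) -!(nat1r j); ring.
Qed.

(** [lower_x] commutes with [lower_y] on singular vectors, which reduces to [j = 0]; there [xp]
    vanishes and [lower_x_yp] is a recursion in [i]. *)
Lemma lower_x_gt j i : lower_x rho (a%:R + i.+1%:R - j%:R) (gt j i.+1)
  = (i.+1%:R * (b - i%:R) * (a%:R + i%:R + 2%:R)) *: gt j i.
Proof.
elim: j => [|j IHj]; last first.
  have := lower_x_lower_y (gt_singular j i.+1); rewrite IHj lower_y_lin.
  have -> : a%:R + i.+1%:R - j%:R - 1 = a%:R + i.+1%:R - j.+1%:R :> K.
    by rewrite -(nat1r j); ring.
  move=> eq1; rewrite [LHS]eq1; congr (_ *: _) => /=.
  by congr (lower_y _ _ _); rewrite -(nat1r i) -(nat1r j); ring.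
elim: i => [|i IHi].
  have [us _ _] := u_hw; have := lower_x_yp us.
  have -> : yp u = gt 0 1 by [].
  have -> : lower_x rho a%:R u = 0 by have := lower_x_gt0 0; rewrite subr0.
  have -> : xp u = 0 := xp_gt0 0.
  rewrite lower_y0 (lin0 yp) scaler0 !addr0 => eq1.
  apply: (@scalerI _ _ (a%:R + 1)); first exact: natr_addS.
  by rewrite subr0 eq1 scalerA; congr (_ *: _); ring.
have := lower_x_yp (gt_singular 0 i.+1); rewrite xp_gt0 lower_y0 yp_gt IHi.
rewrite (linZ yp) yp_gt.
have -> : a%:R + i.+1%:R - 0%:R + 1 = a%:R + i.+2%:R - 0%:R :> K by rewrite -(nat1r i.+1); ring.
have n1 : a%:R + i.+2%:R - 0%:R != 0 :> K by rewrite subr0 -natrD addnS pnatr_eq0.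
move=> eq1; apply: (scalerI n1); rewrite eq1 addr0 !scalerA -scalerDl; congr (_ *: _).
by rewrite natrM -!(nat1r i.+1) -!(nat1r i); ring.
Qed.

Hypothesis simple : rep_simple rho.
Hypothesis u_neq0 : u != 0.
Hypothesis f_nil : exists r, iter r f u = 0.

Lemma f_locally_nilpotent v : locally_nilpotent f v.
Proof. by apply: simple v; [apply: locally_nilpotent_f|exists u]. Qed.

Lemma singular_nat n c w : w != 0 -> singular rho n c w -> exists m : nat, n = m%:R.
Proof.
move=> w0 [ew hw _]; have [r fr] := f_locally_nilpotent w.
by have [m [-> _ _]] := singular_weight (r_hf rho) (r_ef rho) w0 ew hw fr; exists m.
Qed.

Lemma in_lower_hull n c w v : hw_vector rho n c w -> w != 0 -> lower_hull rho w v.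
Proof.
by move=> hww w0; apply: simple v; [apply: lower_hull_stable hww|exists w => //; apply: hull_base].
Qed.

Lemma hw_weight_le n c w n' c' w' : hw_vector rho n c w -> w != 0 ->
  hw_vector rho n' c' w' -> w' != 0 -> exists k : nat, n' + c' = n + c - k%:R.
Proof.
move=> hw1 w0 hw2 w'0; have [k [q [Bq w'E]]] := lower_hull_below hw1 (in_lower_hull w' hw1 w0).
have sB := below_subspace (height rho) (n + c).
apply: (below_weight (T := height rho) (m := w')) => //; last exact: hw_height.
rewrite w'E; apply: sB.2; first exact/below_eigen/hw_height.
exact: (@below_le _ _ _ _ 1%N).
Qed.

(** Each of [w] and [u] lies in the hull of the other, so the two heights differ by a natural number
    in both directions. *)
Lemma hw_weight_uniq n c w : hw_vector rho n c w -> w != 0 -> n + c = a%:R + b.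
Proof.
move=> hww w0; have [k kE] := hw_weight_le hww w0 u_hw u_neq0.
have [l lE] := hw_weight_le u_hw u_neq0 hww w0.
have k1 : k%:R = n + c - (a%:R + b) by rewrite kE; ring.
have l1 : l%:R = a%:R + b - (n + c) by rewrite lE; ring.
have : (k + l)%:R = 0 :> K by rewrite natrD k1 l1; ring.
move/eqP; rewrite pnatr_eq0 addn_eq0 => /andP[/eqP k0 _].
by rewrite kE k0 subr0.
Qed.

Lemma lower_x_eq0_hw n c w : n + 1 != 0 -> singular rho n c w -> xp w = 0 ->
  lower_x rho n w = 0 -> hw_vector rho n c w.
Proof.
move=> n1 ws xpw; rewrite /lower_x xpw (lin0 f) subr0 => /eqP.
by rewrite scaler_eq0 (negPf n1) => /eqP.
Qed.

(** The zero factor in [xp_gt] makes [gt j 0] a highest weight vector, but its height is [2 j] less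
    than that of [u]. *)
Lemma gt_eq0_first j : (0 < j <= a)%N -> a%:R + b + 2%:R = j%:R -> gt j 0 = 0.
Proof.
case: j => // j ja jE; apply/eqP; apply: contraT => g0.
have n1 : a%:R - j.+1%:R + 1 != 0 :> K by rewrite -natrB // natr_addS.
have gs : singular rho (a%:R - j.+1%:R) (b - j.+1%:R) (gt j.+1 0).
  by have := gt_singular j.+1 0; rewrite addr0 subr0.
have xp0 : xp (gt j.+1 0) = 0.
  rewrite xp_gt ?(ltnW ja) // -[X in (_ * X) *: _](_ : 0 = _) ?mulr0 ?scale0r //.
  have -> : b = j.+1%:R - a%:R - 2%:R by rewrite -jE; ring.
  by rewrite -(nat1r j); ring.
have /hw_weight_uniq/(_ g0) := lower_x_eq0_hw n1 gs xp0 (lower_x_gt0 _).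
move/eqP; rewrite -subr_eq0.
rewrite (_ : _ - _ = - (2 * j.+1)%:R); last by rewrite natrM; ring.
by rewrite oppr_eq0 pnatr_eq0.
Qed.

Lemma gt_eq0_second m : b = m%:R -> gt 0 m.+1 = 0.
Proof.
move=> bE; apply/eqP; apply: contraT => g0.
have n1 : a%:R + m.+1%:R - 0%:R + 1 != 0 :> K by rewrite subr0 -natrD natr_addS.
have lx : lower_x rho (a%:R + m.+1%:R - 0%:R) (gt 0 m.+1) = 0.
  by rewrite lower_x_gt bE subrr mulr0 mul0r scale0r.
have /hw_weight_uniq/(_ g0) := lower_x_eq0_hw n1 (gt_singular 0 m.+1) (xp_gt0 _) lx.
move/eqP; rewrite -subr_eq0.
rewrite (_ : _ - _ = - m.+1%:R); last by rewrite natrM; ring.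
by rewrite oppr_eq0 pnatr_eq0.
Qed.

Lemma gt_step1 j : gt j 0 = 0 -> forall j' i, (j <= j')%N -> gt j' i = 0.
Proof.
move=> g0 j' i jj'; rewrite -(subnK jj'); elim: (_ - _)%N => [|k IHk].
  by elim: i => // i IHi; rewrite -yp_gt IHi linear0.
by rewrite addSn /= IHk lower_y0.
Qed.

Lemma gt_step2 i : gt 0 i = 0 -> forall j i', (i <= i')%N -> gt j i' = 0.
Proof.
move=> g0 j i' ii'; rewrite -(subnK ii'); elim: (_ - _)%N => [|k IHk].
  by elim: j => //= j ->; rewrite lower_y0.
by rewrite addSn -yp_gt IHk linear0.
Qed.

(** [gt a.+1 0] is singular of weight -1, and local nilpotency of [f] allows only natural
    weights. *)
Lemma gt_eq0_last j i : (a < j)%N -> gt j i = 0.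
Proof.
apply: gt_step1; apply/eqP; apply: contraT => g0.
have [m mE] := singular_nat g0 (gt_singular a.+1 0).
have : (m.+1)%:R = 0 :> K by rewrite -(nat1r m) -mE -(nat1r a); ring.
by move/eqP; rewrite pnatr_eq0.
Qed.

Definition gt_f (t : nat * nat * nat) : V := iter t.2 f (gt t.1.1 t.1.2).

(** The span is stable under all operators, hence everything by simplicity. On the singular vectors
    [ym] and [xm] are recovered from [lower_y] and [lower_x] by dividing by [n + 1], which is
    nonzero for [j <= a]; commuting past powers of [f] then gives the general case. *)
Lemma gt_span v : family_span gt_f v.
Proof.
have sS := family_span_subspace gt_f.
have Sg j i k : family_span gt_f (iter k f (gt j i)) by exact: (family_span_mem gt_f (j, i, k)).
have Sg0 j i : family_span gt_f (gt j i) by exact: (Sg j i 0%N).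
have SD := subspaceD sS; have SB := subspaceB sS; have SZ := subspaceZ sS.
have Sf : forall v, family_span gt_f v -> family_span gt_f (f v).
  by apply: family_span_stable => -[[j i] k]; apply: (Sg j i k.+1).
have Sh : forall v, family_span gt_f v -> family_span gt_f (h v).
  apply: family_span_stable => -[[j i] k]; have [_ hv _] := gt_singular j i.
  by rewrite /gt_f /= (h_iter_f (r_hf rho) _ hv); apply/SZ/Sg.
have g_iter k w c : g w = c *: w -> g (iter k f w) = (c + k%:R) *: iter k f w.
  move=> gw; elim: k => [|k IHk] /=; first by rewrite gw addr0.
  by rewrite r_gf IHk (linZ f) -(nat1r k); vect K V.
have Sgg : forall v, family_span gt_f v -> family_span gt_f (g v).
  apply: family_span_stable => -[[j i] k]; have [_ _ gv] := gt_singular j i.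
  by rewrite /gt_f /= (g_iter _ _ _ gv); apply/SZ/Sg.
have Se : forall v, family_span gt_f v -> family_span gt_f (e v).
  apply: family_span_stable => -[[j i] [|k]]; have [ev hv _] := gt_singular j i.
    by rewrite /gt_f /= ev; apply: sS.1.
  by rewrite /gt_f [t in t.2]/= (e_iter_f (r_hf rho) (r_ef rho) _ ev hv); apply/SZ/Sg.
have ypS j i : family_span gt_f (yp (gt j i)) by rewrite yp_gt; apply: Sg0.
have n_neq0 j i : (j <= a)%N -> a%:R + i%:R - j%:R + 1 != 0 :> K.
  by move=> ja; rewrite (addrAC a%:R i%:R) -natrB // -natrD natr_addS.
have ymS j i : family_span gt_f (ym (gt j i)).
  have [ja|aj] := leqP j a; last by rewrite gt_eq0_last // linear0; apply: sS.1.
  rewrite -[ym _]scale1r -(mulVf (n_neq0 j i ja)) -scalerA; apply/SZ.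
  have -> : (a%:R + i%:R - j%:R + 1) *: ym (gt j i) = gt j.+1 i - f (yp (gt j i)).
    by rewrite /= /lower_y addrK.
  by apply/SB/Sf/ypS/Sg0.
have xpS j i : family_span gt_f (xp (gt j i)).
  case: j => [|j]; first by rewrite xp_gt0; apply: sS.1.
  have [ja|aj] := ltnP j a; last by rewrite gt_eq0_last // linear0; apply: sS.1.
  by rewrite xp_gt ?(ltnW ja) //; apply/SZ/Sg0.
have xmS j i : family_span gt_f (xm (gt j i)).
  have [ja|aj] := leqP j a; last by rewrite gt_eq0_last // linear0; apply: sS.1.
  rewrite -[xm _]scale1r -(mulVf (n_neq0 j i ja)) -scalerA; apply/SZ.
  have -> : (a%:R + i%:R - j%:R + 1) *: xm (gt j i)
      = lower_x rho (a%:R + i%:R - j%:R) (gt j i) + f (xp (gt j i)).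
    by rewrite /lower_x subrK.
  apply/SD/Sf/xpS; case: i => [|i]; first by rewrite addr0 lower_x_gt0; apply: sS.1.
  by rewrite lower_x_gt; apply/SZ/Sg0.
have Sym : forall v, family_span gt_f v -> family_span gt_f (ym v).
  apply: family_span_stable => -[[j i] k]; rewrite /gt_f /=.
  by elim: k => [|k IHk] //=; rewrite r_ymf; apply: Sf.
have Sxm : forall v, family_span gt_f v -> family_span gt_f (xm v).
  apply: family_span_stable => -[[j i] k]; rewrite /gt_f /=.
  by elim: k => [|k IHk] //=; rewrite r_xmf; apply: Sf.
have Syp : forall v, family_span gt_f v -> family_span gt_f (yp v).
  apply: family_span_stable => -[[j i] k]; rewrite /gt_f /=.
  by elim: k => [|k IHk] //=; rewrite r_ypf; apply/SD/Sym/Sg/Sf.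
have Sxp : forall v, family_span gt_f v -> family_span gt_f (xp v).
  apply: family_span_stable => -[[j i] k]; rewrite /gt_f /=.
  by elim: k => [|k IHk] //=; rewrite r_xpf; apply/SB/Sxm/Sg/Sf.
apply: simple v; last by exists u => //; apply: (Sg0 0%N 0%N).
by split=> // T v; case=> ?; auto.
Qed.

End HighestWeight.

Lemma lin_comb_subspace (K : fieldType) (V : lmodType K) (T : finType) (w : T -> V) :
  subspace [set v | exists c : T -> K, v = \sum_t c t *: w t].
Proof.
split=> [|a u v [c ->] [d ->]].
  by exists (fun=> 0); rewrite big1 // => t _; rewrite scale0r.
exists (fun t => a * c t + d t); rewrite scaler_sumr -big_split.
by apply: eq_bigr => t _; rewrite /= scalerDl scalerA.
Qed.

Lemma lin_comb_mem (K : fieldType) (V : lmodType K) (T : finType) (w : T -> V) t :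
  exists c : T -> K, w t = \sum_s c s *: w s.
Proof.
exists (fun s => (s == t)%:R); rewrite (bigD1 t) //= eqxx scale1r big1 ?addr0 //.
by move=> s /negPf ->; rewrite scale0r.
Qed.

Lemma lin_comb_finite_dim (K : fieldType) (V : lmodType K) (T : finType) (w : T -> V) :
  (forall v, exists c : T -> K, v = \sum_t c t *: w t) -> finite_dim [set: V].
Proof.
move=> h; apply: (@generates_finite_dim _ _ _ #|T| (fun i => w (enum_val i))).
  by split.
split=> // v _; have [c ->] := h v; exists (fun i => c (enum_val i)).
by rewrite (reindex (enum_val (A := T))) //; apply/onW_bij/enum_val_bij.
Qed.

(** * Multiplicities of the k-types *)

Section Multiplicities.
Variables (K : numFieldType) (V : lmodType K) (rho : sl3_rep V).
Local Notation e := (e_ rho).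
Local Notation f := (f_ rho).
Local Notation h := (h_ rho).
Local Notation g := (g_ rho).
Variables (a : nat) (b : K) (u : V).
Hypothesis u_hw : hw_vector rho a%:R b u.
Hypothesis simple : rep_simple rho.
Hypothesis u_neq0 : u != 0.
Hypothesis f_nil : exists r, iter r f u = 0.
Local Notation gt := (gt rho a u).
Local Notation gt_basis := (gt_f rho a u).

Lemma gt_f_eq0 j i k : (a + i < k + j)%N -> iter k f (gt j i) = 0.
Proof.
move=> ajk; have [ja|aj] := leqP j a; last first.
  rewrite (gt_eq0_last u_hw simple u_neq0 f_nil) //; exact: (linear0_fun (iter_linear f k)).
have [->|g0] := eqVneq (gt j i) 0; first exact: (linear0_fun (iter_linear f k)).
have [ev hv _] := gt_singular u_hw j i.
have [r fr] := f_locally_nilpotent simple u_neq0 f_nil (gt j i).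
have [m [mE fm _]] := singular_weight (r_hf rho) (r_ef rho) g0 ev hv fr.
have mE' : m = (a + i - j)%N.
  apply/eqP; rewrite -(eqr_nat K) -mE natrB ?natrD //; lia.
rewrite (_ : k = (k - m.+1) + m.+1)%N; last by lia.
by rewrite iterD fm; apply: (linear0_fun (iter_linear f _)).
Qed.

(** For [b = m] only [j <= a], [i <= m] and [k <= a + m] give nonzero vectors. This is what excludes
    natural [b] for infinite-dimensional modules. *)
Lemma dominant_finite_dim m : b = m%:R -> finite_dim [set: V].
Proof.
move=> bE; pose T := ('I_a.+1 * 'I_m.+1 * 'I_(a + m).+1)%type.
pose w (t : T) := gt_basis (t.1.1 : nat, t.1.2 : nat, t.2 : nat).
have sS := lin_comb_subspace w.
apply: (@lin_comb_finite_dim _ _ T w) => v.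
have [s ->] := gt_span u_hw simple u_neq0 f_nil v.
apply: (subspace_sum sS) => -[c [[j i] k]] _; apply: (subspaceZ sS).
rewrite /= /gt_f /=.
have [ja|aj] := ltnP j a.+1; last first.
  rewrite (gt_eq0_last u_hw simple u_neq0 f_nil) //.
  rewrite (linear0_fun (iter_linear f k)); exact: sS.1.
have [im|mi] := ltnP i m.+1; last first.
  rewrite (gt_step2 u_hw (gt_eq0_second u_hw simple u_neq0 bE)) //.
  rewrite (linear0_fun (iter_linear f k)); exact: sS.1.
have [kam|amk] := ltnP k (a + m).+1; last first.
  by rewrite gt_f_eq0; [exact: sS.1|lia].
exact: (lin_comb_mem w (Ordinal ja, Ordinal im, Ordinal kam)).
Qed.

(** [J] is the first [j] for which [gt j i] vanishes: [a + b + 2] if this is an integer between 1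
    and [a], and [a + 1] otherwise. *)
Variable J : nat.
Hypothesis J_range : (0 < J <= a.+1)%N.
Hypothesis b_not_nat : forall i : nat, b != i%:R.
Hypothesis J_first : forall j, (0 < j < J)%N -> a%:R + b + 2%:R != j%:R.
Hypothesis J_root : (J <= a)%N -> a%:R + b + 2%:R = J%:R.

Lemma gt_neq0 j i : (j < J)%N -> gt j i != 0.
Proof.
elim: j => [|j IHj] jJ.
  elim: i => [//|i IHi]; apply: contra_neq IHi => g0.
  have := lower_x_gt u_hw 0 i; rewrite g0 lower_x0 => /esym/eqP.
  rewrite scaler_eq0 !mulf_eq0 pnatr_eq0 /= subr_eq0 (negPf (b_not_nat _)) /=.
  by rewrite -!natrD pnatr_eq0 addn2 /= => /eqP.
apply: contra_neq (IHj (ltnW jJ)) => g0.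
have ja : (j < a)%N by case/andP: J_range => *; lia.
have := xp_gt u_hw i (ltnW ja); rewrite g0 linear0 => /esym/eqP.
rewrite scaler_eq0 !mulf_eq0 pnatr_eq0 /= subr_eq0 eqr_nat [a == j]gtn_eqF //=.
rewrite (_ : _ - _ = a%:R + b + 2%:R - j.+1%:R); last by rewrite -(nat1r j); ring.
by rewrite subr_eq0 (negPf (J_first _)) //= => /eqP.
Qed.

Lemma gt_eq0 j i : (J <= j)%N -> gt j i = 0.
Proof.
move=> Jj; have [ja|aj] := leqP j a; last exact: (gt_eq0_last u_hw simple u_neq0 f_nil).
have Ja : (0 < J <= a)%N by case/andP: J_range => *; lia.
apply: (gt_step1 u_hw _ i Jj); apply: (gt_eq0_first u_hw simple u_neq0) => //.
by apply: J_root; lia.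
Qed.

(** Twice [e f + f e + h^2 / 2], the Casimir operator of k. It takes the value [n (n + 2)] on the
    whole string of a singular vector of weight [n], so together with [h] it singles out the
    singular vectors of the spanning family. *)
Definition casimir : {linear V -> V} :=
  (4%:R \*: (f \o e)%FUN \+ ((h \o h)%FUN \+ 2%:R \*: h))%R.

Lemma casimir_iter n v k : e v = 0 -> h v = n *: v ->
  casimir (iter k f v) = (n * (n + 2%:R)) *: iter k f v.
Proof.
move=> ev hv; rewrite /=; case: k => [|k].
  by rewrite /= ev hv (linZ h) hv (lin0 f); vect K V.
rewrite (e_iter_f (r_hf rho) (r_ef rho) _ ev hv) (h_iter_f (r_hf rho) _ hv).
rewrite (linZ f) (linZ h) (h_iter_f (r_hf rho) _ hv) -iterS natrM -(nat1r k).
by vect K V.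
Qed.

Lemma singular_dim n :
  has_dim [set w | e w = 0 /\ h w = n%:R *: w] (J - (a - n)).
Proof.
set S := [set w | _].
have S0 : S 0 by split; rewrite linear0 ?scaler0.
apply/(has_dimP _ S0).
(* The solutions of [a + i - j = n] with [j < J]: [j] starts at the truncated difference [a - n],
   and [i = n + j - a] is determined. The operator [g] separates them. *)
pose w (k : 'I_(J - (a - n))) := gt (k + (a - n)) (n + (k + (a - n)) - a).
have aE (k : 'I_(J - (a - n))) : (a + (n + (k + (a - n)) - a) = n + (k + (a - n)))%N by lia.
exists w; last first.
  apply: (@eigen_free _ _ g _ _ (fun k => b - (2 * (n + (k + (a - n)) - a))%:R - (k + (a - n))%:R)).
  - move=> k l /eqP; rewrite -!addrA (inj_eq (addrI b)) -!opprD (inj_eq oppr_inj).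
    rewrite -!natrD eqr_nat => /eqP kl; apply: ord_inj; lia.
  - by move=> k; apply: gt_neq0; have := ltn_ord k; lia.
  - by move=> k; have [] := gt_singular u_hw (k + (a - n)) (n + (k + (a - n)) - a).
split.
  move=> k; have [ek hk _] := gt_singular u_hw (k + (a - n)) (n + (k + (a - n)) - a).
  by split; [exact: ek|rewrite hk -natrD aE natrD addrK].
move=> v [ev hv].
have cv : casimir v = (n%:R * (n%:R + 2%:R)) *: v := casimir_iter 0 ev hv.
have [s] := gt_span u_hw simple u_neq0 f_nil v.
pose N (t : nat * nat * nat) : K := a%:R + t.1.2%:R - t.1.1%:R.
pose F (x : K * (nat * nat * nat)) := x.1 *: gt_basis x.2.
have hF x : h (F x) = (N x.2 - (2 * x.2.2)%:R) *: F x.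
  have [_ hg _] := gt_singular u_hw x.2.1.1 x.2.1.2.
  by rewrite /F (linZ h) /gt_f (h_iter_f (r_hf rho) _ hg) !scalerA mulrC.
have cF x : casimir (F x) = (N x.2 * (N x.2 + 2%:R)) *: F x.
  have [eg hg _] := gt_singular u_hw x.2.1.1 x.2.1.2.
  by rewrite /F (linZ casimir) /gt_f (casimir_iter _ eg hg) !scalerA mulrC.
(* The Casimir eigenvalue leaves the strings with [a + i - j = n]; the [h]-eigenvalue [n] then
   leaves only their first vectors, [k = 0]. *)
move=> /(eigen_filter cF cv); rewrite -big_filter => /(eigen_filter hF hv) ->.
rewrite big_filter_cond; have sW := lin_comb_subspace w.
apply: (subspace_sum sW) => -[c [[j i] k]] /= /andP[/eqP cE /eqP hE].
apply: (subspaceZ sW); rewrite /gt_f /=.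
have [Jj|jJ] := leqP J j.
  rewrite gt_eq0 // (linear0_fun (iter_linear f k)); exact: sW.1.
have ja : (j <= a)%N by case/andP: J_range => *; lia.
move: cE hE; rewrite /N /= -natrD -natrB; last by lia.
rewrite -!natrD -!natrM => /eqP; rewrite eqr_nat => /eqP cE.
have nE : (a + i - j)%N = n by nia.
rewrite nE => /eqP; rewrite subr_eq -natrD eqr_nat => /eqP kE.
have k0 : k = 0%N by lia.
have jk : (j - (a - n) < J - (a - n))%N by lia.
have := lin_comb_mem w (Ordinal jk); rewrite {1}/w /=.
have -> : (j - (a - n) + (a - n) = j)%N by lia.
have -> : (n + j - a = i)%N by lia.
by rewrite k0.
Qed.

End Multiplicities.

(** * Cartan subalgebras of sl(3) *)

Definition i0 : 'I_3 := @Ordinal 3 0 isT.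
Definition i1 : 'I_3 := @Ordinal 3 1 isT.
Definition i2 : 'I_3 := @Ordinal 3 2 isT.

(** An isomorphism onto the traceless matrices that makes the Cartan subalgebra diagonal and the
    simple roots standard. It need not be a conjugation, since an outer automorphism may be required
    to put the two simple roots in order. *)
Record standard_form (C : numClosedFieldType) (D : cartan_data (sl C 3)) := StandardForm {
  Phi : sl C 3 -> 'M[C]_3;
  Psi : 'M[C]_3 -> sl C 3;
  Phi_linear : linear Phi;
  Phi_inj : injective Phi;
  Phi_lie : forall x y, Phi (lie x y) = Phi x *m Phi y - Phi y *m Phi x;
  Phi_trace : forall x, \tr (Phi x) = 0;
  PsiK : forall A, \tr A = 0 -> Phi (Psi A) = A;
  cartan_Phi : forall x, cartan D x <-> forall i j, i != j -> Phi x i j = 0;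
  alpha1_Phi : forall x, cartan D x -> alpha1 D x = Phi x i0 i0 - Phi x i1 i1;
  alpha2_Phi : forall x, cartan D x -> alpha2 D x = Phi x i1 i1 - Phi x i2 i2
}.

Section Diagonalisation.
Variable C : numClosedFieldType.
Implicit Types (t x : 'M[C]_3).

(** From [t x = x (t + d)] one gets [p(t) x = x p(t + d)] for the characteristic polynomial [p]. The
    left side is 0 by Cayley-Hamilton; if no [z - d] were an eigenvalue, [p(t + d)] would be
    invertible and [x = 0]. *)
Lemma ad_eigenvalue t x (r : seq C) (d : C) :
  char_poly t = \prod_(z <- r) ('X - z%:P) -> x != 0 ->
  t *m x - x *m t = d *: x -> exists2 z, z \in r & z - d \in r.
Proof.
move=> tE x0 xE; apply/not_exists2P => h; move/eqP: x0; apply.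
have tx : t *m x = x *m (t + d%:M).
  by rewrite mulmxDr mul_mx_scalar -xE addrC subrK.
have swap (s : seq C) : (\prod_(z <- s) (t - z%:M)) *m x = x *m \prod_(z <- s) (t - (z - d)%:M).
  elim: s => [|z s IHs]; first by rewrite !big_nil mul1mx mulmx1.
  rewrite !big_cons -mulmxE -mulmxA IHs mulmxA mulmxBl tx mulmxA; congr (_ *m _).
  rewrite mul_scalar_mx mulmxDr mul_mx_scalar mulmxBr !mul_mx_scalar scalerBl.
  by rewrite opprB addrA.
have pt : \prod_(z <- r) (t - z%:M) = 0.
  have := Cayley_Hamilton t; rewrite tE rmorph_prod => <-.
  by apply: eq_bigr => z _; rewrite rmorphB /= horner_mx_X horner_mx_C.
have := swap r; rewrite pt mul0mx => /esym x_0.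
have u : \prod_(z <- r) (t - (z - d)%:M) \in unitmx.
  rewrite big_seq; elim/big_ind: _ => [|A B uA uB|z zr]; first exact: unitmx1.
    by rewrite -mulmxE unitmx_mul uA.
  have : ~~ eigenvalue t (z - d).
    rewrite eigenvalue_root_char tE root_prod_XsubC.
    by apply/negP => zd; have := h z; case.
  by rewrite /eigenvalue /eigenspace kermx_eq0 negbK row_free_unit.
by rewrite -[x](mulmxK u) x_0 mul0mx.
Qed.

(** Some eigenvalues differ by 1 and some by 2. If one were repeated, at most two values [p], [q]
    would occur, both differences would have square [(p - q)^2], and 1 = 4. This is the reason for
    prescribing the values 1 and 2: equal values would not exclude a repeated eigenvalue. *)
Lemma diagonalise t x1 x2 : x1 != 0 -> x2 != 0 ->
  t *m x1 - x1 *m t = x1 -> t *m x2 - x2 *m t = 2%:R *: x2 ->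
  exists P (d : 'I_3 -> C), [/\ P \in unitmx, injective d &
    P *m t *m invmx P = diag_mx (\row_i d i)].
Proof.
move=> x10 x20 e1 e2; have [r /= rE] := closed_field_poly_normal (char_poly t).
rewrite (monicP (char_poly_monic t)) scale1r in rE.
have sr : size r = 3.
  by have := size_char_poly t; rewrite rE size_prod_XsubC => -[].
have [z1 z1r z1'r] : exists2 z, z \in r & z - 1 \in r.
  by apply: (ad_eigenvalue rE x10); rewrite scale1r.
have [z2 z2r z2'r] := ad_eigenvalue rE x20 e2.
have ur : uniq r.
  apply: contraT => nu.
  have [p [q rpq]] : exists p q, forall z, z \in r -> z = p \/ z = q.
    move: nu; case: (r) sr => [|a [|b [|c []]]] //= _.
    rewrite !inE !negb_and !negbK orbF => /orP[/orP[]|] /eqP e;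
      [exists a, c|exists a, b|exists a, b] => z; rewrite !inE => /or3P[] /eqP; subst; auto.
  have sq z z' : z \in r -> z' \in r -> z - z' = 0 \/ (z - z') ^+ 2 = (p - q) ^+ 2.
    by move=> /rpq[]-> /rpq[]->; [left|right|right|left]; ring.
  have := sq _ _ z1r z1'r; have := sq _ _ z2r z2'r.
  rewrite !subKr.
  case=> [/eqP|e4]; first by rewrite pnatr_eq0.
  case=> [/eqP|e5]; first by rewrite oner_eq0.
  have : 3%:R = 0 :> C by rewrite -[RHS](subrr ((p - q) ^+ 2)) -{1}e4 -e5; ring.
  by move/eqP; rewrite pnatr_eq0.
pose d (i : 'I_3) := r`_i.
have dinj : injective d.
  move=> i j /eqP; rewrite nth_uniq ?sr // => /eqP; exact: ord_inj.
have /choice[v vE] : forall i, exists v : 'rV[C]_3, v *m t = d i *: v /\ v != 0.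
  move=> i; have : eigenvalue t (d i).
    by rewrite eigenvalue_root_char rE root_prod_XsubC mem_nth ?sr.
  by move/eigenvalueP => [v vt v0]; exists v.
pose P := \matrix_(i < 3) v i.
have uP : P \in unitmx.
  rewrite -row_free_unit -kermx_eq0; apply/eqP/row_matrixP => i; apply/rowP => j.
  rewrite row0 [RHS]mxE.
  have fv : free_family v.
    apply: (@eigen_free _ _ (mulmxr t) _ v d) => // k; first by have [] := vE k.
    by have [] := vE k.
  apply: (fv (fun j => row i (kermx P) 0 j)) => {j}.
  have : row i (kermx P) *m P = 0 by rewrite -row_mul mulmx_ker row0.
  by rewrite mulmx_sum_row => k0; rewrite -[RHS]k0; apply: eq_bigr => k _; rewrite rowK.
exists P, d; split=> //.
suff -> : P *m t = diag_mx (\row_i d i) *m P by rewrite mulmxK.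
apply/matrixP => i j; rewrite mul_diag_mx !mxE.
have /rowP/(_ j) := (vE i).1; rewrite !mxE => <-.
by apply: eq_bigr => k _; rewrite mxE.
Qed.

End Diagonalisation.

Section Conjugation.
Variables (C : numClosedFieldType) (P : 'M[C]_3).
Hypothesis uP : P \in unitmx.

Definition conj_sl (x : sl C 3) : 'M[C]_3 := locked (P *m x *m invmx P).
Lemma conj_slE x : conj_sl x = P *m x *m invmx P.
Proof. by rewrite /conj_sl -lock. Qed.
Definition conj_sl_inv (A : 'M[C]_3) : sl C 3 := insubd (0 : sl C 3) (invmx P *m A *m P).

Lemma conj_sl_linear : linear conj_sl.
Proof.
by move=> a x y; rewrite !conj_slE mulmxDr mulmxDl -scalemxAr -scalemxAl.
Qed.
Lemma conj_sl_inj : injective conj_sl.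
Proof.
move=> x y /(congr1 (mulmx (invmx P))); rewrite !conj_slE !mulmxA mulVmx // !mul1mx.
by move=> /(congr1 (mulmx^~ P)); rewrite !mulmxKV // => /val_inj.
Qed.
Lemma conj_sl_lie x y : conj_sl (lie x y) = conj_sl x *m conj_sl y - conj_sl y *m conj_sl x.
Proof.
rewrite !conj_slE /= mulmxBr mulmxBl !mulmxA.
by rewrite !(mulmxKV uP).
Qed.
Lemma conj_sl_trace x : \tr (conj_sl x) = 0.
Proof.
by rewrite !conj_slE mxtrace_mulC mulmxA mulVmx // mul1mx; apply/eqP; apply: (slvalP x).
Qed.
Lemma conj_sl_invK A : \tr A = 0 -> conj_sl (conj_sl_inv A) = A.
Proof.
move=> trA; rewrite conj_slE /conj_sl_inv -[slval _]/(val _) insubdK.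
  by rewrite !mulmxA mulmxV // mul1mx mulmxK.
by apply/eqP; rewrite mxtrace_mulC mulmxA mulmxV // mul1mx.
Qed.

End Conjugation.

Lemma diag_mxE (R : pzRingType) n (A : 'M[R]_n) :
  (forall i j, i != j -> A i j = 0) -> A = diag_mx (\row_i A i i).
Proof.
move=> A0; apply/matrixP => i j; rewrite !mxE.
by case: eqP => [->|/eqP ij] /=; [rewrite mulr1n|rewrite mulr0n A0].
Qed.

Lemma mxtrace_delta (R : pzSemiRingType) n (i j : 'I_n) :
  \tr (delta_mx i j : 'M[R]_n) = (i == j)%:R.
Proof.
rewrite /mxtrace (bigD1 i) //= mxE eqxx big1 ?addr0 // => k ki.
by rewrite mxE (negPf ki).
Qed.

Section CartanForm.
Variables (C : numClosedFieldType) (D : cartan_data (sl C 3)).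
Let h := cartan D.
Let a1 := alpha1 D.
Let a2 := alpha2 D.

Definition diagonalises (P : 'M[C]_3) : Prop :=
  P \in unitmx /\ forall x, h x <-> forall i j, i != j -> conj_sl P x i j = 0.

Lemma h_subspace : subspace h.
Proof. by have [[]] := cartanP D. Qed.

Lemma alpha_values : exists2 t, h t & a1 t = 1 /\ a2 t = 2%:R.
Proof.
have [[l1 [t1 ht1 t1n] _] [l2 _ _] indep _] := alphaP D; rewrite -/h -/a1 -/a2 in l1 l2 t1n indep.
(* Otherwise [- a2 t1] and [a1 t1] are the coefficients of a linear relation between the two roots,
   with [a1 t1] nonzero. *)
have [t2 ht2 det] : exists2 t2, h t2 & a1 t1 * a2 t2 - a2 t1 * a1 t2 != 0.
  apply/not_exists2P => no; have [|/eqP] := indep (- a2 t1) (a1 t1).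
    move=> t ht; have [//|/negP] := no t; rewrite negbK => /eqP <-; ring.
  by move=> _ /eqP; rewrite (negPf t1n).
set dt := _ - _ in det.
have hZ := subspaceZ h_subspace.
(* Cramer's rule for the system [a1 t = 1], [a2 t = 2]. *)
exists (((a2 t2 - 2%:R * a1 t2) / dt) *: t1 + ((2%:R * a1 t1 - a2 t1) / dt) *: t2).
  by apply: h_subspace.2 => //; apply: hZ.
have aE al : linear_on h al -> forall c d, al (c *: t1 + d *: t2) = c * al t1 + d * al t2.
  move=> lal c d; rewrite lal //; last exact: hZ.
  congr (_ + _); have := lal d t2 0 ht2 h_subspace.1; rewrite addr0 => ->.
  have := lal 1 0 0 h_subspace.1 h_subspace.1; rewrite scale1r addr0 mul1r => /eqP.
  by rewrite -subr_eq subrr eq_sym => /eqP ->; rewrite addr0.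
by rewrite !aE //; split; rewrite /dt in det *; field.
Qed.

Lemma root_vector_neq0 (x : sl C 3) : x != 0 -> slval x != 0.
Proof. by apply: contra_neq => x0; apply: val_inj. Qed.

(** In an eigenbasis of [t], each bracket with [t] multiplies the entry [(i, j)] by [d i - d j]. As
    [h] is nilpotent, enough brackets give 0, so off-diagonal entries vanish on [h]. Conversely a
    diagonal matrix commutes with [h], which is its own normaliser. *)
Lemma cartan_diagonalises : exists P, diagonalises P.
Proof.
have [t ht [t1 t2]] := alpha_values.
have [[_ _ [x1 g1 x10]] [_ _ [x2 g2 x20]] _ _] := alphaP D.
have e1 := congr1 (@slval C 3) (g1 _ ht); have e2 := congr1 (@slval C 3) (g2 _ ht).
rewrite -/a1 -/a2 t1 t2 scale1r /= in e1 e2.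
have [P [d [uP dinj Pt]]] := diagonalise (root_vector_neq0 x10) (root_vector_neq0 x20) e1 e2.
have [_ [N hN] hself] := cartanP D; rewrite -/h in hN hself.
have commE y (i j : 'I_3) : conj_sl P (lie t y) i j = (d i - d j) * conj_sl P y i j.
  rewrite conj_sl_lie // (conj_slE P t) Pt mul_diag_mx mul_mx_diag !mxE; ring.
have hdiag x : h x -> forall i j, i != j -> conj_sl P x i j = 0.
  move=> hx i j ij.
  have iterE n : conj_sl P (iter n (lie t) x) i j = (d i - d j) ^+ n * conj_sl P x i j.
    by elim: n => [|n IHn]; rewrite ?mul1r // iterS commE IHn mulrA -exprS.
  have lc n : lower_central h n (iter n (lie t) x).
    elim: n => // n IHn; rewrite iterS /= => S [_ SG]; apply: SG.
    by exists t => //; exists (iter n (lie t) x).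
  have := lc N; rewrite hN => /= x0; have := iterE N; rewrite x0.
  rewrite (linear0_fun (@conj_sl_linear _ P)) mxE => /esym/eqP.
  by rewrite mulf_eq0 expf_eq0 subr_eq0 (inj_eq dinj) (negPf ij) andbF => /eqP.
exists P; split=> // x; split=> [|xd]; first exact: hdiag.
apply: hself => s hs; suff -> : lie x s = 0 by apply: h_subspace.1.
apply: (conj_sl_inj uP).
rewrite (linear0_fun (@conj_sl_linear _ P)) conj_sl_lie //.
by rewrite (diag_mxE xd) (diag_mxE (hdiag _ hs)) diag_mxC subrr.
Qed.

Lemma diagonalises_row_perm P (s : 'S_3) : diagonalises P ->
  diagonalises (row_perm s P) /\
  forall x i j, conj_sl (row_perm s P) x i j = conj_sl P x (s i) (s j).
Proof.
move=> [uP dP].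
have u : row_perm s P \in unitmx by rewrite row_permE unitmx_mul unitmx_perm.
have E x i j : conj_sl (row_perm s P) x i j = conj_sl P x (s i) (s j).
  have -> : conj_sl (row_perm s P) x = row_perm s (col_perm s (conj_sl P x)).
    suff e : row_perm s P *m x = row_perm s (col_perm s (conj_sl P x)) *m row_perm s P.
      by rewrite conj_slE e mulmxK.
    rewrite !row_permE col_permE !conj_slE !mulmxA.
    by rewrite -[_ *m perm_mx s^-1 *m perm_mx s]mulmxA -perm_mxM mulVg perm_mx1 mulmx1 mulmxKV.
  by rewrite !mxE.
split=> //; split=> // x; rewrite dP; split=> xd i j ij.
  by rewrite E xd // (inj_eq perm_inj).
by rewrite -(permKV s i) -(permKV s j) -E xd // (inj_eq perm_inj).
Qed.

(** The position of any nonzero entry of a root vector reads off the root. [F] is left general to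
    cover both [conj_sl P] and the [Phi] of a standard form. *)
Lemma root_entry (F : sl C 3 -> 'M[C]_3) : linear F -> injective F ->
  (forall x y, F (lie x y) = F x *m F y - F y *m F x) ->
  (forall s, h s -> forall i j, i != j -> F s i j = 0) ->
  forall be, Defs.root h be ->
  exists i j : 'I_3, i != j /\ forall s, h s -> be s = F s i i - F s j j.
Proof.
move=> Fl F_inj F_lie hF be [_ [t ht bt] [x gx x0]].
have [i [j xij]] : exists i j, F x i j != 0.
  apply/not_existsP => no; move/eqP: x0; apply; apply: F_inj.
  rewrite (linear0_fun Fl); apply/matrixP => i j; rewrite [X in _ = X]mxE.
  by apply/eqP/negPn/negP => xij; apply: (no i); exists j.
have bE s : h s -> be s = F s i i - F s j j.
  move=> hs; have /= e := congr1 (fun y => F y i j) (gx s hs).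
  rewrite F_lie (linearZ_fun Fl) in e.
  rewrite (diag_mxE (hF s hs)) mul_diag_mx mul_mx_diag !mxE in e.
  by apply: (mulIf xij); rewrite -e; ring.
by exists i, j; split=> //; apply: contra_neq bt => ij; rewrite bE // ij subrr.
Qed.

Section Roots.
Variables (P : 'M[C]_3) (dP : diagonalises P).

Lemma entry_root (i j : 'I_3) : i != j -> Defs.root h (fun s => conj_sl P s i i - conj_sl P s j j).
Proof.
move=> ij; have [uP hP] := dP; split.
- by move=> a x y _ _; rewrite conj_sl_linear !mxE; ring.
- have tr : \tr (delta_mx i i - delta_mx j j : 'M[C]_3) = 0.
    by rewrite linearB /= !mxtrace_delta !eqxx subrr.
  exists (conj_sl_inv P (delta_mx i i - delta_mx j j)).
    apply/hP => k l kl; rewrite conj_sl_invK // !mxE.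
    have F (m : 'I_3) : (k == m) && (l == m) = false.
      by apply/negP => /andP[/eqP km /eqP lm]; rewrite km lm eqxx in kl.
    by rewrite !F subrr.
  rewrite conj_sl_invK // !mxE (eq_sym j i) (negPf ij) !eqxx /=.
  by rewrite subr0 sub0r opprK -(natrD _ 1 1) pnatr_eq0.
have tr : \tr (delta_mx i j : 'M[C]_3) = 0.
  by rewrite mxtrace_delta (negPf ij).
exists (conj_sl_inv P (delta_mx i j)).
  move=> s hs; rewrite /=; set c := _ - _; apply: (conj_sl_inj uP).
  rewrite conj_sl_lie // (linearZ_fun (@conj_sl_linear _ P)) conj_sl_invK //.
  rewrite (diag_mxE ((hP _).1 hs)) mul_diag_mx mul_mx_diag.
  apply/matrixP => k l; rewrite !mxE.
  case: eqP => [->|_]; case: eqP => [->|_]; rewrite /= ?mulr0 ?mul0r ?subrr //.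
  by rewrite !mulr1 mul1r.
apply/eqP => /(congr1 (conj_sl P)); rewrite conj_sl_invK //.
rewrite (linear0_fun (@conj_sl_linear _ P)) => /matrixP/(_ i j)/eqP.
by rewrite !mxE !eqxx oner_eq0.
Qed.

(** The difference of two simple roots is neither zero nor a root, so the two roots share neither
    their first nor their second index. With three indices available, the second index of one is the
    first index of the other. *)
Lemma simple_roots_entries : exists i j l : 'I_3, [/\ i != j, i != l & j != l] /\
  ((forall s, h s -> a1 s = conj_sl P s i i - conj_sl P s j j /\
                     a2 s = conj_sl P s j j - conj_sl P s l l) \/
   (forall s, h s -> a1 s = conj_sl P s i i - conj_sl P s j j /\
                     a2 s = conj_sl P s l l - conj_sl P s i i)).
Proof.
have [r1 r2 indep pos] := alphaP D; rewrite -/h -/a1 -/a2 in r1 r2 indep pos.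
have [uP hP] := dP; have hd s (hs : h s) := (hP s).1 hs.
have Pe := root_entry (@conj_sl_linear _ P) (conj_sl_inj uP) (conj_sl_lie uP) hd.
have [i [j [ij E1]]] := Pe _ r1; have [k [l [kl E2]]] := Pe _ r2.
have neg be : Defs.root h be -> ~ forall s, h s -> be s = a1 s - a2 s.
  move=> rbe bE; have [m [n [pE|nE]]] := pos _ rbe.
    have [|_ /eqP] := indep (m%:R - 1) (n%:R + 1).
      by move=> t ht; have := pE t ht; rewrite bE // => e; rewrite -(mulr_natr) -(mulr_natr) in e; 
         rewrite -[RHS](subrr (a1 t - a2 t)) {1}e; ring.
    by rewrite natr1 pnatr_eq0.
  have [|/eqP m1 _] := indep (m%:R + 1) (n%:R - 1).
    by move=> t ht; have := nE t ht; rewrite bE // => e; rewrite -(mulr_natr) -(mulr_natr) in e;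
       rewrite -[RHS](subrr (a1 t - a2 t)) {2}e; ring.
  by rewrite natr1 pnatr_eq0 in m1.
have ki : k != i.
  apply/eqP => ki; subst k; have [lj|lj] := eqVneq l j.
    subst l; have [|/eqP] := indep 1 (-1); last by rewrite oner_eq0.
    by move=> t ht; rewrite E1 // E2 //; ring.
  apply: (neg _ (entry_root lj)) => s hs; rewrite E1 // E2 //; ring.
have lj : l != j.
  apply/eqP => lj; subst l.
  apply: (neg (fun s => conj_sl P s i i - conj_sl P s k k)).
    by apply: entry_root; rewrite eq_sym.
  by move=> s hs; rewrite E1 // E2 //; ring.
have [kj|kj] := eqVneq k j.
  subst k; exists i, j, l; split; last by left=> s hs; rewrite E1 ?E2.
  split=> //; apply/eqP => il; subst l.
  have [|/eqP] := indep 1 1; last by rewrite oner_eq0.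
  by move=> t ht; rewrite E1 // E2 //; ring.
exists i, j, k; split; first by split=> //; rewrite eq_sym.
right=> s hs; rewrite E1 ?E2 //; suff -> : l = i by [].
apply/eqP/negPn/negP => li; have u : uniq [:: i; j; k; l].
  by rewrite /= !inE !negb_or ij (eq_sym i k) ki (eq_sym i l) li (eq_sym j k) kj (eq_sym j l) lj kl.
by have := max_card (mem [:: i; j; k; l]); rewrite (card_uniqP u) card_ord.
Qed.

End Roots.

Lemma standard_form_exists : exists S : standard_form D, True.
Proof.
have [P0 dP0] := cartan_diagonalises.
have [i [j [l [[ij il jl] cases]]]] := simple_roots_entries dP0.
have perm_of (x y z : 'I_3) : x != y -> x != z -> y != z ->
    exists s : 'S_3, [/\ s i0 = x, s i1 = y & s i2 = z].
  move=> xy xz yz; pose s0 (k : 'I_3) := nth x [:: x; y; z] k.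
  have inj : injective s0.
    move=> k m /eqP; rewrite /s0 nth_uniq //=; first by move/eqP/ord_inj.
    by rewrite !inE negb_or xy xz yz.
  by exists (perm inj); rewrite !permE.
case: cases => aE.
  have [s [s0 s1 s2]] := perm_of i j l ij il jl.
  have [[uP hP] E] := diagonalises_row_perm s dP0; set P := row_perm s P0 in uP hP E.
  unshelve eexists (@StandardForm _ D (conj_sl P) (conj_sl_inv P) (@conj_sl_linear _ P)
    (conj_sl_inj uP) (conj_sl_lie uP) (conj_sl_trace uP) (conj_sl_invK uP) hP _ _) => //.
    by move=> x hx; rewrite !E s0 s1 -/a1 (aE x hx).1.
  by move=> x hx; rewrite !E s1 s2 -/a2 (aE x hx).2.
(* In this case the roles of the simple roots are exchanged by [x |-> - x^T]. *)
have [s [s0 s1 s2]] : exists s : 'S_3, [/\ s i0 = j, s i1 = i & s i2 = l].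
  by apply: perm_of => //; rewrite eq_sym.
have [[uP hP] E] := diagonalises_row_perm s dP0; set P := row_perm s P0 in uP hP E.
pose F x := - (conj_sl P x)^T; pose G A := conj_sl_inv P (- A^T).
unshelve eexists (@StandardForm _ D F G _ _ _ _ _ _ _ _) => //.
- by move=> a x y; rewrite /F conj_sl_linear linearP opprD scalerN.
- by move=> x y /oppr_inj/trmx_inj/(conj_sl_inj uP).
- move=> x y; rewrite /F conj_sl_lie // linearB /= !trmx_mul opprB.
  by rewrite !mulmxN !mulNmx !opprK.
- by move=> x; rewrite /F linearN /= mxtrace_tr conj_sl_trace // oppr0.
- by move=> A trA; rewrite /F /G conj_sl_invK ?linearN /= ?trmxK ?opprK // mxtrace_tr trA oppr0.
- move=> x; rewrite /F; split=> [hx i' j' ij'|xd].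
    by rewrite !mxE ((hP x).1 hx) ?oppr0 // eq_sym.
  apply/hP => i' j' ij'; have := xd j' i'; rewrite eq_sym ij' !mxE => /(_ isT)/eqP.
  by rewrite oppr_eq0 => /eqP.
- by move=> x hx; rewrite /F !mxE !E s0 s1 -/a1 (aE x hx).1; ring.
- by move=> x hx; rewrite /F !mxE !E s1 s2 -/a2 (aE x hx).2; ring.
Qed.

End CartanForm.

Section LieModLinear.
Variables (K : fieldType) (L : lieAlgType K) (p : set L) (M : liemod p).

Definition act_at (x : L) (px : p x) : M -> M := act x.
Fact act_at_linear x (px : p x) : linear (act_at px).
Proof. by have [h _ _] := actP M; apply: h. Qed.
HB.instance Definition _ x (px : p x) :=
  GRing.isLinear.Build K M M *:%R (act_at px) (act_at_linear px).

Lemma act_comb a x y (v : M) : p x -> p y -> act (a *: x + y) v = a *: act x v + act y v.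
Proof. by have [_ h _] := actP M; apply: h. Qed.

Lemma act_lie x y (v : M) : p x -> p y -> act x (act y v) = act y (act x v) + act (lie x y) v.
Proof. by move=> px py; have [_ _ ->] := actP M; rewrite // addrC subrK. Qed.

Lemma act_add x y (v : M) : p x -> p y -> act (x + y) v = act x v + act y v.
Proof. by move=> px py; rewrite -[x]scale1r act_comb // !scale1r. Qed.

Hypothesis sp : subspace p.
Lemma act0l (v : M) : act 0 v = 0.
Proof. by have := act_comb (-1) v sp.1 sp.1; rewrite scaler0 addr0 scaleN1r addNr. Qed.
Lemma act_scale a x (v : M) : p x -> act (a *: x) v = a *: act x v.
Proof. by move=> px; rewrite -[a *: x]addr0 act_comb ?act0l ?addr0 //; apply: sp.1. Qed.
End LieModLinear.

(** * The standard basis of sl(3), its brackets and its root spaces *)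

Section Basis.
Variables (C : numClosedFieldType) (D : cartan_data (sl C 3)) (S : standard_form D).
Local Notation Phi := (Phi S).
Local Notation Psi := (Psi S).
Local Notation L := (sl C 3).
Let h := cartan D.

Definition mE (i j : 'I_3) : 'M[C]_3 := locked (delta_mx i j).
Fact mxtrace_mE i j : \tr (mE i j) = (i == j)%:R.
Proof. by rewrite /mE -lock mxtrace_delta. Qed.
Fact mE_E i j k l : mE i j k l = ((k == i) && (l == j))%:R.
Proof. by rewrite /mE -lock mxE. Qed.

Definition be_ : L := Psi (mE i0 i1).
Definition bf_ : L := Psi (mE i1 i0).
Definition bh_ : L := Psi (mE i0 i0 - mE i1 i1).
Definition bg_ : L := Psi (mE i1 i1 - mE i2 i2).
Definition bxp_ : L := Psi (mE i0 i2).
Definition bxm_ : L := Psi (mE i1 i2).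
Definition byp_ : L := Psi (mE i2 i1).
Definition bym_ : L := Psi (mE i2 i0).

Lemma Phi0 : Phi 0 = 0. Proof. exact/linear0_fun/Phi_linear. Qed.
Lemma PhiD : {morph Phi : x y / x + y}. Proof. exact/linearD_fun/Phi_linear. Qed.
Lemma PhiZ a : {morph Phi : x / a *: x}. Proof. exact/linearZ_fun/Phi_linear. Qed.
Lemma PhiN x : Phi (- x) = - Phi x. Proof. by rewrite -!scaleN1r PhiZ. Qed.

Lemma Phi_be : Phi be_ = mE i0 i1. Proof. by rewrite PsiK // mxtrace_mE. Qed.
Lemma Phi_bf : Phi bf_ = mE i1 i0. Proof. by rewrite PsiK // mxtrace_mE. Qed.
Lemma Phi_bh : Phi bh_ = mE i0 i0 - mE i1 i1.
Proof. by rewrite PsiK // linearB /= !mxtrace_mE subrr. Qed.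
Lemma Phi_bg : Phi bg_ = mE i1 i1 - mE i2 i2.
Proof. by rewrite PsiK // linearB /= !mxtrace_mE subrr. Qed.
Lemma Phi_bxp : Phi bxp_ = mE i0 i2. Proof. by rewrite PsiK // mxtrace_mE. Qed.
Lemma Phi_bxm : Phi bxm_ = mE i1 i2. Proof. by rewrite PsiK // mxtrace_mE. Qed.
Lemma Phi_byp : Phi byp_ = mE i2 i1. Proof. by rewrite PsiK // mxtrace_mE. Qed.
Lemma Phi_bym : Phi bym_ = mE i2 i0. Proof. by rewrite PsiK // mxtrace_mE. Qed.

Definition Phi_b := (Phi_be, Phi_bf, Phi_bh, Phi_bg, Phi_bxp, Phi_bxm, Phi_byp, Phi_bym).

Lemma delta_mulE (i j k l : 'I_3) :
  mE i j *m mE k l = (j == k)%:R *: mE i l.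
Proof. by rewrite /mE -!lock mul_delta_mx_cond; case: eqP => _; rewrite ?scale1r ?scale0r. Qed.

Fact ord3_eqE : ((i0 == i1) = false) * ((i1 == i0) = false) * ((i0 == i2) = false) *
  ((i2 == i0) = false) * ((i1 == i2) = false) * ((i2 == i1) = false).
Proof. by []. Qed.

Ltac bracket :=
  apply: (Phi_inj (s := S)); rewrite Phi_lie ?(PhiD, PhiZ, PhiN, Phi0) !Phi_b
    ?(mulmxBl, mulmxBr, delta_mulE, ord3_eqE, eqxx); vect_with false C 'M[C]_3.

Lemma lie_he : lie bh_ be_ = 2%:R *: be_. Proof. bracket. Qed.
Lemma lie_hf : lie bh_ bf_ = - (2%:R *: bf_). Proof. bracket. Qed.
Lemma lie_hxp : lie bh_ bxp_ = bxp_. Proof. bracket. Qed.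
Lemma lie_hxm : lie bh_ bxm_ = - bxm_. Proof. bracket. Qed.
Lemma lie_hyp : lie bh_ byp_ = byp_. Proof. bracket. Qed.
Lemma lie_hym : lie bh_ bym_ = - bym_. Proof. bracket. Qed.
Lemma lie_ge : lie bg_ be_ = - be_. Proof. bracket. Qed.
Lemma lie_gf : lie bg_ bf_ = bf_. Proof. bracket. Qed.
Lemma lie_gxp : lie bg_ bxp_ = bxp_. Proof. bracket. Qed.
Lemma lie_gxm : lie bg_ bxm_ = 2%:R *: bxm_. Proof. bracket. Qed.
Lemma lie_gyp : lie bg_ byp_ = - (2%:R *: byp_). Proof. bracket. Qed.
Lemma lie_gym : lie bg_ bym_ = - bym_. Proof. bracket. Qed.
Lemma lie_gh : lie bg_ bh_ = 0. Proof. bracket. Qed.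
Lemma lie_ef : lie be_ bf_ = bh_. Proof. bracket. Qed.
Lemma lie_exp : lie be_ bxp_ = 0. Proof. bracket. Qed.
Lemma lie_exm : lie be_ bxm_ = bxp_. Proof. bracket. Qed.
Lemma lie_eyp : lie be_ byp_ = 0. Proof. bracket. Qed.
Lemma lie_eym : lie be_ bym_ = - byp_. Proof. bracket. Qed.
Lemma lie_xpf : lie bxp_ bf_ = - bxm_. Proof. bracket. Qed.
Lemma lie_xmf : lie bxm_ bf_ = 0. Proof. bracket. Qed.
Lemma lie_ypf : lie byp_ bf_ = bym_. Proof. bracket. Qed.
Lemma lie_ymf : lie bym_ bf_ = 0. Proof. bracket. Qed.
Lemma lie_xpxm : lie bxp_ bxm_ = 0. Proof. bracket. Qed.
Lemma lie_ypym : lie byp_ bym_ = 0. Proof. bracket. Qed.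
Lemma lie_xpyp : lie bxp_ byp_ = be_. Proof. bracket. Qed.
Lemma lie_xpym : lie bxp_ bym_ = bh_ + bg_. Proof. bracket. Qed.
Lemma lie_xmyp : lie bxm_ byp_ = bg_. Proof. bracket. Qed.
Lemma lie_xmym : lie bxm_ bym_ = bf_. Proof. bracket. Qed.

Lemma ord3P (i : 'I_3) : [\/ i = i0, i = i1 | i = i2].
Proof.
by case: i => [[|[|[|i]]] Hi] //; [apply: Or31|apply: Or32|apply: Or33]; apply: ord_inj.
Qed.

Lemma Phi22 x : Phi x i2 i2 = - Phi x i0 i0 - Phi x i1 i1.
Proof.
have := Phi_trace S x; rewrite /mxtrace (bigD1 i0) //= (bigD1 i1) //= (bigD1 i2) //=.
rewrite big1 => [|k]; last by case: (ord3P k) => ->.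
by rewrite addr0 addrA addrC => /eqP; rewrite addr_eq0 => /eqP ->; ring.
Qed.

Lemma decomposition x :
  x = Phi x i0 i1 *: be_ + Phi x i1 i0 *: bf_ + Phi x i0 i0 *: bh_ + (Phi x i0 i0 + Phi x i1 i1) *: bg_
    + Phi x i0 i2 *: bxp_ + Phi x i1 i2 *: bxm_ + Phi x i2 i1 *: byp_ + Phi x i2 i0 *: bym_.
Proof.
apply: (Phi_inj (s := S)); rewrite !(PhiD, PhiZ) !Phi_b.
set c := Phi x; have c22 : c i2 i2 = - c i0 i0 - c i1 i1 := Phi22 x; move: c c22 => c c22.
apply/matrixP => i j; rewrite !(mxE, mE_E).
by case: (ord3P i) => ->; case: (ord3P j) => -> /=; rewrite ?c22; ring.
Qed.

(* The roots take distinct values on the diagonal matrix with these entries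
   (made traceless by subtracting 6). *)
Definition hweight (k : 'I_3) : nat := nth 0%N [:: 11; 7; 0]%N k.
Lemma hweight_inj (i j k l : 'I_3) : i != j ->
  (hweight k + hweight j = hweight i + hweight l)%N -> k = i /\ l = j.
Proof.
by case: (ord3P i) => ->; case: (ord3P j) => ->; case: (ord3P k) => ->; case: (ord3P l) => ->.
Qed.

Lemma root_space_Phi al (i j : 'I_3) x : i != j ->
  (forall s, h s -> al s = Phi s i i - Phi s j j) ->
  root_space h al x <-> Phi x = Phi x i j *: mE i j.
Proof.
move=> ij alE; split=> [rx|xE s hs]; last first.
  apply: (Phi_inj (s := S)); rewrite Phi_lie PhiZ xE (diag_mxE ((cartan_Phi S s).1 hs)).
  rewrite alE //; move: (Phi s) => s'.
  rewrite -scalemxAl -scalemxAr mul_diag_mx mul_mx_diag; apply/matrixP => k l; rewrite !(mxE, mE_E).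
  by case: eqP => [->|_]; case: eqP => [->|_]; rewrite /=; ring.
pose A : 'M[C]_3 := diag_mx (\row_k ((hweight k)%:R - 6%:R)).
have trA : \tr A = 0.
  rewrite mxtrace_diag (bigD1 i0) //= (bigD1 i1) //= (bigD1 i2) //=.
  rewrite big1 => [|k]; last by case: (ord3P k) => ->.
  by rewrite !mxE /hweight /=; ring.
have hA : h (Psi A).
  by apply/(cartan_Phi S) => k l kl; rewrite PsiK // !mxE (negPf kl).
have e := congr1 Phi (rx _ hA); rewrite Phi_lie PhiZ alE // PsiK // in e.
apply/matrixP => k l; rewrite !mxE mE_E; case: andP => [[/eqP -> /eqP ->]|kl]; first by rewrite mulr1.
have /= := congr1 (fun B : 'M[C]_3 => B k l) e.
rewrite mul_diag_mx mul_mx_diag !mxE !eqxx !mulr1n mulr0 => {}e.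
apply/eqP; apply: contra_notT kl => xkl.
suff /(hweight_inj ij)[-> ->] : (hweight k + hweight j = hweight i + hweight l)%N by rewrite !eqxx.
apply/eqP; rewrite -(eqr_nat C) !natrD -subr_eq0; apply/eqP/(mulIf xkl); rewrite mul0r.
by move/eqP: e; rewrite -subr_eq0 => /eqP e; rewrite -[RHS]e; ring.
Qed.

End Basis.

Lemma smallest_mem (T : Type) (P : set T -> Prop) (G : set T) : G `<=` smallest P G.
Proof. by move=> x Gx X [_]; apply. Qed.

Lemma smallest_ind (T : Type) (P : set T -> Prop) (G X : set T) :
  P X -> G `<=` X -> smallest P G `<=` X.
Proof. by move=> PX GX x; apply. Qed.

Lemma lspan_subspace (K : fieldType) (V : lmodType K) (G : set V) : subspace (lspan G).
Proof.
split=> [X [sX _]|a u v Gu Gv X XG]; first exact: sX.1.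
by have [sX _] := XG; apply: sX.2; [apply: Gu|apply: Gv].
Qed.

(** * Restriction to k and induction from the parabolic *)

Section StandardBasis.
Variables (C : numClosedFieldType) (D : cartan_data (sl C 3)) (S : standard_form D).
Local Notation Phi := (Phi S).
Local Notation L := (sl C 3).
Local Notation h := (cartan D).
Local Notation a1 := (alpha1 D).
Local Notation a2 := (alpha2 D).
Local Notation be := (be_ S).
Local Notation bf := (bf_ S).
Local Notation bh := (bh_ S).
Local Notation bg := (bg_ S).
Local Notation bxp := (bxp_ S).
Local Notation bxm := (bxm_ S).
Local Notation byp := (byp_ S).
Local Notation bym := (bym_ S).

Lemma cartan_bh : h bh.
Proof.
apply/(cartan_Phi S) => i j ij; rewrite Phi_bh !(mxE, mE_E).
case: (ord3P i) ij => ->; case: (ord3P j) => -> //= _; exact: subrr.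
Qed.
Lemma cartan_bg : h bg.
Proof.
apply/(cartan_Phi S) => i j ij; rewrite Phi_bg !(mxE, mE_E).
case: (ord3P i) ij => ->; case: (ord3P j) => -> //= _; exact: subrr.
Qed.

Lemma cartan_subspace : subspace h.
Proof. by have [[]] := cartanP D. Qed.

Lemma cartan_decomposition x : h x -> x = Phi x i0 i0 *: bh + (Phi x i0 i0 + Phi x i1 i1) *: bg.
Proof.
move=> /(cartan_Phi S) hx; have := decomposition S x.
by rewrite (hx i0 i1) // (hx i1 i0) // (hx i0 i2) // (hx i1 i2) // (hx i2 i1) // (hx i2 i0) // !scale0r !addr0 !add0r.
Qed.

Lemma neg_alpha1_Phi s : h s -> (- a1) s = Phi s i1 i1 - Phi s i0 i0.
Proof. by move=> hs; rewrite -opprB -(alpha1_Phi S hs). Qed.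
Lemma alpha12_Phi s : h s -> (a1 + a2) s = Phi s i0 i0 - Phi s i2 i2.
Proof.
move=> hs; rewrite (_ : (a1 + a2) s = a1 s + a2 s) // (alpha1_Phi S hs) (alpha2_Phi S hs); ring.
Qed.

Lemma root_be : root_space h a1 be.
Proof. by apply/(@root_space_Phi _ _ S _ i0 i1) => // [s|]; [apply: alpha1_Phi|rewrite Phi_be mE_E scale1r]. Qed.
Lemma root_bf : root_space h (- a1) bf.
Proof. by apply/(@root_space_Phi _ _ S _ i1 i0) => // [s|]; [apply: neg_alpha1_Phi|rewrite Phi_bf mE_E scale1r]. Qed.
Lemma root_bxm : root_space h a2 bxm.
Proof. by apply/(@root_space_Phi _ _ S _ i1 i2) => // [s|]; [apply: alpha2_Phi|rewrite Phi_bxm mE_E scale1r]. Qed.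
Lemma root_bxp : root_space h (a1 + a2) bxp.
Proof. by apply/(@root_space_Phi _ _ S _ i0 i2) => // [s|]; [apply: alpha12_Phi|rewrite Phi_bxp mE_E scale1r]. Qed.

Lemma root_space_be x : root_space h a1 x -> x = Phi x i0 i1 *: be.
Proof.
move=> /(@root_space_Phi _ _ S _ i0 i1 x isT (@alpha1_Phi _ _ S)) xE.
by apply: (Phi_inj (s := S)); rewrite PhiZ Phi_be.
Qed.
Lemma root_space_bf x : root_space h (- a1) x -> x = Phi x i1 i0 *: bf.
Proof.
move=> /(@root_space_Phi _ _ S _ i1 i0 x isT neg_alpha1_Phi) xE.
by apply: (Phi_inj (s := S)); rewrite PhiZ Phi_bf.
Qed.
Lemma root_space_bxm x : root_space h a2 x -> x = Phi x i1 i2 *: bxm.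
Proof.
move=> /(@root_space_Phi _ _ S _ i1 i2 x isT (@alpha2_Phi _ _ S)) xE.
by apply: (Phi_inj (s := S)); rewrite PhiZ Phi_bxm.
Qed.
Lemma root_space_bxp x : root_space h (a1 + a2) x -> x = Phi x i0 i2 *: bxp.
Proof.
move=> /(@root_space_Phi _ _ S _ i0 i2 x isT alpha12_Phi) xE.
by apply: (Phi_inj (s := S)); rewrite PhiZ Phi_bxp.
Qed.

(** The brackets of the two opposite root spaces span the line of E_ii - E_jj, and the condition
    [al x = 2] fixes the scalar. *)
Lemma coroot_unique al (i j : 'I_3) x y : i != j ->
  (forall s, h s -> al s = Phi s i i - Phi s j j) ->
  Phi y = mE C i i - mE C j j -> coroot h al x -> x = y.
Proof.
move=> ij alE yE [xs ax].
have nalE s : h s -> (- al) s = Phi s j j - Phi s i i by move=> hs; rewrite -opprB -alE.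
pose T := [set z : L | exists c, z = c *: y].
have sT : subspace T.
  split; first by exists 0; rewrite scale0r.
  by move=> c u v [c1 ->] [c2 ->]; exists (c * c1 + c2); vect C (sl C 3).
have [c xE] : T x.
  move: x xs ax => x xs _; apply: (smallest_ind sT _ xs).
  move=> _ [u ru [v rv <-]]; exists (Phi u i j * Phi v j i).
  move: ru rv => /(@root_space_Phi _ _ S _ _ _ _ ij alE) uE; rewrite eq_sym in ij.
  move=> /(@root_space_Phi _ _ S _ _ _ _ ij nalE) vE.
  apply: (Phi_inj (s := S)); rewrite PhiZ yE Phi_lie uE vE -!scalemxAl -!scalemxAr !delta_mulE !eqxx.
  by rewrite !mxE !mE_E !eqxx /=; vect C 'M[C]_3.
have hy : h y.
  apply/(cartan_Phi S) => k l kl; rewrite yE !mxE !mE_E.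
  have F (m : 'I_3) : (k == m) && (l == m) = false.
    by apply/negP => /andP[/eqP km /eqP lm]; rewrite km lm eqxx in kl.
  by rewrite !F subrr.
have hx : h x by rewrite xE; apply: (subspaceZ cartan_subspace).
move: ax; rewrite (alE x hx) xE PhiZ yE !mxE !mE_E !eqxx (negPf ij) eq_sym (negPf ij) /= => e.
have c1 : c = 1.
  have n2 : 2%:R != 0 :> C by rewrite pnatr_eq0.
  by apply: (mulfI n2); rewrite mulr1 -[RHS]e; ring.
by rewrite c1 scale1r.
Qed.

Lemma h1E : h1 D = bh.
Proof.
apply: (@coroot_unique a1 i0 i1) (h1P D) => // [s|]; [exact: alpha1_Phi|exact: Phi_bh].
Qed.
Lemma h2E : h2 D = bg.
Proof.
apply: (@coroot_unique a2 i1 i2) (h2P D) => // [s|]; [exact: alpha2_Phi|exact: Phi_bg].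
Qed.

Lemma k_sub_subalg : lie_subalg (k_sub D).
Proof.
split=> [|x y kx ky X XG]; last first.
  by have [[_ Xl] _] := XG; apply: Xl; [apply: kx|apply: ky].
split=> [X [[sX _] _]|a u v ku kv X XG]; first exact: sX.1.
by have [[sX _] _] := XG; apply: sX.2; [apply: ku|apply: kv].
Qed.

Lemma k_sub_be : k_sub D be.
Proof. by apply: smallest_mem; left; apply: root_be. Qed.
Lemma k_sub_bf : k_sub D bf.
Proof. by apply: smallest_mem; right; apply: root_bf. Qed.
Lemma k_sub_bh : k_sub D bh.
Proof. by rewrite -lie_ef; apply: k_sub_subalg.2; [apply: k_sub_be|apply: k_sub_bf]. Qed.

Lemma k_sub_decomposition x : k_sub D x ->
  x = Phi x i0 i1 *: be + Phi x i1 i0 *: bf + Phi x i0 i0 *: bh.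
Proof.
pose T := [set x : L | exists a b c : C, x = a *: be + b *: bf + c *: bh].
have sT : lie_subalg T.
  split; first split.
  - by exists 0, 0, 0; rewrite !scale0r !addr0.
  - move=> k _ _ [a [b [c ->]]] [a' [b' [c' ->]]].
    by exists (k * a + a'), (k * b + b'), (k * c + c'); vect C (sl C 3).
  move=> _ _ [a [b [c ->]]] [a' [b' [c' ->]]].
  exists ((c * a' - a * c') * 2%:R), (- (c * b' - b * c') * 2%:R), (a * b' - b * a').
  apply: (Phi_inj (s := S)); rewrite Phi_lie !(PhiD, PhiZ) !Phi_b.
  rewrite ?(mulmxBl, mulmxBr, mulmxDl, mulmxDr) -?scalemxAl -?scalemxAr
    ?(mulmxBl, mulmxBr, delta_mulE, ord3_eqE, eqxx).
  by vect_with false C 'M[C]_3.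
move=> kx; have [a [b [c ->]]] : T x.
  apply: smallest_ind kx => // y [/root_space_be ->|/root_space_bf ->].
    by exists (Phi y i0 i1), 0, 0; rewrite !scale0r !addr0.
  by exists 0, (Phi y i1 i0), 0; rewrite !scale0r addr0 add0r.
rewrite !(PhiD, PhiZ) !Phi_b !(mxE, mE_E) !ord3_eqE !eqxx /=.
by vect C (sl C 3).
Qed.

Lemma p_plus_subspace : subspace (p_plus D).
Proof. exact: lspan_subspace. Qed.
Lemma p_plus_cartan : h `<=` p_plus D.
Proof. by move=> x hx; apply: smallest_mem; do 3 left. Qed.
Lemma p_plus_k : k_sub D `<=` p_plus D.
Proof. by move=> x hx; apply: smallest_mem; do 2 left; right. Qed.
Lemma p_plus_be : p_plus D be. Proof. by apply: p_plus_k; apply: k_sub_be. Qed.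
Lemma p_plus_bf : p_plus D bf. Proof. by apply: p_plus_k; apply: k_sub_bf. Qed.
Lemma p_plus_bh : p_plus D bh. Proof. by apply: p_plus_k; apply: k_sub_bh. Qed.
Lemma p_plus_bg : p_plus D bg. Proof. by apply: p_plus_cartan; apply: cartan_bg. Qed.
Lemma p_plus_bxm : p_plus D bxm.
Proof. by apply: smallest_mem; left; right; apply: root_bxm. Qed.
Lemma p_plus_bxp : p_plus D bxp.
Proof. by apply: smallest_mem; right; apply: root_bxp. Qed.

Lemma p_plus_decomposition x : p_plus D x ->
  x = Phi x i0 i1 *: be + Phi x i1 i0 *: bf + Phi x i0 i0 *: bh + (Phi x i0 i0 + Phi x i1 i1) *: bg
    + Phi x i0 i2 *: bxp + Phi x i1 i2 *: bxm.
Proof.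
pose T := [set x : L | Phi x i2 i0 = 0 /\ Phi x i2 i1 = 0].
have sT : subspace T.
  split; first by rewrite /T /= Phi0 !mxE.
  by move=> a u v [u0 u1] [v0 v1]; rewrite /T /= Phi_linear !mxE u0 u1 v0 v1 mulr0 addr0.
move=> px; have [x0 x1] : T x.
  apply: smallest_ind px => // y [[[|]|]|].
  - by move=> /(cartan_Phi S) hy; split; apply: hy.
  - move=> /k_sub_decomposition ->; rewrite /T /= !(PhiD, PhiZ) !Phi_b !(mxE, mE_E) !ord3_eqE.
    by rewrite /= ?andbF !(mulr0, subr0, addr0).
  - move=> /root_space_bxm ->; rewrite /T /= !PhiZ !Phi_b !(mxE, mE_E) !ord3_eqE.
    by rewrite /= ?andbF !mulr0.
  - move=> /root_space_bxp ->; rewrite /T /= !PhiZ !Phi_b !(mxE, mE_E) !ord3_eqE.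
    by rewrite /= ?andbF !mulr0.
by have := decomposition S x; rewrite x0 x1 !scale0r !addr0.
Qed.

Section Rep.
Variable M : liemod [set: L].
Local Notation op x := (@act_at _ _ _ M x I : {linear M -> M}).

Fact opE x y z (v : M) : lie x y = z -> op x (op y v) = op y (op x v) + act z v.
Proof. by move=> <- /=; rewrite /act_at act_lie. Qed.
Fact op0 (v : M) : act (0 : L) v = 0. Proof. exact: act0l. Qed.
Fact opZ a (x : L) (v : M) : act (a *: x) v = a *: op x v. Proof. exact: act_scale. Qed.
Fact opN (x : L) (v : M) : act (- x) v = - op x v.
Proof. by rewrite -[X in act X]scaleN1r opZ scaleN1r. Qed.
Fact opNZ a (x : L) (v : M) : act (- (a *: x)) v = - (a *: op x v).
Proof. by rewrite opN; congr (- _); apply: opZ. Qed.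

(** Transparent, because later proofs pass between [e_ rep_of v] and [act be v] by conversion. *)
Definition rep_of : sl3_rep M.
Proof.
apply: (@Sl3Rep _ M (op be) (op bf) (op bh) (op bg) (op bxp) (op bxm) (op byp) (op bym)) => v.
- by rewrite (opE v (lie_he S)) opZ.
- by rewrite (opE v (lie_hf S)) opNZ.
- by rewrite (opE v (lie_hxp S)).
- by rewrite (opE v (lie_hxm S)) opN.
- by rewrite (opE v (lie_hyp S)).
- by rewrite (opE v (lie_hym S)) opN.
- by rewrite (opE v (lie_ge S)) opN.
- by rewrite (opE v (lie_gf S)).
- by rewrite (opE v (lie_gxp S)).
- by rewrite (opE v (lie_gxm S)) opZ.
- by rewrite (opE v (lie_gyp S)) opNZ.
- by rewrite (opE v (lie_gym S)) opN.
- by rewrite (opE v (lie_gh S)) op0 addr0.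
- by rewrite (opE v (lie_ef S)).
- by rewrite (opE v (lie_exp S)) op0 addr0.
- by rewrite (opE v (lie_exm S)).
- by rewrite (opE v (lie_eyp S)) op0 addr0.
- by rewrite (opE v (lie_eym S)) opN.
- by rewrite (opE v (lie_xpf S)) opN.
- by rewrite (opE v (lie_xmf S)) op0 addr0.
- by rewrite (opE v (lie_ypf S)).
- by rewrite (opE v (lie_ymf S)) op0 addr0.
- by rewrite (opE v (lie_xpxm S)) op0 addr0.
- by rewrite (opE v (lie_ypym S)) op0 addr0.
- by rewrite (opE v (lie_xpyp S)).
- by rewrite (opE v (lie_xpym S)) act_add // addrA.
- by rewrite (opE v (lie_xmyp S)).
- by rewrite (opE v (lie_xmym S)).
Defined.

Lemma act_decomposition x (v : M) : act x v =
  Phi x i0 i1 *: e_ rep_of v + Phi x i1 i0 *: f_ rep_of v + Phi x i0 i0 *: h_ rep_of v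
  + (Phi x i0 i0 + Phi x i1 i1) *: g_ rep_of v + Phi x i0 i2 *: xp_ rep_of v
  + Phi x i1 i2 *: xm_ rep_of v + Phi x i2 i1 *: yp_ rep_of v + Phi x i2 i0 *: ym_ rep_of v.
Proof. by rewrite {1}(decomposition S x) !act_add // !act_scale. Qed.

Lemma rep_stable_submodule W : rep_stable rep_of W <-> submodule W.
Proof.
split=> [[sW Wop]|[sW Wact]]; last by split=> // T v [] Wv; apply: Wact.
split=> // x v _ Wv; rewrite act_decomposition.
have Z (c : C) T : rep_op rep_of T -> W (c *: T v).
  by move=> opT; apply: (subspaceZ sW); apply: Wop.
by do 7 ?[apply: (subspaceD sW)]; apply: Z; constructor.
Qed.

Lemma simple_rep : simple_mod M -> rep_simple rep_of.
Proof.
move=> [_ _ simple] W /rep_stable_submodule sW [w Ww w0] v.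
by have [W0|-> //] := simple _ sW (@subsetT _ W); move: Ww w0; rewrite W0 => ->; rewrite eqxx.
Qed.

Lemma simple_neq0 : simple_mod M -> exists v : M, v != 0.
Proof.
move=> [_ n0 _]; apply/not_existsP => h; apply: n0; apply/seteqP; split=> // v _ /=.
by apply/eqP/negPn/negP/h.
Qed.

End Rep.

End StandardBasis.

(** * Submodules as modules *)

Section SubModule.
Variables (K : fieldType) (L : lieAlgType K) (p : set L) (M : liemod p) (W : set M).
Hypothesis sW : submodule W.

Definition sub_pred of submodule W : {pred M} := fun v => `[< W v >].

Fact sub_pred_closed : submod_closed (sub_pred sW).
Proof.
have [[W0 Wl] _] := sW; split=> [|a u v /asboolP Wu /asboolP Wv]; apply/asboolP => //.
exact: Wl.
Qed.
HB.instance Definition _ := GRing.isSubmodClosed.Build K M (sub_pred sW) sub_pred_closed.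

Record sub_carrier := SubCarrier { sub_val :> M; sub_valP : sub_val \in sub_pred sW }.
HB.instance Definition _ := [isSub for sub_val].
HB.instance Definition _ := [Choice of sub_carrier by <:].
HB.instance Definition _ := [SubChoice_isSubLmodule of sub_carrier by <:].

(** For [x] outside [p] the vector may leave [W], hence the default 0; [lie_action] constrains only
    [x] in [p]. *)
Definition sub_act (x : L) (u : sub_carrier) : sub_carrier := insubd (0 : sub_carrier) (act x (sub_val u)).

Lemma sub_valW (u : sub_carrier) : W (sub_val u).
Proof. exact/asboolP/(sub_valP u). Qed.

Lemma sub_act_val x u : W (act x (sub_val u)) -> sub_val (sub_act x u) = act x (sub_val u).
Proof. by move=> Wx; apply: (insubdK (sT := sub_carrier)); apply/asboolP. Qed.

Lemma sub_act_valp x u : p x -> sub_val (sub_act x u) = act x (sub_val u).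
Proof. by move=> px; apply: sub_act_val; apply: sW.2 => //; apply: sub_valW. Qed.

Lemma sub_val_linear : linear sub_val.
Proof. by move=> a u v; apply: (linearP (val : sub_carrier -> M)). Qed.

Lemma sub_val_inj : injective sub_val.
Proof. exact: (@val_inj _ _ sub_carrier). Qed.

Fact sub_actP : lie_action p sub_act.
Proof.
have [h1 h2 h3] := actP M; have [[_ Wl] Wa] := sW.
split=> [x px a u v|a x y v px py|x y v px py]; apply: sub_val_inj.
- by rewrite sub_val_linear !sub_act_valp // sub_val_linear h1.
(* [p] is an arbitrary set and need not contain [a *: x + y]; membership of the image in [W] comes
   from the right-hand side instead. The bracket below is treated in the same way. *)
- rewrite sub_val_linear (sub_act_valp _ px) (sub_act_valp _ py) sub_act_val h2 //.
  by apply: Wl; apply: Wa => //; apply: sub_valW.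
- have sub s t : sub_val (s - t) = sub_val s - sub_val t.
    have -> : s - t = (-1) *: t + s by rewrite scaleN1r addrC.
    by rewrite sub_val_linear scaleN1r addrC.
  have Wv := sub_valW v.
  rewrite sub !(sub_act_valp _ px, sub_act_valp _ py) sub_act_val h3 //.
  by rewrite addrC -scaleN1r; apply: Wl; apply/Wa => //; apply/Wa.
Qed.

Definition submod : liemod p := LieMod sub_actP.

Lemma submod_simple : simple_submodule W -> simple_mod submod.
Proof.
move=> [_ W0 Wsimple].
have v0 : sub_val 0 = 0 := linear0_fun sub_val_linear.
split=> [|E|U [[U0 Ul] Ua] _].
- by [].
- apply: W0; apply/seteqP; split=> [w Ww|w ->]; last exact: sW.1.1.
  have Pw : w \in sub_pred sW by apply/asboolP.
  have : [set: submod] (SubCarrier Pw) by [].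
  by rewrite E => /(congr1 sub_val); rewrite v0.
have sU : submodule (sub_val @` U).
  split; first split; first by exists 0.
    by move=> a _ _ [u Uu <-] [v Uv <-]; exists (a *: u + v); [apply: Ul|apply: sub_val_linear].
  by move=> x _ px [u Uu <-]; exists (sub_act x u); [apply: Ua|rewrite sub_act_valp].
have [|UE|UE] := Wsimple _ sU; first by move=> _ [u _ <-]; apply: sub_valW.
  left; apply/seteqP; split=> [u Uu|u ->] //.
  have : (sub_val @` U) (sub_val u) by exists u.
  by rewrite UE -v0 => /sub_val_inj.
right; apply/seteqP; split=> // u _.
have : (sub_val @` U) (sub_val u) by rewrite UE; apply: sub_valW.
by case=> v Uv /sub_val_inj <-.
Qed.

Lemma submod_has_dim n : has_dim W n -> has_dim [set: submod] n.
Proof.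
have W0 := sW.1.1; move=> /(has_dimP _ W0)[e [We g] fe]; apply/has_dimP => //.
have Pe i : e i \in sub_pred sW by apply/asboolP.
pose e' i : submod := SubCarrier (Pe i).
have vE (c : 'I_n -> K) : sub_val (\sum_i c i *: e' i) = \sum_i c i *: e i.
  exact: (linear_sum_fun c e' sub_val_linear).
exists e'; first split=> // w _.
  have [c wE] := g _ (sub_valW w); exists c; apply: sub_val_inj; rewrite vE; exact: wE.
move=> c c0; apply: fe; rewrite -vE c0; exact: (linear0_fun sub_val_linear).
Qed.

End SubModule.

(** * Irreducible sl(2)-modules and homomorphisms from them *)

Section Sl2Span.
Variables (K : numFieldType) (V : lmodType K) (e f h : {linear V -> V}).
Hypothesis hf : forall v, h (f v) = f (h v) - 2%:R *: f v.
Hypothesis ef : forall v, e (f v) = f (e v) + h v.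
Variables (n : nat) (v : V).
Hypotheses (v0 : v != 0) (ev : e v = 0) (hv : h v = n%:R *: v) (fv : iter n.+1 f v = 0).

Definition f_span : set V :=
  [set w | exists c : 'I_n.+1 -> K, w = \sum_i c i *: iter i f v].

Lemma f_span_subspace : subspace f_span.
Proof. exact: lin_comb_subspace. Qed.

Lemma f_span_iter k : f_span (iter k f v).
Proof.
have [kn|nk] := ltnP k n.+1; first exact: (lin_comb_mem _ (Ordinal kn)).
rewrite -(subnK nk) iterD fv (linear0_fun (iter_linear f _)).
exact: f_span_subspace.1.
Qed.

Lemma f_span_mem : f_span v. Proof. exact: (f_span_iter 0). Qed.

Lemma f_span_stable (T : {linear V -> V}) :
  (forall k, f_span (T (iter k f v))) -> forall w, f_span w -> f_span (T w).
Proof.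
move=> h1 w [c ->]; rewrite linear_sum; apply: (subspace_sum f_span_subspace) => i _.
by rewrite (linZ T); apply: (subspaceZ f_span_subspace).
Qed.

Lemma f_span_f w : f_span w -> f_span (f w).
Proof. by apply: f_span_stable => k; apply: (f_span_iter k.+1). Qed.
Lemma f_span_h w : f_span w -> f_span (h w).
Proof.
apply: f_span_stable => k; rewrite (h_iter_f hf k hv).
by apply: (subspaceZ f_span_subspace); apply: f_span_iter.
Qed.
Lemma f_span_e w : f_span w -> f_span (e w).
Proof.
apply: f_span_stable => -[|k]; first by rewrite /= ev; apply: f_span_subspace.1.
rewrite (e_iter_f hf ef k ev hv).
by apply: (subspaceZ f_span_subspace); apply: f_span_iter.
Qed.

Lemma f_span_basis : generates f_span (fun i : 'I_n.+1 => iter i f v) /\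
  free_family (fun i : 'I_n.+1 => iter i f v).
Proof.
by split; [split=> // i; apply: f_span_iter|apply: (iter_f_free hf ef v0 ev hv)].
Qed.

Lemma f_span_has_dim : has_dim f_span n.+1.
Proof.
apply/(has_dimP _ f_span_subspace.1).
by exists (fun i : 'I_n.+1 => iter i f v); have [] := f_span_basis.
Qed.

Lemma f_span_irreducible W : subspace W -> (forall w, W w -> W (e w)) ->
  (forall w, W w -> W (f w)) -> W `<=` f_span -> W = [set 0] \/ W = f_span.
Proof.
move=> sW We Wf Wsub; have [[w Ww w0]|no] := pselect (exists2 w, W w & w != 0); last first.
  left; apply/seteqP; split=> [w Ww|w ->]; last exact: sW.1.
  by apply/eqP/negPn/negP => w0; apply: no; exists w.
right; apply/seteqP; split=> // u [c ->]; apply: (subspace_sum sW) => i _; apply: (subspaceZ sW).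
have Wv : W v.
  have [d wE] := Wsub _ Ww; rewrite wE in Ww w0.
  (* Extension by 0 to all natural indices, the form in which [iter_f_span_simple] takes its
     coefficients. *)
  pose d' k := if insub k is Some i then d i else 0.
  have dE : \sum_i d i *: iter i f v = \sum_(i < n.+1) d' i *: iter i f v.
    by apply: eq_bigr => k _; rewrite /d' valK.
  rewrite dE in Ww w0.
  exact: (iter_f_span_simple hf ef v0 ev hv (leqnn n) sW We Ww w0).
by elim: (nat_of_ord i) => //= k; apply: Wf.
Qed.

Hypothesis f_span_full : f_span = [set: V].
Variable W : lmodType K.

Lemma f_span_ext (phi psi : V -> W) : linear phi -> linear psi ->
  (forall k, phi (iter k f v) = psi (iter k f v)) -> phi = psi.
Proof.
move=> phil psil E; apply/funext => x; have : [set: V] x by [].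
rewrite -f_span_full => -[c ->]; rewrite !linear_sum_fun //.
by apply: eq_bigr => i _; rewrite E.
Qed.

(** The map sends [f^k v] to [f'^k u], also for [k > n], where both sides vanish. The last clause
    reduces commutation with any pair [T], [T'] to the string vectors, so that one construction
    serves k and the parabolic subalgebra. *)
Lemma f_span_hom (f' : {linear W -> W}) u : iter n.+1 f' u = 0 ->
  exists phi : V -> W, [/\ linear phi, forall k, phi (iter k f v) = iter k f' u
    & forall (T : {linear V -> V}) (T' : {linear W -> W}),
        (forall k, phi (T (iter k f v)) = T' (iter k f' u)) ->
        forall x, phi (T x) = T' (phi x)].
Proof.
move=> fu; have [[_ g] ff] := f_span_basis; rewrite f_span_full in g.
have /choice[c cE] : forall x : V, exists c : 'I_n.+1 -> K, x = \sum_i c i *: iter i f v.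
  by move=> x; apply: g.
have c_uniq x (d : 'I_n.+1 -> K) : x = \sum_i d i *: iter i f v -> c x = d.
  move=> xE; apply/funext => i; apply/subr0_eq; apply: (ff (fun i => c x i - d i)).
  under eq_bigr do rewrite scalerBl.
  by rewrite sumrB -cE -xE subrr.
pose phi (x : V) : W := \sum_i c x i *: iter i f' u.
have phi_lin : linear phi.
  move=> d x y; rewrite /phi (c_uniq _ (fun i => d * c x i + c y i)).
    rewrite scaler_sumr -big_split; apply: eq_bigr => i _.
    by rewrite /= scalerDl scalerA.
  rewrite {1}(cE x) {1}(cE y) scaler_sumr -big_split; apply: eq_bigr => i _.
  by rewrite /= scalerDl scalerA.
have phi_iter k : phi (iter k f v) = iter k f' u.
  have [kn|nk] := ltnP k n.+1; last first.
    rewrite -(subnK nk) !iterD fv fu !(linear0_fun (iter_linear _ _)).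
    exact: linear0_fun.
  have delta (U : lmodType K) (w : nat -> U) : \sum_(i < n.+1) (i == Ordinal kn)%:R *: w i = w k.
    rewrite (bigD1 (Ordinal kn)) //= eqxx scale1r big1 ?addr0 // => i /negPf ->.
    by rewrite scale0r.
  by rewrite /phi (c_uniq _ (fun i => (i == Ordinal kn)%:R)) delta.
exists phi; split=> // T T' TT' x.
apply: (f_equal (fun F => F x) (@f_span_ext (phi \o T) (T' \o phi) _ _ _)) => [a y z|a y z|k] /=.
- by rewrite linearP phi_lin.
- by rewrite phi_lin linearP.
- by rewrite TT' phi_iter.
Qed.

End Sl2Span.

Lemma the_modP (K : fieldType) (L : lieAlgType K) (p : set L) (P : liemod p -> Prop) :
  (exists M, P M) -> P (the_mod P).
Proof.
by move=> ex; rewrite /the_mod; case: pselect => // h1; case: (cid h1).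
Qed.

Section Sl2Modules.
Variables (C : numClosedFieldType) (D : cartan_data (sl C 3)) (S : standard_form D).
Local Notation Phi := (Phi S).
Local Notation L := (sl C 3).
Local Notation be := (be_ S).
Local Notation bf := (bf_ S).
Local Notation bh := (bh_ S).

Section Ops.
Variables (p : set L) (sp : subspace p) (pe : p be) (pf : p bf) (ph : p bh) (M : liemod p).
Local Notation e := (@act_at _ _ _ M _ pe : {linear M -> M}).
Local Notation f := (@act_at _ _ _ M _ pf : {linear M -> M}).
Local Notation h := (@act_at _ _ _ M _ ph : {linear M -> M}).
Fact sl2_he v : h (e v) = e (h v) + 2%:R *: e v.
Proof. by rewrite /= /act_at act_lie // lie_he act_scale. Qed.
Fact sl2_hf v : h (f v) = f (h v) - 2%:R *: f v.
Proof. by rewrite /= /act_at act_lie // lie_hf -(scaleNr _ bf) act_scale // scaleNr. Qed.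
Fact sl2_ef v : e (f v) = f (e v) + h v.
Proof. by rewrite /= /act_at act_lie // lie_ef. Qed.
End Ops.

Let ke : k_sub D be := k_sub_be S.
Let kf : k_sub D bf := k_sub_bf S.
Let kh : k_sub D bh := k_sub_bh S.
Let sk : subspace (k_sub D) := (k_sub_subalg D).1.

Section KModule.
Variable V : liemod (k_sub D).
Local Notation e := (@act_at _ _ _ V _ ke : {linear V -> V}).
Local Notation f := (@act_at _ _ _ V _ kf : {linear V -> V}).
Local Notation h := (@act_at _ _ _ V _ kh : {linear V -> V}).

Lemma k_act x v : k_sub D x ->
  act x v = Phi x i0 i1 *: e v + Phi x i1 i0 *: f v + Phi x i0 i0 *: h v.
Proof.
move=> /(k_sub_decomposition S) {1}->; have sZ := subspaceZ sk; have sD := subspaceD sk.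
by rewrite !act_add ?act_scale //; do ?[apply: sZ|apply: sD] => //; apply: sZ.
Qed.

Lemma k_submodule (W : set V) : subspace W -> (forall v, W v -> W (e v)) ->
  (forall v, W v -> W (f v)) -> (forall v, W v -> W (h v)) -> submodule W.
Proof.
move=> sW We Wf Wh; split=> // x v kx Wv; rewrite k_act //.
by do 2 ?apply: (subspaceD sW); apply: (subspaceZ sW); [apply: We|apply: Wf|apply: Wh].
Qed.

Lemma k_simple_dim n : simple_mod V -> has_dim [set: V] n ->
  exists m v, [/\ n = m.+1, v != 0, e v = 0, h v = m%:R *: v & iter m.+1 f v = 0].
Proof.
move=> [sV V0 Vs] dV.
have nz : exists2 v : V, [set: V] v & v != 0.
  apply/not_exists2P => no; apply: V0; apply/seteqP; split=> // v _ /=.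
  by apply/eqP/negPn/negP => v0; have [no1|] := no v; [apply: no1|].
have [m [v [_ v0 ev hv fv]]] := has_dim_singular (sl2_he sk ke kh (M := V))
  (sl2_hf sk kf kh (M := V)) (sl2_ef ke kf kh (M := V)) sV.1 dV
  (fun _ _ => I) (fun _ _ => I) (fun _ _ => I) nz.
exists m, v; split=> //.
have hf := sl2_hf sk kf kh (M := V); have ef := sl2_ef ke kf kh (M := V).
have fT : f_span f m v = [set: V].
  have sW : submodule (f_span f m v).
    apply: k_submodule => [|w|w|w]; first exact: f_span_subspace.
    - exact: f_span_e.
    - exact: f_span_f.
    - exact: f_span_h.
  have [f0|//] := Vs _ sW (@subsetT _ _).
  by have := f_span_mem fv; rewrite f0 => /eqP; rewrite (negPf v0).
apply: (has_dim_uniq (S := [set: V])) => //; rewrite -fT; exact: f_span_has_dim.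
Qed.

Lemma k_f_span_simple n v : v != 0 -> e v = 0 -> h v = n%:R *: v -> iter n.+1 f v = 0 ->
  simple_submodule (f_span f n v).
Proof.
have hf := sl2_hf sk kf kh (M := V); have ef := sl2_ef ke kf kh (M := V).
move=> v0 ev hv fv; split.
- apply: k_submodule => [|w|w|w]; first exact: f_span_subspace.
  + exact: f_span_e.
  + exact: f_span_f.
  + exact: f_span_h.
- by move=> E; have := f_span_mem fv; rewrite E => /eqP; rewrite (negPf v0).
- move=> W [sW Wa] Wsub; apply: (f_span_irreducible hf ef v0 ev hv) => // w Ww; exact: Wa.
Qed.

End KModule.

Section Hom.
Variables (n : nat) (M : liemod [set: L]).
Local Notation rho := (rep_of S M).
Variable V : liemod (k_sub D).
Hypotheses (V_simple : simple_mod V) (V_dim : has_dim [set: V] n.+1).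
Local Notation e := (@act_at _ _ _ V _ ke : {linear V -> V}).
Local Notation f := (@act_at _ _ _ V _ kf : {linear V -> V}).
Local Notation h := (@act_at _ _ _ V _ kh : {linear V -> V}).

Definition k_singular : set M := [set w | e_ rho w = 0 /\ h_ rho w = n%:R *: w].

Lemma k_singular_subspace : subspace k_singular.
Proof.
split; first by split; rewrite linear0 ?scaler0.
move=> a u v [eu hu] [ev hv]; split; rewrite linearP ?eu ?ev ?hu ?hv ?scaler0 ?addr0 //.
by vect C M.
Qed.

Hypothesis f_nil : forall w, k_singular w -> iter n.+1 (f_ rho) w = 0.

(** Evaluation at the highest weight vector [v] of [V] identifies the homomorphisms with the
    singular vectors of weight [n]. Surjectivity is where [f_nil] enters, as [f^(n+1) v = 0] in
    [V]. *)
Lemma hom_evaluation : exists v : V,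
  [/\ forall phi, lie_hom V (res_k D M) phi -> k_singular (phi v),
      forall phi, lie_hom V (res_k D M) phi -> phi v = 0 -> phi = 0
    & forall w, k_singular w -> exists2 phi, lie_hom V (res_k D M) phi & phi v = w].
Proof.
have [m [v [[nm] v0 ev hv fv]]] := k_simple_dim V_simple V_dim; subst m.
have hf := sl2_hf sk kf kh (M := V); have ef := sl2_ef ke kf kh (M := V).
have fT : f_span f n v = [set: V].
  have [_ _ Vs] := V_simple; have [sW W0 _] := k_f_span_simple v0 ev hv fv.
  by have [] := Vs _ sW (@subsetT _ _).
exists v; split.
- move=> phi [pl pa]; split.
    have := pa _ v ke; rewrite [act be v]ev (linear0_fun pl) => E; exact: esym E.
  have := pa _ v kh; rewrite [act bh v]hv (linearZ_fun pl) => E; exact: esym E.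
- move=> phi [pl pa] phi0; apply: (f_span_ext fT) => // [a x y|k].
    by rewrite /= scaler0 addr0.
  have -> : phi (iter k f v) = iter k (f_ rho) (phi v).
    by elim: k => //= k IHk; rewrite [LHS](pa _ _ kf) IHk.
  by rewrite phi0; apply: (linear0_fun (iter_linear _ _)).
move=> w [ew hw]; have fw : iter n.+1 (f_ rho) w = 0 by apply: f_nil.
have [phi [pl pk comm]] := f_span_hom hf ef v0 ev hv fv fT fw.
have pZ := linearZ_fun pl; exists phi; last exact: (pk 0%N).
have Fe : forall x, phi (e x) = e_ rho (phi x).
  apply: comm => -[|k]; first by rewrite /= ev ew (linear0_fun pl).
  by rewrite (e_iter_f hf ef k ev hv) (e_iter_f (r_hf rho) (r_ef rho) k ew hw) pZ pk.
have Ff : forall x, phi (f x) = f_ rho (phi x) by apply: comm => k; rewrite -!iterS.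
have Fh : forall x, phi (h x) = h_ rho (phi x).
  by apply: comm => k; rewrite (h_iter_f hf k hv) (h_iter_f (r_hf rho) k hw) pZ pk.
split=> // x y kx; rewrite k_act // [act x _](k_act (V := res_k D M)) //.
by rewrite !(linearD_fun pl) !pZ [phi (f y)]Ff [phi (e y)]Fe [phi (h y)]Fh.
Qed.

Lemma hom_subspace : subspace (lie_hom V (res_k D M)).
Proof.
split.
  split=> [a u w|x v kx]; first by rewrite /= scaler0 addr0.
  by have [l _ _] := actP (res_k D M); rewrite /= (linear0_fun (l x kx)).
move=> a phi psi [pl pa] [ql qa]; have [l _ _] := actP (res_k D M); split.
  move=> b u w; rewrite [LHS](_ : _ = a *: phi (b *: u + w) + psi (b *: u + w)) //.
  rewrite [RHS](_ : _ = b *: (a *: phi u + psi u) + (a *: phi w + psi w)) //.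
  by rewrite pl ql; vect C (res_k D M).
move=> x v kx; rewrite [LHS](_ : _ = a *: phi (act x v) + psi (act x v)) // pa // qa //.
by rewrite -(l x kx).
Qed.

Lemma hom_dim d : has_dim (lie_hom V (res_k D M)) d <-> has_dim k_singular d.
Proof.
have [v [vS v_inj v_onto]] := hom_evaluation.
by apply: (has_dim_transport (f := fun phi : V -> res_k D M => phi v : M) _ hom_subspace).
Qed.

End Hom.

End Sl2Modules.

(** * Existence of highest weight modules *)

Section RepToModule.
Variables (C : numClosedFieldType) (D : cartan_data (sl C 3)) (S : standard_form D).
Variables (V : lmodType C) (rho : sl3_rep V).
Local Notation L := (sl C 3).

Definition rep_act (x : L) (v : V) : V := let A := Phi S x in
  A i0 i1 *: e_ rho v + A i1 i0 *: f_ rho v + A i0 i0 *: h_ rho v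
  + (A i0 i0 + A i1 i1) *: g_ rho v + A i0 i2 *: xp_ rho v
  + A i1 i2 *: xm_ rho v + A i2 i1 *: yp_ rho v + A i2 i0 *: ym_ rho v.

Lemma rep_act_linear x : linear (rep_act x).
Proof. by move=> a u v; rewrite /rep_act /= !linearP /=; vect C V. Qed.

Lemma rep_act_comb a x y v : rep_act (a *: x + y) v = a *: rep_act x v + rep_act y v.
Proof. by rewrite /rep_act /= Phi_linear !mxE; vect C V. Qed.

Lemma rep_act0 v : rep_act 0 v = 0.
Proof. by have := rep_act_comb (-1) 0 0 v; rewrite scaler0 addr0 scaleN1r addNr. Qed.
Lemma rep_actZ a x v : rep_act (a *: x) v = a *: rep_act x v.
Proof. by rewrite -[X in rep_act X]addr0 rep_act_comb rep_act0 addr0. Qed.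
Lemma rep_actD x y v : rep_act (x + y) v = rep_act x v + rep_act y v.
Proof. by rewrite -[X in rep_act (X + _)]scale1r rep_act_comb scale1r. Qed.
Lemma rep_actN x v : rep_act (- x) v = - rep_act x v.
Proof. by rewrite -[X in rep_act X]scaleN1r rep_actZ scaleN1r. Qed.

Lemma rep_act_e v : rep_act (be_ S) v = e_ rho v.
Proof.
by rewrite /rep_act Phi_be ?(mxE, mE_E) ?ord3_eqE /=; vect_with false C V.
Qed.
Lemma rep_act_f v : rep_act (bf_ S) v = f_ rho v.
Proof.
by rewrite /rep_act Phi_bf ?(mxE, mE_E) ?ord3_eqE /=; vect_with false C V.
Qed.
Lemma rep_act_h v : rep_act (bh_ S) v = h_ rho v.
Proof.
by rewrite /rep_act Phi_bh ?(mxE, mE_E) ?ord3_eqE /=; vect_with false C V.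
Qed.
Lemma rep_act_g v : rep_act (bg_ S) v = g_ rho v.
Proof.
by rewrite /rep_act Phi_bg ?(mxE, mE_E) ?ord3_eqE /=; vect_with false C V.
Qed.
Lemma rep_act_xp v : rep_act (bxp_ S) v = xp_ rho v.
Proof.
by rewrite /rep_act Phi_bxp ?(mxE, mE_E) ?ord3_eqE /=; vect_with false C V.
Qed.
Lemma rep_act_xm v : rep_act (bxm_ S) v = xm_ rho v.
Proof.
by rewrite /rep_act Phi_bxm ?(mxE, mE_E) ?ord3_eqE /=; vect_with false C V.
Qed.
Lemma rep_act_yp v : rep_act (byp_ S) v = yp_ rho v.
Proof.
by rewrite /rep_act Phi_byp ?(mxE, mE_E) ?ord3_eqE /=; vect_with false C V.
Qed.
Lemma rep_act_ym v : rep_act (bym_ S) v = ym_ rho v.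
Proof.
by rewrite /rep_act Phi_bym ?(mxE, mE_E) ?ord3_eqE /=; vect_with false C V.
Qed.

Definition rep_actE := (rep_act_e, rep_act_f, rep_act_h, rep_act_g,
  rep_act_xp, rep_act_xm, rep_act_yp, rep_act_ym).

Lemma basis_ind (P : L -> Prop) :
  (forall a x y, P x -> P y -> P (a *: x + y)) ->
  P (be_ S) -> P (bf_ S) -> P (bh_ S) -> P (bg_ S) ->
  P (bxp_ S) -> P (bxm_ S) -> P (byp_ S) -> P (bym_ S) -> forall x, P x.
Proof.
move=> lin Pe Pf Ph Pg Pxp Pxm Pyp Pym x.
have P0 : P 0 by rewrite -(addNr (be_ S)) -scaleN1r; apply: lin.
have sP : subspace [set x | P x] by split=> //; exact: lin.
rewrite (decomposition S x).
by do 7 ?[apply: (subspaceD sP)]; apply: (subspaceZ sP).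
Qed.

Definition bracket_ok x y := forall v,
  rep_act (lie x y) v = rep_act x (rep_act y v) - rep_act y (rep_act x v).

Lemma bracket_ok_sym x y : bracket_ok x y -> bracket_ok y x.
Proof.
move=> h v; have : lie y x = - lie x y.
  have := liexx (x + y); rewrite (linearD_fun (lie_linearl _)) !(linearD_fun (lie_linearr _)).
  by rewrite !liexx add0r addr0 addrC => /eqP; rewrite addr_eq0 => /eqP.
by move=> ->; rewrite rep_actN h opprB.
Qed.

Lemma bracket_ok_xx x : bracket_ok x x.
Proof. by move=> v; rewrite liexx rep_act0 subrr. Qed.

Lemma bracket_ok_lin a x y z : bracket_ok x z -> bracket_ok y z -> bracket_ok (a *: x + y) z.
Proof.
move=> hx hy v; rewrite lie_linearl !rep_act_comb hx hy (rep_act_linear z).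
by vect C V.
Qed.

Ltac rel L R :=
  move=> v; rewrite L ?(rep_actN, rep_actZ, rep_actD, rep_act0) !rep_actE R; vect C V.

(** By bilinearity and antisymmetry it suffices to check the 28 pairs of distinct basis elements,
    which are the 28 relations of [sl3_rep]. *)
Fact rep_actP : lie_action [set: L] rep_act.
Proof.
split=> [x _|a x y v _ _|x y v _ _]; [exact: rep_act_linear|exact: rep_act_comb|].
move: x y v; suff : forall x y, bracket_ok x y by [].
have heR : bracket_ok (bh_ S) (be_ S) by rel (lie_he S) (r_he rho).
have hfR : bracket_ok (bh_ S) (bf_ S) by rel (lie_hf S) (r_hf rho).
have hxpR : bracket_ok (bh_ S) (bxp_ S) by rel (lie_hxp S) (r_hxp rho).
have hxmR : bracket_ok (bh_ S) (bxm_ S) by rel (lie_hxm S) (r_hxm rho).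
have hypR : bracket_ok (bh_ S) (byp_ S) by rel (lie_hyp S) (r_hyp rho).
have hymR : bracket_ok (bh_ S) (bym_ S) by rel (lie_hym S) (r_hym rho).
have geR : bracket_ok (bg_ S) (be_ S) by rel (lie_ge S) (r_ge rho).
have gfR : bracket_ok (bg_ S) (bf_ S) by rel (lie_gf S) (r_gf rho).
have gxpR : bracket_ok (bg_ S) (bxp_ S) by rel (lie_gxp S) (r_gxp rho).
have gxmR : bracket_ok (bg_ S) (bxm_ S) by rel (lie_gxm S) (r_gxm rho).
have gypR : bracket_ok (bg_ S) (byp_ S) by rel (lie_gyp S) (r_gyp rho).
have gymR : bracket_ok (bg_ S) (bym_ S) by rel (lie_gym S) (r_gym rho).
have ghR : bracket_ok (bg_ S) (bh_ S) by rel (lie_gh S) (r_gh rho).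
have efR : bracket_ok (be_ S) (bf_ S) by rel (lie_ef S) (r_ef rho).
have expR : bracket_ok (be_ S) (bxp_ S) by rel (lie_exp S) (r_exp rho).
have exmR : bracket_ok (be_ S) (bxm_ S) by rel (lie_exm S) (r_exm rho).
have eypR : bracket_ok (be_ S) (byp_ S) by rel (lie_eyp S) (r_eyp rho).
have eymR : bracket_ok (be_ S) (bym_ S) by rel (lie_eym S) (r_eym rho).
have xpfR : bracket_ok (bxp_ S) (bf_ S) by rel (lie_xpf S) (r_xpf rho).
have xmfR : bracket_ok (bxm_ S) (bf_ S) by rel (lie_xmf S) (r_xmf rho).
have ypfR : bracket_ok (byp_ S) (bf_ S) by rel (lie_ypf S) (r_ypf rho).
have ymfR : bracket_ok (bym_ S) (bf_ S) by rel (lie_ymf S) (r_ymf rho).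
have xpxmR : bracket_ok (bxp_ S) (bxm_ S) by rel (lie_xpxm S) (r_xpxm rho).
have ypymR : bracket_ok (byp_ S) (bym_ S) by rel (lie_ypym S) (r_ypym rho).
have xpypR : bracket_ok (bxp_ S) (byp_ S) by rel (lie_xpyp S) (r_xpyp rho).
have xpymR : bracket_ok (bxp_ S) (bym_ S) by rel (lie_xpym S) (r_xpym rho).
have xmypR : bracket_ok (bxm_ S) (byp_ S) by rel (lie_xmyp S) (r_xmyp rho).
have xmymR : bracket_ok (bxm_ S) (bym_ S) by rel (lie_xmym S) (r_xmym rho).
have E := bracket_ok_xx; have Y := bracket_ok_sym.
apply: basis_ind => [a x y hx hy z| | | | | | | |]; first by apply: bracket_ok_lin.
- apply: basis_ind => [a x y hx hy| | | | | | | |]; first by apply/Y/bracket_ok_lin; apply: Y.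
  + exact: E.
  + exact: efR.
  + exact: Y heR.
  + exact: Y geR.
  + exact: expR.
  + exact: exmR.
  + exact: eypR.
  + exact: eymR.
- apply: basis_ind => [a x y hx hy| | | | | | | |]; first by apply/Y/bracket_ok_lin; apply: Y.
  + exact: Y efR.
  + exact: E.
  + exact: Y hfR.
  + exact: Y gfR.
  + exact: Y xpfR.
  + exact: Y xmfR.
  + exact: Y ypfR.
  + exact: Y ymfR.
- apply: basis_ind => [a x y hx hy| | | | | | | |]; first by apply/Y/bracket_ok_lin; apply: Y.
  + exact: heR.
  + exact: hfR.
  + exact: E.
  + exact: Y ghR.
  + exact: hxpR.
  + exact: hxmR.
  + exact: hypR.
  + exact: hymR.
- apply: basis_ind => [a x y hx hy| | | | | | | |]; first by apply/Y/bracket_ok_lin; apply: Y.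
  + exact: geR.
  + exact: gfR.
  + exact: ghR.
  + exact: E.
  + exact: gxpR.
  + exact: gxmR.
  + exact: gypR.
  + exact: gymR.
- apply: basis_ind => [a x y hx hy| | | | | | | |]; first by apply/Y/bracket_ok_lin; apply: Y.
  + exact: Y expR.
  + exact: xpfR.
  + exact: Y hxpR.
  + exact: Y gxpR.
  + exact: E.
  + exact: xpxmR.
  + exact: xpypR.
  + exact: xpymR.
- apply: basis_ind => [a x y hx hy| | | | | | | |]; first by apply/Y/bracket_ok_lin; apply: Y.
  + exact: Y exmR.
  + exact: xmfR.
  + exact: Y hxmR.
  + exact: Y gxmR.
  + exact: Y xpxmR.
  + exact: E.
  + exact: xmypR.
  + exact: xmymR.
- apply: basis_ind => [a x y hx hy| | | | | | | |]; first by apply/Y/bracket_ok_lin; apply: Y.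
  + exact: Y eypR.
  + exact: ypfR.
  + exact: Y hypR.
  + exact: Y gypR.
  + exact: Y xpypR.
  + exact: Y xmypR.
  + exact: E.
  + exact: ypymR.
- apply: basis_ind => [a x y hx hy| | | | | | | |]; first by apply/Y/bracket_ok_lin; apply: Y.
  + exact: Y eymR.
  + exact: ymfR.
  + exact: Y hymR.
  + exact: Y gymR.
  + exact: Y xpymR.
  + exact: Y xmymR.
  + exact: Y ypymR.
  + exact: E.
Qed.

Definition rep_module : liemod [set: L] := LieMod rep_actP.

End RepToModule.

Definition mk_linear (K : fieldType) (V : lmodType K) (F : V -> V) (lF : linear F) :
  {linear V -> V} := HB.pack F (GRing.isLinear.Build K V V *:%R F lF).

Lemma nilpotent_last (K : fieldType) (V : lmodType K) (T : {linear V -> V}) w : w != 0 -> locally_nilpotent T w ->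
  exists m, iter m T w != 0 /\ T (iter m T w) = 0.
Proof.
move=> w0 [r Tr]; have ex : exists r, iter r T w == 0 by exists r; apply/eqP.
case: (ex_minnP ex) => -[|m]; first by rewrite /= (negPf w0).
move=> /eqP Tm mn; exists m; split=> //.
by apply/negP => /mn; rewrite ltnn.
Qed.

(** [xp], [xm] and [e] are locally nilpotent on the hull. Applied in this order, each as long as the
    vector stays nonzero, they end at a vector killed by all three: [xm] commutes with [xp], and
    commuting [e] past [xm] only produces [xp]. By assumption it is a multiple of [u]. *)
Lemma lower_hull_socle (K : numFieldType) (V : lmodType K) (rho : sl3_rep V) n c u W :
  hw_vector rho n c u ->
  (forall v, xp_ rho v = 0 -> xm_ rho v = 0 -> e_ rho v = 0 -> exists d, v = d *: u) ->
  rep_stable rho W -> W `<=` lower_hull rho u -> (exists2 w, W w & w != 0) -> W u.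
Proof.
move=> u_hw u_uniq.
move=> [sW Wop] Wsub [w Ww w0].
have [[ed _ _] xpd xmd] := u_hw.
have nil T : rep_stable rho (locally_nilpotent T) -> T u = 0 ->
    forall v, W v -> locally_nilpotent T v.
  move=> sT T0 v /Wsub; apply: lower_hull_sub sT _ _; by exists 1%N.
have Wit T v m : rep_op rho T -> W v -> W (iter m T v).
  by move=> opT Wv; elim: m => //= m; apply: Wop.
have [m1 [n1 xp1]] := nilpotent_last w0 (nil _ (locally_nilpotent_xp rho) xpd _ Ww).
set w1 := iter _ _ _ in n1 xp1; have Ww1 : W w1 by apply: Wit => //; apply: op_xp.
have [m2 [n2 xm2]] := nilpotent_last n1 (nil _ (locally_nilpotent_xm rho) xmd _ Ww1).
set w2 := iter _ _ _ in n2 xm2; have Ww2 : W w2 by apply: Wit => //; apply: op_xm.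
have xp2 : xp_ rho w2 = 0.
  by rewrite /w2; elim: (m2) => //= m IHm; rewrite r_xpxm IHm linear0.
have [m3 [n3 e3]] := nilpotent_last n2 (nil _ (locally_nilpotent_e rho) ed _ Ww2).
set w3 := iter _ _ _ in n3 e3; have Ww3 : W w3 by apply: Wit => //; apply: op_e.
have [xp3 xm3] : xp_ rho w3 = 0 /\ xm_ rho w3 = 0.
  rewrite /w3; elim: (m3) => //= m [IHp IHm]; rewrite -r_exp IHp linear0; split=> //.
  have := r_exm rho (iter m (e_ rho) w2).
  by rewrite IHm IHp linear0 addr0 => /esym.
have [d w3E] := u_uniq _ xp3 xm3 e3.
have d0 : d != 0 by apply: contra_neq n3 => d0; rewrite w3E d0 scale0r.
by rewrite -[u]scale1r -(mulVf d0) -scalerA -w3E; apply: (subspaceZ sW).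
Qed.

(* The module coinduced from the parabolic subalgebra, in the form of
   differential operators on expressions
   [\sum_(i, j, k) phi (i, j, k) p ^ i q ^ j s ^ (a - k) t ^ k]. Exponents range
   over the whole field: only the submodule generated by [s ^ a] matters. *)
Section Model.
Variables (C : numClosedFieldType) (a : nat) (b : C).
Definition coinduced : lmodType C := (C * C * C -> C^o)%type.
Local Notation V := coinduced.
Implicit Types (phi : V).

(** On coefficients these are the operators xp = d/dp, xm = d/dq, e = s d/dt - q d/dp, f = t d/ds -
    p d/dq, h = s d/ds - t d/dt - p d/dp + q d/dq, g = b + t d/dt - p d/dp - 2 q d/dq, yp = p s d/dt
    + q (b + t d/dt - p d/dp - q d/dq), ym = p (b + s d/ds - p d/dp - q d/dq) + q t d/ds. *)
Definition m_xp phi : V := fun x => let: (i, j, k) := x in (i + 1) * phi (i + 1, j, k).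
Definition m_xm phi : V := fun x => let: (i, j, k) := x in (j + 1) * phi (i, j + 1, k).
Definition m_e phi : V := fun x => let: (i, j, k) := x in
  (k + 1) * phi (i, j, k + 1) - (i + 1) * phi (i + 1, j - 1, k).
Definition m_f phi : V := fun x => let: (i, j, k) := x in
  (a%:R - k + 1) * phi (i, j, k - 1) - (j + 1) * phi (i - 1, j + 1, k).
Definition m_h phi : V := fun x => let: (i, j, k) := x in
  (j - i + a%:R - 2%:R * k) * phi (i, j, k).
Definition m_g phi : V := fun x => let: (i, j, k) := x in
  (b - i - 2%:R * j + k) * phi (i, j, k).
Definition m_yp phi : V := fun x => let: (i, j, k) := x in
  (k + 1) * phi (i - 1, j, k + 1) + (b + k - i - j + 1) * phi (i, j - 1, k).
Definition m_ym phi : V := fun x => let: (i, j, k) := x in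
  (b + a%:R - k - i - j + 1) * phi (i - 1, j, k) + (a%:R - k + 1) * phi (i, j - 1, k - 1).

Fact coinducedP c (u v : V) t : (c *: u + v) t = c * u t + v t. Proof. by []. Qed.
Fact coinducedD (u v : V) t : (u + v) t = u t + v t. Proof. by []. Qed.
Fact coinducedN (u : V) t : (- u) t = - u t. Proof. by []. Qed.
Fact coinducedZ c (u : V) t : (c *: u) t = c * u t. Proof. by []. Qed.
Definition coinducedE := (coinducedP, coinducedD, coinducedN, coinducedZ).

Ltac m_lin := move=> c u v; apply/funext => -[[i j] k];
  rewrite coinducedP /m_e /m_f /m_h /m_g /m_xp /m_xm /m_yp /m_ym !coinducedP; ring.

Fact m_xp_linear : linear m_xp. Proof. m_lin. Qed.
Fact m_xm_linear : linear m_xm. Proof. m_lin. Qed.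
Fact m_e_linear : linear m_e. Proof. m_lin. Qed.
Fact m_f_linear : linear m_f. Proof. m_lin. Qed.
Fact m_h_linear : linear m_h. Proof. m_lin. Qed.
Fact m_g_linear : linear m_g. Proof. m_lin. Qed.
Fact m_yp_linear : linear m_yp. Proof. m_lin. Qed.
Fact m_ym_linear : linear m_ym. Proof. m_lin. Qed.

Definition model : sl3_rep V.
Proof.
apply: (@Sl3Rep _ V (mk_linear m_e_linear) (mk_linear m_f_linear)
  (mk_linear m_h_linear) (mk_linear m_g_linear) (mk_linear m_xp_linear) (mk_linear m_xm_linear)
  (mk_linear m_yp_linear) (mk_linear m_ym_linear)) => v;
  apply/funext => -[[i j] k]; rewrite ?coinducedE /= /m_e /m_f /m_h /m_g /m_xp /m_xm /m_yp /m_ym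
    ?coinducedE ?(addrK, subrK); ring.
Defined.

Definition delta_t (n : nat) : V := fun x => (x == (0, 0, n%:R))%:R.

Lemma delta_t_neq0 n : delta_t n != 0.
Proof.
by apply/eqP => /(congr1 (fun u : V => u (0, 0, n%:R)))/eqP; rewrite /delta_t eqxx oner_eq0.
Qed.

(** A constant has derivative 0: the coefficient [x + 1] vanishes exactly where the shifted
    indicator is supported. *)
Lemma shift_mul0 (x : C) (P : bool) : (x + 1) * ((x + 1 == 0) && P)%:R = 0.
Proof. by have [->|_] := eqVneq (x + 1) 0; rewrite ?mul0r ?mulr0. Qed.

Lemma model_f n : f_ model (delta_t n) = (a%:R - n%:R) *: delta_t n.+1.
Proof.
apply/funext => -[[i j] k]; rewrite coinducedZ /= /m_f /delta_t !xpair_eqE -(nat1r n).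
rewrite (andbC (i - 1 == 0)) -(andbA (j + 1 == 0)) shift_mul0 subr0.
have -> : (k - 1 == n%:R) = (k == 1 + n%:R) by rewrite subr_eq addrC.
by have [->|_] := eqVneq k (1 + n%:R); rewrite ?andbF ?mulr0 // andbT; congr (_ * _); ring.
Qed.

Lemma model_f_nil : iter a.+1 (f_ model) (delta_t 0) = 0.
Proof.
have it n : exists c, iter n (f_ model) (delta_t 0) = c *: delta_t n.
  elim: n => [|n [c IHn]]; first by exists 1; rewrite scale1r.
  by exists (c * (a%:R - n%:R)); rewrite iterS IHn (linZ (f_ model)) model_f scalerA.
have [c E] := it a; rewrite iterS E (linZ (f_ model)) model_f subrr scale0r scaler0 //.
Qed.

Lemma model_hw : hw_vector model a%:R b (delta_t 0).
Proof.
split; first split; apply/funext => -[[i j] k]; rewrite ?coinducedZ /=.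
- rewrite /m_e /delta_t !xpair_eqE -(andbA (i + 1 == 0)) shift_mul0 subr0.
  by rewrite andbC shift_mul0.
- rewrite /m_h /delta_t !xpair_eqE; have [->|_] := eqVneq i 0; last by rewrite !mulr0.
  have [->|_] := eqVneq j 0; last by rewrite !mulr0.
  by have [->|_] := eqVneq k 0; rewrite ?mulr0 //=; ring.
- rewrite /m_g /delta_t !xpair_eqE; have [->|_] := eqVneq i 0; last by rewrite !mulr0.
  have [->|_] := eqVneq j 0; last by rewrite !mulr0.
  by have [->|_] := eqVneq k 0; rewrite ?mulr0 //=; ring.
- by rewrite /m_xp /delta_t !xpair_eqE -andbA shift_mul0.
- by rewrite /m_xm /delta_t !xpair_eqE (andbC (i == 0)) -(andbA (j + 1 == 0)) shift_mul0.
Qed.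

(** Vanishing of d/dp and d/dq leaves no [p] and [q]; then [e] acts as s d/dt, whose vanishing
    leaves no [t]. *)
Lemma model_hw_uniq phi : xp_ model phi = 0 -> xm_ model phi = 0 -> e_ model phi = 0 ->
  phi = phi (0, 0, 0) *: delta_t 0.
Proof.
move=> xp0 xm0 e0.
have ph_i i j k : i != 0 -> phi (i, j, k) = 0.
  move=> i0; have := congr1 (fun u : V => u (i - 1, j, k)) xp0.
  by rewrite /= /m_xp subrK => /eqP; rewrite mulf_eq0 (negPf i0) => /eqP.
have ph_j i j k : j != 0 -> phi (i, j, k) = 0.
  move=> j0; have := congr1 (fun u : V => u (i, j - 1, k)) xm0.
  by rewrite /= /m_xm subrK => /eqP; rewrite mulf_eq0 (negPf j0) => /eqP.
have ph_k k : k != 0 -> phi (0, 0, k) = 0.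
  move=> k0; have := congr1 (fun u : V => u (0, 0, k - 1)) e0.
  rewrite /= /m_e subrK add0r (ph_i 1) ?oner_eq0 // mulr0 subr0.
  by move=> /eqP; rewrite mulf_eq0 (negPf k0) => /eqP.
apply/funext => -[[i j] k]; rewrite coinducedZ /delta_t !xpair_eqE.
have [->|i0] := eqVneq i 0; last by rewrite ph_i ?mulr0.
have [->|j0] := eqVneq j 0; last by rewrite ph_j ?mulr0.
by have [->|k0] := eqVneq k 0; rewrite ?mulr1 // ph_k ?mulr0.
Qed.

End Model.

Section ModelModule.
Variables (C : numClosedFieldType) (D : cartan_data (sl C 3)) (S : standard_form D).

Lemma rep_module_stable (V : lmodType C) (rho : sl3_rep V) (W : set (rep_module S rho)) :
  submodule W <-> rep_stable rho W.
Proof.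
split=> [[sW Wa]|[sW Wop]].
  split=> // T v opT Wv.
  have P x : W (rep_act S rho x v) by apply: Wa.
  by case: opT; rewrite -(rep_actE S rho).
split=> // x v _ Wv; rewrite /act /= /rep_act.
have Z (c : C) T : rep_op rho T -> W (c *: T v).
  by move=> opT; apply: (subspaceZ sW); apply: Wop.
by do 7 ?[apply: (subspaceD sW)]; apply: Z; constructor.
Qed.

(** The hull of [s ^ a] in the coinduced module is simple because every nonzero submodule of it
    contains [s ^ a]. Existence of F, L and V_k is derived from this one module. *)
Lemma simple_hw_exists (a : nat) (b : C) : exists (M : liemod [set: sl C 3]) (u : M),
  [/\ simple_mod M, u != 0, hw_vector (rep_of S M) a%:R b u & iter a.+1 (f_ (rep_of S M)) u = 0].
Proof.
pose rho := model a b; pose N := rep_module S rho; pose W : set N := lower_hull rho (delta_t 0).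
have sW : submodule W by apply/rep_module_stable/lower_hull_stable/model_hw.
have W0 : W (delta_t 0 : N) by apply: hull_base.
have P0 : (delta_t 0 : N) \in sub_pred sW by apply/asboolP.
exists (submod sW), (SubCarrier P0).
have aE x (u : submod sW) : sub_val (act x u) = rep_act S rho x (sub_val u) by exact: sub_act_valp.
have vZ (c : C) (u : submod sW) : sub_val (c *: u) = c *: sub_val u.
  exact: (linearZ_fun (sub_val_linear (sW := sW))).
have v0 : sub_val (0 : submod sW) = 0 := linear0_fun (sub_val_linear (sW := sW)).
have [[ed hd gd] xpd xmd] := model_hw a b.
split.
- apply: submod_simple; split=> //.
    by move=> E; have := W0; rewrite E => /eqP; apply/negP/delta_t_neq0.
  move=> W' /rep_module_stable sW' W'W.
  have [nz|no] := pselect (exists2 w, W' w & w != 0).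
    right; apply/seteqP; split=> //; apply: lower_hull_sub => //.
    apply: (lower_hull_socle (model_hw a b)) => // v xp0 xm0 e0.
    by exists (v (0, 0, 0)); apply: (model_hw_uniq (a := a) (b := b)).
  left; apply/seteqP; split=> [w Ww|w ->]; last by case: sW' => -[].
  by apply/eqP/negPn/negP => w0; apply: no; exists w.
- apply/eqP => /(congr1 (@sub_val _ _ _ _ _ sW)); rewrite v0 => /eqP.
  by apply/negP/delta_t_neq0.
- split; first split; apply: sub_val_inj; rewrite ?vZ ?v0 [LHS]aE /= ?(rep_actE S rho) //.
- apply: sub_val_inj; rewrite v0 -(model_f_nil a b).
  elim: a.+1 => //= n IHn; rewrite [LHS]aE (rep_actE S rho); congr (f_ rho _); exact: IHn.
Qed.

End ModelModule.

(** * Induced modules and their simple quotients *)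

Section Frobenius.
Variables (K : fieldType) (L : lieAlgType K) (M : liemod [set: L]).

Fixpoint uact (s : uterm L) (m : M) : M :=
  match s with
  | uGen x => act x m
  | uScal c => c *: m
  | uAdd s t => uact s m + uact t m
  | uMul s t => uact s (uact t m)
  end.

Lemma uact_linear s : linear (uact s).
Proof.
elim: s => [x|c|s IHs t IHt|s IHs t IHt] a u v /=.
- by have [h _ _] := actP M; apply: h.
- by rewrite scalerDr !scalerA mulrC.
- by rewrite IHs IHt scalerDr addrACA.
- by rewrite IHt IHs.
Qed.

Lemma uact_ueq s t : ueq s t -> forall m, uact s m = uact t m.
Proof.
elim=> {s t} /=.
- by [].
- by move=> s t _ IH m; rewrite IH.
- by move=> s t r _ IH1 _ IH2 m; rewrite IH1.
- by move=> s s' t t' _ IH1 _ IH2 m; rewrite IH1 IH2.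
- by move=> s s' t t' _ IH1 _ IH2 m; rewrite IH2 IH1.
- by move=> s t r m; rewrite addrA.
- by move=> s t m; rewrite addrC.
- by move=> s m; rewrite scale0r add0r.
- by move=> s m; rewrite scaleN1r addNr scale0r.
- by [].
- by move=> s m; rewrite scale1r.
- by [].
- by move=> s t r m; rewrite (linearD_fun (uact_linear s)).
- by move=> a b m; rewrite scalerDl.
- by move=> a b m; rewrite scalerA.
- by move=> a s m; rewrite (linearZ_fun (uact_linear s)).
- by move=> a x y m; rewrite act_comb.
- by move=> x y m; rewrite act_lie.
Qed.

Lemma uact_repr (s : uterm L) m : uact (repr (uclass s)) m = uact s m.
Proof. exact/uact_ueq/ueq_repr. Qed.

Variables (p : set L) (F : liemod p) (phi : F -> M).
Hypothesis phi_linear : linear phi.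
Hypothesis phi_hom : forall x v, p x -> phi (act x v) = act x (phi v).

(** [tPure] carries a class in [uea L], so a representing term is chosen; [uact_repr] shows that the
    choice does not matter. *)
Fixpoint tev (s : tterm F) : M :=
  match s with
  | tPure w v => uact (repr w) (phi v)
  | tZero => 0
  | tAdd s t => tev s + tev t
  | tScale a s => a *: tev s
  end.

Lemma tev_teq s t : teq s t -> tev s = tev t.
Proof.
elim=> {s t} //=.
- by move=> s t r _ -> _ ->.
- by move=> s s' t t' _ -> _ ->.
- by move=> a s s' _ ->.
- by move=> s t r; rewrite addrA.
- by move=> s t; rewrite addrC.
- by move=> s; rewrite add0r.
- by move=> s; rewrite scaleN1r addNr.
- by move=> a b s; rewrite scalerA.
- by move=> s; rewrite scale1r.
- by move=> a s t; rewrite scalerDr.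
- by move=> a b s; rewrite scalerDl.
- move=> a w w' v; elim/uclass_ind: w => s; elim/uclass_ind: w' => t.
  by rewrite [X in repr X](_ : _ = uclass (uAdd (uMul (uScal L a) s) t));
    rewrite ?uact_repr // /+%R /*:%R /= !uea_opE.
- by move=> a w v v'; rewrite phi_linear uact_linear.
- move=> w x v px; elim/uclass_ind: w => s.
  rewrite [X in repr X](_ : _ = uclass (uMul s (uGen x))); last by rewrite /*%R /= /Defs.iota !uea_opE.
  by rewrite !uact_repr /= phi_hom.
Qed.

Definition frobenius (q : ind F) : M := tev (repr (q : ind_space F)).

Lemma frobeniusE s : frobenius (tclass s) = tev s.
Proof. exact/tev_teq/teq_repr. Qed.

Lemma frobenius_hom : lie_hom (ind F) M frobenius.
Proof.
split.
  move=> a; elim/tclass_ind => s; elim/tclass_ind => t.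
  by rewrite -tclassZ -tclassD !frobeniusE.
move=> x; elim/tclass_ind => s _.
have -> : act x (tclass s : ind F) = ind_lmul (Defs.iota x) (tclass s) by [].
rewrite ind_lmulE !frobeniusE.
have [l _ _] := actP M; have lx := l x I.
elim: s => [w v||s IHs t IHt|a s IHs] /=.
- elim/uclass_ind: w => s.
  rewrite [X in repr X](_ : _ = uclass (uMul (uGen x) s)); last by rewrite /*%R /= /Defs.iota !uea_opE.
  by rewrite !uact_repr.
- by rewrite (linear0_fun lx).
- by rewrite IHs IHt (linearD_fun lx).
- by rewrite IHs (linearZ_fun lx).
Qed.

Definition tensor1 (v : F) : ind F := tclass (tPure 1 v).

Lemma frobenius_tensor1 v : frobenius (tensor1 v) = phi v.
Proof. by rewrite frobeniusE /= [X in repr X](_ : _ = uclass (uScal L 1)) // uact_repr /= scale1r. Qed.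

End Frobenius.

Section InducedHom.
Variables (K : fieldType) (L : lieAlgType K) (p : set L) (F : liemod p).

Lemma tensor1_linear : linear (@tensor1 _ _ _ F).
Proof. by move=> a u v; rewrite -tclassZ -tclassD; apply/tclassP/teq_linr. Qed.

Lemma tensor1_act x v : p x -> act x (tensor1 v) = tensor1 (act x v) :> ind F.
Proof.
move=> px; rewrite {1}/act /= ind_lmulE /=; apply/tclassP; rewrite mulr1 -[Defs.iota x]mul1r.
exact: teq_bal.
Qed.

Variables (Q : liemod [set: L]) (pi : ind F -> Q).
Hypothesis pi_hom : lie_hom (ind F) Q pi.

Lemma pi_lmul0 w (q : ind F) : pi q = 0 -> pi (ind_lmul w (q : ind_space F)) = 0.
Proof.
have [pl pa] := pi_hom; have p0 := linear0_fun pl; have pD := linearD_fun pl.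
elim/uclass_ind: w => s; elim: s q => [x|c|s IHs t IHt|s IHs t IHt] q q0.
- have -> : ind_lmul (uclass (uGen x)) (q : ind_space F) = act x q by [].
  rewrite pa // q0; have [l _ _] := actP Q; exact: (linear0_fun (l x I)).
- have -> : uclass (uScal L c) = c *: (1 : uea L) + 0.
    rewrite addr0 [RHS](_ : _ = uea_scale c (uclass (uScal L 1))) // uea_scaleE.
    by apply/uclassP; have := ueq_scalM L c 1; rewrite mulr1.
  rewrite ind_lmulDl pD (linearZ_fun pl).
  have -> : ind_lmul 1 (q : ind_space F) = q.
    elim/tclass_ind: (q : ind_space F) => t; rewrite ind_lmulE; congr tclass.
    by elim: t => //= [u v|? -> ? ->|? ? ->] //; rewrite mul1r.
  have -> : ind_lmul 0 (q : ind_space F) = 0.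
    have := ind_lmulDl (-1) 0 0 (q : ind_space F).
    by rewrite scaler0 addr0 scaleN1r addNr.
  by rewrite q0 scaler0 p0 addr0.
- have -> : uclass (uAdd s t) = 1 *: uclass s + uclass t.
    by rewrite scale1r /+%R /= uea_addE.
  by rewrite ind_lmulDl pD (linearZ_fun pl) IHs // IHt // scaler0 addr0.
- have -> : uclass (uMul s t) = uclass s * uclass t by rewrite /*%R /= uea_mulE.
  by rewrite ind_lmulA IHs // IHt.
Qed.

(** The tensors 1 (x) v generate the induced module, and the kernel of [pi] is stable under U(g) by
    [pi_lmul0]. *)
Lemma pi_eq0 : (forall v, pi (tensor1 v) = 0) -> forall q, pi q = 0.
Proof.
have [pl pa] := pi_hom; move=> h; elim/tclass_ind => s.
elim: s => [w v||s IHs t IHt|a s IHs].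
- have -> : tclass (tPure w v) = ind_lmul w (tclass (tPure 1 v)) :> ind_space F.
    by rewrite ind_lmulE /= mulr1.
  exact/pi_lmul0/h.
- exact: (linear0_fun pl).
- by rewrite tclassD (linearD_fun pl) IHs IHt addr0.
- by rewrite tclassZ (linearZ_fun pl) IHs scaler0.
Qed.

End InducedHom.

(** * Finite-dimensional modules over the parabolic subalgebra *)

Section Parabolic.
Variables (C : numClosedFieldType) (D : cartan_data (sl C 3)) (S : standard_form D).
Local Notation Phi := (Phi S).
Local Notation L := (sl C 3).
Local Notation p := (p_plus D).
Let pe := p_plus_be S.
Let pf := p_plus_bf S.
Let ph := p_plus_bh S.
Let pg := p_plus_bg S.
Let pxp := p_plus_bxp S.
Let pxm := p_plus_bxm S.
Let sp : subspace p := p_plus_subspace D.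

Section PModule.
Variable M : liemod p.
Local Notation e := (@act_at _ _ _ M _ pe : {linear M -> M}).
Local Notation f := (@act_at _ _ _ M _ pf : {linear M -> M}).
Local Notation h := (@act_at _ _ _ M _ ph : {linear M -> M}).
Local Notation g := (@act_at _ _ _ M _ pg : {linear M -> M}).
Local Notation xp := (@act_at _ _ _ M _ pxp : {linear M -> M}).
Local Notation xm := (@act_at _ _ _ M _ pxm : {linear M -> M}).

Definition p_hw (a : nat) (b : C) (v : M) : Prop :=
  [/\ e v = 0, h v = a%:R *: v & g v = b *: v] /\
  [/\ xp v = 0, xm v = 0 & iter a.+1 f v = 0].

Lemma p_hef : (forall v, h (f v) = f (h v) - 2%:R *: f v) /\ (forall v, e (f v) = f (e v) + h v).
Proof. by split; [apply: sl2_hf|apply: sl2_ef]. Qed.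

Lemma p_act x v : p x -> act x v = Phi x i0 i1 *: e v + Phi x i1 i0 *: f v + Phi x i0 i0 *: h v
  + (Phi x i0 i0 + Phi x i1 i1) *: g v + Phi x i0 i2 *: xp v + Phi x i1 i2 *: xm v.
Proof.
move=> /(p_plus_decomposition S) {1}->.
have Z c y : p y -> p (c *: y) by move=> py; apply: (subspaceZ sp).
have m1 := Z (Phi x i0 i1) _ pe.
have m2 := subspaceD sp m1 (Z (Phi x i1 i0) _ pf).
have m3 := subspaceD sp m2 (Z (Phi x i0 i0) _ ph).
have m4 := subspaceD sp m3 (Z (Phi x i0 i0 + Phi x i1 i1) _ pg).
have m5 := subspaceD sp m4 (Z (Phi x i0 i2) _ pxp).
rewrite (act_add v m5 (Z _ _ pxm)) (act_add v m4 (Z _ _ pxp)) (act_add v m3 (Z _ _ pg)).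
rewrite (act_add v m2 (Z _ _ ph)) (act_add v m1 (Z _ _ pf)).
by rewrite !(act_scale sp _ _ pe, act_scale sp _ _ pf, act_scale sp _ _ ph, act_scale sp _ _ pg,
  act_scale sp _ _ pxp, act_scale sp _ _ pxm).
Qed.

Variables (a : nat) (b : C) (v : M).
Hypothesis v_hw : p_hw a b v.

(** The brackets of [xp] and [xm] with [f] stay in the nilradical, so both kill the whole string, by
    a common induction. *)
Lemma p_iter k : [/\ g (iter k f v) = (b + k%:R) *: iter k f v, xp (iter k f v) = 0 & xm (iter k f v) = 0].
Proof.
have [[_ _ gv] [xpv xmv _]] := v_hw; elim: k => [|k [IHg IHp IHm]]; first by rewrite addr0.
rewrite !iterS; split.
- rewrite [LHS]act_lie // (lie_gf S) [act _ (iter k f v)]IHg.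
  rewrite -[act (bf_ S) (_ *: _)]/(f (_ *: _)) (linZ f) -(nat1r k).
  by rewrite -[act (bf_ S) (iter _ _ _)]/(f (iter k f v)); vect C M.
- rewrite [LHS]act_lie // (lie_xpf S) [act _ (iter k f v)]IHp.
  rewrite -[act (bf_ S) 0]/(f 0) (lin0 f) -(scaleN1r (bxm_ S)) act_scale //.
  by rewrite [act _ (iter k f v)]IHm scaler0 addr0.
- rewrite [LHS]act_lie // (lie_xmf S) [act _ (iter k f v)]IHm act0l //.
  by rewrite -[act (bf_ S) 0]/(f 0) (lin0 f) addr0.
Qed.

Lemma p_f_span_submodule : submodule (f_span f a v).
Proof.
have [[ev hv gv] [xpv xmv fv]] := v_hw; have [hf ef] := p_hef.
have sF := f_span_subspace f a v; split=> // x w px Wx; rewrite p_act //.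
have st (T : {linear M -> M}) : (forall k, f_span f a v (T (iter k f v))) -> f_span f a v (T w).
  by move=> Tk; apply: f_span_stable Wx.
do 5 ?apply: (subspaceD sF); apply: (subspaceZ sF).
- exact: (f_span_e hf ef ev hv fv).
- exact: f_span_f.
- exact: (f_span_h hf hv fv).
- by apply: st => k; have [-> _ _] := p_iter k; apply: (subspaceZ sF); apply: f_span_iter.
- by apply: st => k; have [_ -> _] := p_iter k; apply: sF.1.
- by apply: st => k; have [_ _ ->] := p_iter k; apply: sF.1.
Qed.

Hypothesis v_neq0 : v != 0.

Lemma p_f_span_simple : simple_submodule (f_span f a v).
Proof.
have [[ev hv gv] [xpv xmv fv]] := v_hw; have [hf ef] := p_hef.
split; first exact: p_f_span_submodule.
  by move=> E; have := f_span_mem fv; rewrite E => /eqP; rewrite (negPf v_neq0).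
move=> W [sW Wa] Wsub; apply: (f_span_irreducible hf ef v_neq0 ev hv) => // w Ww; exact: Wa.
Qed.

Lemma p_simple_f_span : simple_mod M -> f_span f a v = [set: M].
Proof.
by move=> [_ _ Ms]; have [sF F0 _] := p_f_span_simple; have [] := Ms _ sF (@subsetT _ _).
Qed.

End PModule.

Lemma p_hom_exists (F M : liemod p) a b (v : F) (u : M) : simple_mod F -> v != 0 ->
  p_hw a b v -> p_hw a b u ->
  exists phi : F -> M, [/\ linear phi, forall x w, p x -> phi (act x w) = act x (phi w) & phi v = u].
Proof.
move=> simF v0 hwv hwu; have fT := p_simple_f_span hwv v0 simF.
have [[ev hv gv] [xpv xmv fv]] := hwv; have [[eu hu gu] [xpu xmu fu]] := hwu.
have [hf ef] := p_hef F; have [hf' ef'] := p_hef M.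
have [phi [phi_lin phi_iter comm]] := f_span_hom hf ef v0 ev hv fv fT fu.
exists phi; split=> //; last exact: (phi_iter 0%N).
move=> x w px; rewrite !p_act // !(linearD_fun phi_lin) !(linearZ_fun phi_lin).
congr (_ *: _ + _ *: _ + _ *: _ + _ *: _ + _ *: _ + _ *: _); apply: comm => k.
- case: k => [|k]; first by rewrite /= ev eu (linear0_fun phi_lin).
  rewrite (e_iter_f hf ef k ev hv) (e_iter_f hf' ef' k eu hu).
  by rewrite (linearZ_fun phi_lin) phi_iter.
- exact: (phi_iter k.+1).
- rewrite (h_iter_f hf k hv) (h_iter_f hf' k hu).
  by rewrite (linearZ_fun phi_lin) phi_iter.
- have [-> _ _] := p_iter hwv k; have [-> _ _] := p_iter hwu k.
  by rewrite (linearZ_fun phi_lin) phi_iter.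
- by have [_ -> _] := p_iter hwv k; have [_ -> _] := p_iter hwu k; rewrite (linear0_fun phi_lin).
- by have [_ _ ->] := p_iter hwv k; have [_ _ ->] := p_iter hwu k; rewrite (linear0_fun phi_lin).
Qed.

Lemma weightE a b t : cartan D t ->
  weight D a b t = a%:R * Phi t i0 i0 + b * (Phi t i0 i0 + Phi t i1 i1).
Proof.
move=> ht; rewrite /weight; have [l1 l2] := omega_linear D.
(* A linear form on the Cartan subalgebra is determined by its values at the two coroots. *)
have om al : linear_on (cartan D) al -> al t = Phi t i0 i0 * al (h1 D) + (Phi t i0 i0 + Phi t i1 i1) * al (h2 D).
  move=> la; have hh := cartan_bh S; have hg := cartan_bg S.
  have sh := cartan_subspace D; have al0 : al 0 = 0.
    have := la 1 0 0 sh.1 sh.1; rewrite scale1r addr0 mul1r => /eqP.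
    by rewrite -subr_eq subrr eq_sym => /eqP.
  rewrite {1}(cartan_decomposition S ht) (h1E S) (h2E S) la //; last exact: (subspaceZ sh).
  congr (_ + _); rewrite -[X in al X]addr0 la // ?al0 ?addr0 //; exact: sh.1.
have [o11 o12] := omega1P D; have [o21 o22] := omega2P D.
by rewrite (om _ l1) (om _ l2) o11 o12 o21 o22; ring.
Qed.

Lemma weight_bh a b : weight D a b (bh_ S) = a%:R.
Proof.
rewrite weightE; last exact: cartan_bh.
by rewrite Phi_bh !mxE !mE_E !ord3_eqE !eqxx /=; ring.
Qed.
Lemma weight_bg a b : weight D a b (bg_ S) = b.
Proof.
rewrite weightE; last exact: cartan_bg.
by rewrite Phi_bg !mxE !mE_E !ord3_eqE !eqxx /=; ring.
Qed.

Lemma highest_weight_vectorP (M : liemod p) a b (v : M) : v != 0 ->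
  highest_weight_vector (cartan D) (pos_plus D) (weight D a b) v <->
  [/\ act (be_ S) v = 0, act (bh_ S) v = a%:R *: v, act (bg_ S) v = b *: v,
      act (bxp_ S) v = 0 & act (bxm_ S) v = 0].
Proof.
move=> v0; split=> [[_ wt pos]|[ev hv gv xpv xmv]].
  have := wt _ (cartan_bh S); have := wt _ (cartan_bg S).
  rewrite weight_bh weight_bg => gv hv; split=> //.
  - by apply: (pos (alpha1 D)); [left; left|apply: root_be].
  - by apply: (pos (alpha1 D + alpha2 D)); [right|apply: root_bxp].
  - by apply: (pos (alpha2 D)); [left; right|apply: root_bxm].
split=> // [t ht|al x].
  rewrite weightE // [in LHS](cartan_decomposition S ht) act_add; last 2 first.
  - by apply: (subspaceZ sp).
  - by apply: (subspaceZ sp).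
  by rewrite !act_scale // hv gv; vect C M.
case=> [[->|->]|->].
- by move=> /(root_space_be S) ->; rewrite act_scale // ev scaler0.
- by move=> /(root_space_bxm S) ->; rewrite act_scale // xmv scaler0.
- by move=> /(root_space_bxp S) ->; rewrite act_scale // xpv scaler0.
Qed.

Definition res_p (M : liemod [set: L]) : liemod p := res (@subsetT L p) M.

Lemma p_hw_res (M : liemod [set: L]) a b (u : M) :
  p_hw (M := res_p M) a b u <->
  hw_vector (rep_of S M) a%:R b u /\ iter a.+1 (f_ (rep_of S M)) u = 0.
Proof.
split=> [[[eu hu gu] [xpu xmu fu]]|[[[eu hu gu] xpu xmu] fu]].
  by split; [split; [split|exact: xpu|exact: xmu]|exact: fu].
by split; split.
Qed.

(** Existence comes from the string of [f] through the highest weight vector of [simple_hw_exists],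
    which is stable under the parabolic. Finite dimension in turn yields [f^(a+1) v = 0] for any
    choice of F. *)
Lemma F_plusP a b : simple_mod (F_plus D a b) /\
  exists v : F_plus D a b, v != 0 /\ p_hw a b v.
Proof.
suff [sF fF [v vhw]] : [/\ simple_mod (F_plus D a b), finite_dim [set: F_plus D a b]
    & exists v : F_plus D a b, highest_weight_vector (cartan D) (pos_plus D) (weight D a b) v].
  split=> //; exists v; have [v0 _ _] := vhw; split=> //.
  have [ev hv gv xpv xmv] := (highest_weight_vectorP _ _ v0).1 vhw.
  have [hf ef] := p_hef (F_plus D a b); have [d dF] := fF.
  have [n /eqP an fn] := has_dim_singular_weight hf ef (conj I (fun _ _ _ _ _ => I)) dF (fun _ _ => I) I v0 ev hv.
  by rewrite eqr_nat in an; rewrite -(eqP an) in fn; split; split.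
apply: (the_modP (P := fun F : liemod p => [/\ simple_mod F, finite_dim [set: F]
  & exists v : F, highest_weight_vector (cartan D) (pos_plus D) (weight D a b) v])).
have [M [u [_ u0 uhw fu]]] := simple_hw_exists S a b.
have hwu := (p_hw_res a b u).2 (conj uhw fu).
have sW := p_f_span_submodule hwu; have simW := p_f_span_simple hwu u0.
have [[eu hu gu] [xpu xmu _]] := hwu; have [hf ef] := p_hef (res_p M).
exists (submod sW); split.
- exact: submod_simple.
- by exists a.+1; apply/submod_has_dim/(f_span_has_dim hf ef).
have Pu : (u : res_p M) \in sub_pred sW by apply/asboolP/f_span_mem.
have aE x (w : submod sW) : p x -> sub_val (act x w) = act x (sub_val w).
  by move=> px; apply: sub_act_valp.
have vZ (c : C) (w : submod sW) : sub_val (c *: w) = c *: sub_val w.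
  exact: (linearZ_fun (sub_val_linear (sW := sW))).
have v0 : sub_val (0 : submod sW) = 0 := linear0_fun (sub_val_linear (sW := sW)).
exists (SubCarrier Pu); apply/highest_weight_vectorP.
  by apply: contra_neq u0 => /(congr1 (@sub_val _ _ _ _ _ sW)); rewrite v0.
by split; apply: sub_val_inj; rewrite ?vZ ?v0 aE.
Qed.

End Parabolic.

(** * Simple quotients of the induced modules *)

Section HighestWeightModules.
Variables (C : numClosedFieldType) (D : cartan_data (sl C 3)) (S : standard_form D).
Local Notation L := (sl C 3).
Local Notation rep M := (rep_of S M).

Lemma hom_image (I M : liemod [set: L]) (pi : I -> M) (W : set I) : lie_hom I M pi ->
  submodule W -> submodule (pi @` W).
Proof.
move=> [pl pa] [sW Wa]; split; first split.
- by exists 0; [apply: sW.1|apply: linear0_fun].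
- by move=> a _ _ [u Wu <-] [v Wv <-]; exists (a *: u + v); [apply: sW.2|apply: pl].
- by move=> x _ _ [u Wu <-]; exists (act x u); [apply: Wa|apply: pa].
Qed.

Lemma simple_submodule_full (M : liemod [set: L]) (W : set M) w : simple_mod M -> submodule W ->
  W w -> w != 0 -> forall v, W v.
Proof.
move=> [_ _ simple] sW Ww w0 v.
by have [W0|-> //] := simple _ sW (@subsetT _ W); move: Ww w0; rewrite W0 => ->; rewrite eqxx.
Qed.

Lemma hom_hw (I M : liemod [set: L]) (pi : I -> M) n c w : lie_hom I M pi ->
  hw_vector (rep I) n c w -> hw_vector (rep M) n c (pi w).
Proof.
move=> [pl pa] [[ew hw gw] xpw xmw]; have p0 := linear0_fun pl; have pZ := linearZ_fun pl.
have pE x v : pi (act x w) = v -> act x (pi w) = v by rewrite pa.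
split; first split; apply: pE.
- by rewrite [act _ w]ew p0.
- by rewrite [act _ w]hw pZ.
- by rewrite [act _ w]gw pZ.
- by rewrite [act _ w]xpw p0.
- by rewrite [act _ w]xmw p0.
Qed.

Lemma hom_below (I M : liemod [set: L]) (pi : I -> M) mu q : lie_hom I M pi ->
  below (height (rep I)) mu q -> below (height (rep M)) mu (pi q).
Proof.
move=> [pl pa] [s sE ->]; exists [seq (x.1, pi x.2) | x <- s].
  move=> x /mapP[y ys ->] /=; rewrite -(linearZ_fun pl) -(sE y ys) /= (linearD_fun pl).
  by congr (_ + _); symmetry; apply: pa.
by rewrite big_map (big_morph pi (linearD_fun pl) (linear0_fun pl)).
Qed.

Lemma not_below_hw (M : liemod [set: L]) n c (u : M) : hw_vector (rep M) n c u -> u != 0 ->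
  ~ below (height (rep M)) (n + c - 1) u.
Proof.
move=> uhw u0 ub; have [k] := below_weight ub (hw_height uhw) u0.
move=> /eqP; rewrite -subr_eq0 (_ : _ - _ = k.+1%:R); last by rewrite -(nat1r k); ring.
by rewrite pnatr_eq0.
Qed.

Lemma lower_hull_submodule (I : liemod [set: L]) n c w : hw_vector (rep I) n c w ->
  submodule (lower_hull (rep I) w).
Proof. by move=> whw; apply/(rep_stable_submodule S); apply: lower_hull_stable whw. Qed.

(** If [pi2 q] were nonzero, the image under [pi2] of the kernel of [pi1] in the hull would be all
    of [N], so [pi2 w = pi2 q'] with [pi1 q' = 0] and [q' = k w + r], [r] of smaller height. As
    [pi1 w] is not of smaller height, [k = 0]; then [pi2 w = pi2 r] is a contradiction. *)
Lemma hom_kernel_le (I M N : liemod [set: L]) (pi1 : I -> M) (pi2 : I -> N) n c w q :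
  lie_hom I M pi1 -> lie_hom I N pi2 -> simple_mod N -> hw_vector (rep I) n c w ->
  pi1 w != 0 -> pi2 w != 0 -> lower_hull (rep I) w q -> pi1 q = 0 -> pi2 q = 0.
Proof.
move=> h1 h2 simN whw w1 w2 Xq q0; apply/eqP/negPn/negP => q2.
have [p1l p1a] := h1; have [p2l p2a] := h2.
have [sX Xa] := lower_hull_submodule whw.
pose W := [set x : I | lower_hull (rep I) w x /\ pi1 x = 0].
have sW : submodule W.
  split; first split; first by split; [apply: sX.1|apply: linear0_fun].
    by move=> a u v [Xu u0] [Xv v0]; split; [apply: sX.2|rewrite p1l u0 v0 scaler0 addr0].
  move=> x v xT [Xv v0]; split; first exact: Xa.
  rewrite p1a // v0; have [l _ _] := actP M; exact: (linear0_fun (l x Logic.I)).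
have Wq : (pi2 @` W) (pi2 q) by exists q.
have [q' [Xq' q'0] q'w] := simple_submodule_full simN (hom_image h2 sW) Wq q2 (pi2 w).
have [k [r [br q'E]]] := lower_hull_below whw Xq'.
have k0 : k = 0.
  apply/eqP/negPn/negP => k0; apply: (not_below_hw (hom_hw h1 whw) w1).
  have wE : pi1 w = (- k^-1) *: pi1 r.
    move/eqP: q'0; rewrite q'E p1l addr_eq0 => /eqP E.
    by rewrite -[pi1 w]scale1r -(mulVf k0) -scalerA E scalerN scaleNr.
  rewrite wE; apply: (subspaceZ (below_subspace _ _)); exact: (hom_below h1).
apply: (not_below_hw (hom_hw h2 whw) w2).
by rewrite -q'w q'E k0 scale0r add0r; apply: (hom_below h2).
Qed.

(** Both modules are images of the hull of [w], and by [hom_kernel_le] in both directions the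
    kernels coincide. The maps are built from chosen lifts [s1], [s2] to the hull. *)
Lemma quotient_iso (I M N : liemod [set: L]) (pi1 : I -> M) (pi2 : I -> N) n c w :
  lie_hom I M pi1 -> lie_hom I N pi2 -> simple_mod M -> simple_mod N ->
  hw_vector (rep I) n c w -> pi1 w != 0 -> pi2 w != 0 -> iso M N.
Proof.
move=> h1 h2 simM simN whw w1 w2; set X := lower_hull (rep I) w.
have [p1l p1a] := h1; have [p2l p2a] := h2.
have sX := lower_hull_submodule whw; have [[X0 Xl] Xa] := sX.
have Xw : X w by apply: hull_base.
have onto1 m : exists q, X q /\ pi1 q = m.
  have [|q Xq qm] := simple_submodule_full simM (hom_image h1 sX) _ w1 m; first by exists w.
  by exists q.
have onto2 m : exists q, X q /\ pi2 q = m.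
  have [|q Xq qm] := simple_submodule_full simN (hom_image h2 sX) _ w2 m; first by exists w.
  by exists q.
have /choice[s1 s1P] := onto1; have /choice[s2 s2P] := onto2.
have B1 := linearB_fun p1l; have B2 := linearB_fun h2.1.
have k12 q q' : X q -> X q' -> pi1 q = pi1 q' -> pi2 q = pi2 q'.
  move=> Xq Xq' E; apply/subr0_eq; rewrite -B2.
  apply: (hom_kernel_le h1 h2 simN whw w1 w2); last by rewrite B1 E subrr.
  by rewrite addrC -scaleN1r; apply: Xl.
have k21 q q' : X q -> X q' -> pi2 q = pi2 q' -> pi1 q = pi1 q'.
  move=> Xq Xq' E; apply/subr0_eq; rewrite -B1.
  apply: (hom_kernel_le h2 h1 simM whw w2 w1); last by rewrite B2 E subrr.
  by rewrite addrC -scaleN1r; apply: Xl.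
exists (pi2 \o s1); first split.
- move=> a u v /=; rewrite -p2l; apply: k12.
  + by have [] := s1P (a *: u + v).
  + by apply: Xl; [have [] := s1P u|have [] := s1P v].
  + by rewrite p1l (s1P _).2 (s1P u).2 (s1P v).2.
- move=> x v _ /=; rewrite -p2a //; apply: k12.
  + by have [] := s1P (act x v).
  + by apply: Xa => //; have [] := s1P v.
  + by rewrite p1a // (s1P _).2 (s1P v).2.
exists (pi1 \o s2) => v /=.
- rewrite -[RHS](s1P v).2; apply: k21; first by have [] := s2P (pi2 (s1 v)).
    by have [] := s1P v.
  by rewrite (s2P _).2.
- rewrite -[RHS](s2P v).2; apply: k12; first by have [] := s1P (pi1 (s2 v)).
    by have [] := s2P v.
  by rewrite (s1P _).2.
Qed.

Section Plus.
Variables (a : nat) (b : C).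
Local Notation F := (F_plus D a b).

Lemma ind_hw (v : F) : p_hw S a b v ->
  hw_vector (rep (ind F)) a%:R b (tensor1 v) /\ iter a.+1 (f_ (rep (ind F))) (tensor1 v) = 0.
Proof.
move=> [[ev hv gv] [xpv xmv fv]]; have tl := @tensor1_linear _ _ _ F.
have t0 := linear0_fun tl; have tZ := linearZ_fun tl.
have tE x : p_plus D x -> act x (tensor1 v) = tensor1 (act x v) by apply: tensor1_act.
split; first split; first split.
- by rewrite [LHS](tE _ (p_plus_be S)) [act _ v]ev t0.
- by rewrite [LHS](tE _ (p_plus_bh S)) [act _ v]hv tZ.
- by rewrite [LHS](tE _ (p_plus_bg S)) [act _ v]gv tZ.
- by rewrite [LHS](tE _ (p_plus_bxp S)) [act _ v]xpv t0.
- by rewrite [LHS](tE _ (p_plus_bxm S)) [act _ v]xmv t0.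
rewrite -t0 -[in RHS]fv; elim: (a.+1) => //= k ->.
by rewrite [LHS](tensor1_act _ (p_plus_bf S)).
Qed.

Lemma ind_hom (M : liemod [set: L]) (u : M) (v : F) : p_hw S a b v -> v != 0 ->
  hw_vector (rep M) a%:R b u -> iter a.+1 (f_ (rep M)) u = 0 ->
  exists2 pi, lie_hom (ind F) M pi & pi (tensor1 v) = u.
Proof.
move=> vhw v0 uhw fu; have [simF _] := F_plusP S a b.
have hwu := (p_hw_res S a b u).2 (conj uhw fu).
have [phi [pl pa pv]] := p_hom_exists (M := res_p D M) simF v0 vhw hwu.
exists (frobenius (M := M) phi); first exact: frobenius_hom.
by rewrite frobenius_tensor1.
Qed.

Lemma L_plusP : simple_mod (L_plus D a b) /\ forall v : F, p_hw S a b v -> v != 0 ->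
  exists2 pi, lie_hom (ind F) (L_plus D a b) pi & pi (tensor1 v) != 0.
Proof.
have [simL [pi hpi rpi]] : simple_mod (L_plus D a b) /\
    exists2 pi, lie_hom (ind F) (L_plus D a b) pi & range pi = [set: L_plus D a b].
  apply: (the_modP (P := fun Q : liemod [set: L] => simple_mod Q /\
    exists2 pi, lie_hom (ind F) Q pi & range pi = [set: Q])).
  have [M [u [simM u0 uhw fu]]] := simple_hw_exists S a b.
  have [_ [v [v0 vhw]]] := F_plusP S a b.
  have [pi hpi piv] := ind_hom vhw v0 uhw fu; exists M; split=> //; exists pi => //.
  apply/seteqP; split=> // m _.
  have sT : submodule [set: ind F] by split.
  have := simple_submodule_full simM (hom_image hpi sT) _ u0 m; apply.
  by exists (tensor1 v).
(* If [pi] killed [tensor1 v], it would kill the string of [f] through it, hence all tensors 1 (x) w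
   and the whole induced module, although it is onto a nonzero module. *)
split=> // v vhw v0; exists pi => //; apply/eqP => pv.
have [z z0] := simple_neq0 simL; have : range pi z by rewrite rpi.
case=> q _ qz; move/eqP: z0; apply; rewrite -qz; apply: (pi_eq0 hpi) => w.
have [simF _] := F_plusP S a b.
have fT := p_simple_f_span vhw v0 simF.
have : [set: F] w by []; rewrite -fT => -[c ->].
have [pl pa] := hpi; have tl := @tensor1_linear _ _ _ F.
rewrite (linear_sum_fun _ _ tl) (linear_sum_fun _ _ pl) big1 // => i _.
suff -> : pi (tensor1 (iter i (act_at (p_plus_bf S)) v)) = 0 by rewrite scaler0.
elim: (nat_of_ord i) => //= k IHk; rewrite -(tensor1_act _ (p_plus_bf S)) pa // IHk.
by have [l _ _] := actP (L_plus D a b); apply: (linear0_fun (l _ I)).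
Qed.

Lemma L_plus_hw : exists u : L_plus D a b,
  [/\ u != 0, hw_vector (rep (L_plus D a b)) a%:R b u & iter a.+1 (f_ (rep (L_plus D a b))) u = 0].
Proof.
have [_ [v [v0 vhw]]] := F_plusP S a b; have [simL hL] := L_plusP.
have [pi hpi pv] := hL v vhw v0; have [whw wf] := ind_hw vhw.
exists (pi (tensor1 v)); split=> //; first exact: hom_hw.
have [pl pa] := hpi; rewrite -(linear0_fun pl) -wf; elim: (a.+1) => //= k ->.
by rewrite [RHS]pa.
Qed.

Lemma L_plus_iso (M : liemod [set: L]) (u : M) : simple_mod M -> u != 0 ->
  hw_vector (rep M) a%:R b u -> iter a.+1 (f_ (rep M)) u = 0 -> iso M (L_plus D a b).
Proof.
move=> simM u0 uhw fu; have [_ [v [v0 vhw]]] := F_plusP S a b; have [simL hL] := L_plusP.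
have [pi1 h1 p1v] := ind_hom vhw v0 uhw fu; have [pi2 h2 p2v] := hL v vhw v0.
have [whw _] := ind_hw vhw.
by apply: (quotient_iso h1 h2 simM simL whw) => //; rewrite p1v.
Qed.

Lemma V_kP n : simple_mod (V_k D n) /\ has_dim [set: V_k D n] n.+1.
Proof.
apply: (the_modP (P := fun V : liemod (k_sub D) => simple_mod V /\ has_dim [set: V] n.+1)).
(* The second weight 0 is an arbitrary choice: the k-module spanned by the string through [u]
   depends only on [n]. *)
have [M [u [_ u0 [[eu hu _] _ _] fu]]] := simple_hw_exists S n 0.
have simW := k_f_span_simple (S := S) (V := res_k D M) u0 eu hu fu.
have sW : submodule (f_span (act_at (k_sub_bf S) : {linear res_k D M -> _}) n u) by have [] := simW.
exists (submod sW); split; first exact: submod_simple.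
apply: submod_has_dim.
apply: (f_span_has_dim (V := res_k D M) (e := act_at (k_sub_be S)) (h := act_at (k_sub_bh S))) => //.
- exact: (r_hf (rep M)).
- exact: (r_ef (rep M)).
Qed.

Lemma L_plus_c J : (0 < J <= a.+1)%N -> (forall i : nat, b != i%:R) ->
  (forall j, (0 < j < J)%N -> a%:R + b + 2%:R != j%:R) ->
  ((J <= a)%N -> a%:R + b + 2%:R = J%:R) ->
  c_eq D (L_plus D a b) (fun n => (J - (a - n))%N).
Proof.
move=> JR b_nat Jf Jr n; have [simV dV] := V_kP n.
have [simL _] := L_plusP; have [u [u0 uhw fu]] := L_plus_hw.
have simR := simple_rep (S := S) simL.
have fnil : exists r, iter r (f_ (rep (L_plus D a b))) u = 0 by exists a.+1.
have fn w : k_singular S n w -> iter n.+1 (f_ (rep (L_plus D a b))) w = 0.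
  move=> [ew hw]; have [->|w0] := eqVneq w 0; first exact: (linear0_fun (iter_linear _ _)).
  have [r fr] := f_locally_nilpotent simR u0 fnil w.
  have [m [/eqP mE fm _]] := singular_weight (r_hf (rep _)) (r_ef (rep _)) w0 ew hw fr.
  by rewrite eqr_nat in mE; rewrite (eqP mE).
apply/(hom_dim simV dV fn).
exact: (singular_dim uhw simR u0 fnil JR b_nat Jf Jr).
Qed.

End Plus.
End HighestWeightModules.

(** * Bounded modules *)

Section Bounded.
Variables (C : numClosedFieldType) (D : cartan_data (sl C 3)) (S : standard_form D).
Local Notation L := (sl C 3).
Variable M : liemod [set: L].
Hypothesis M_simple : simple_mod M.
Hypothesis M_finite : locally_finite (res_k D M).
Local Notation rho := (rep_of S M).

Lemma finite_singular n w : w != 0 -> e_ rho w = 0 -> h_ rho w = n *: w ->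
  exists2 m, n = m%:R & iter m.+1 (f_ rho) w = 0.
Proof.
move=> w0 ew hw; have [W [[sW Wa] [d dW] Ww]] := M_finite (w : res_k D M).
apply: (has_dim_singular_weight (r_hf rho) (r_ef rho) sW dW _ Ww w0 ew hw).
by move=> v Wv; apply: (Wa (bf_ S)) => //; apply: k_sub_bf.
Qed.

Lemma singular_exists : exists n w, [/\ w != 0, e_ rho w = 0 & h_ rho w = n%:R *: w].
Proof.
have [v v0] := simple_neq0 M_simple.
have [W [[sW Wa] [d dW] Wv]] := M_finite (v : res_k D M).
have [|||n [w [_ w0 ew hw _]]] := has_dim_singular (r_he rho) (r_hf rho) (r_ef rho) sW dW _ _ _ (ex_intro2 _ _ v Wv v0).
- by move=> u Wu; apply: (Wa (be_ S)) => //; apply: k_sub_be.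
- by move=> u Wu; apply: (Wa (bf_ S)) => //; apply: k_sub_bf.
- by move=> u Wu; apply: (Wa (bh_ S)) => //; apply: k_sub_bh.
by exists n, w.
Qed.

(** As [xp w = 0], the vectors [xm^k w] remain k-singular, of weight [m - k]. Local finiteness
    forbids negative weights, so [xm] stops after at most [m] steps. *)
Lemma xp_singular_hw n c w : w != 0 -> singular rho n c w -> xp_ rho w = 0 ->
  exists (a : nat) b u, [/\ u != 0, hw_vector rho a%:R b u & iter a.+1 (f_ rho) u = 0].
Proof.
move=> w0 ws xpw; have [ew hw _] := ws; have [m nE _] := finite_singular w0 ew hw; subst n.
have step k : singular rho (m%:R - k%:R) (c + (2 * k)%:R) (iter k (xm_ rho) w) /\
    xp_ rho (iter k (xm_ rho) w) = 0.
  elim: k => [|k [[ek hk gk] xk]]; first by rewrite subr0 addr0.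
  rewrite iterS; split; last by rewrite r_xpxm xk linear0.
  split; first by rewrite r_exm ek xk linear0 addr0.
    by rewrite r_hxm hk (linZ (xm_ rho)) -(nat1r k); vect C M.
  by rewrite r_gxm gk (linZ (xm_ rho)) mulnS natrD; vect C M.
have nil : locally_nilpotent (xm_ rho) w.
  exists m.+1; apply/eqP/negPn/negP => k0; have [[ek hk _] _] := step m.+1.
  have [l /eqP lE _] := finite_singular k0 ek hk.
  move: lE; rewrite -(nat1r m) -subr_eq0 (_ : _ - _ = - l.+1%:R); last by rewrite -(nat1r l); ring.
  by rewrite oppr_eq0 pnatr_eq0.
have [k [k0 xmk]] := nilpotent_last w0 nil; have [[ek hk gk] xpk] := step k.
have [l lE fl] := finite_singular k0 ek hk.
exists l, (c + (2 * k)%:R), (iter k (xm_ rho) w); split=> //.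
by rewrite -lE; split.
Qed.

Lemma bounded_singular : bounded D M -> exists n c w,
  [/\ w != 0, singular rho n c w & xp_ rho w = 0 \/ yp_ rho w = 0].
Proof.
move=> [N bN].
have dim n : exists2 d, (d <= N)%N & has_dim (k_singular S n (M := M)) d.
  have [simV dV] := V_kP S n; have [d dN hd] := bN _ simV (ex_intro _ _ dV).
  have fn w : k_singular S n w -> iter n.+1 (f_ rho) w = 0.
    move=> [ew hw]; have [->|w0] := eqVneq w 0; first exact: (linear0_fun (iter_linear _ _)).
    have [m /eqP mE fm] := finite_singular w0 ew hw.
    by rewrite eqr_nat in mE; rewrite (eqP mE).
  by exists d => //; apply/(hom_dim simV dV fn).
have [n0 [w0 [nz0 ew0 hw0]]] := singular_exists.
have [d0 _ hd0] := dim n0.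
(* [g] preserves the singular vectors of weight [n0], a finite-dimensional space by boundedness, so
   it has an eigenvector there. *)
have [|c [v [[ev hv] v0 gv]]] := has_dim_eigenvector (k_singular_subspace S n0 M) hd0
    (ex_intro2 _ _ w0 (conj ew0 hw0) nz0) _ (linearP (g_ rho)).
  move=> u [eu hu]; split.
    have := r_ge rho u; rewrite eu (lin0 (g_ rho)) subr0 => /esym; exact.
  by rewrite -r_gh hu (linZ (g_ rho)).
have ypk k : singular rho (n0%:R + k%:R) (c - (2 * k)%:R) (iter k (yp_ rho) v).
  elim: k => [|k /singular_yp IHk]; first by rewrite addr0 subr0; split.
  rewrite iterS; move: IHk; congr (singular _ _ _ _); first by rewrite -(nat1r k); ring.
  by rewrite mulnS natrD; ring.
have xpk i k : singular rho (n0%:R + k%:R + i%:R) (c - (2 * k)%:R + i%:R)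
    (iter i (xp_ rho) (iter k (yp_ rho) v)).
  elim: i => [|i /singular_xp IHi]; first by rewrite !addr0.
  by rewrite iterS; move: IHi; congr (singular _ _ _ _); rewrite -(nat1r i); ring.
have [[k yk]|ny] := pselect (locally_nilpotent (yp_ rho) v).
  have [l [l0 yl]] := nilpotent_last v0 (ex_intro _ k yk).
  by exists (n0%:R + l%:R), (c - (2 * l)%:R), (iter l (yp_ rho) v); split=> //; right.
suff [i [k xik]] : exists i k, iter i (xp_ rho) (iter k (yp_ rho) v) = 0.
  have y0 : iter k (yp_ rho) v != 0 by apply/eqP => yk; apply: ny; exists k.
  have [l [l0 xl]] := nilpotent_last y0 (ex_intro _ i xik).
  by exists (n0%:R + k%:R + l%:R), (c - (2 * k)%:R + l%:R),
    (iter l (xp_ rho) (iter k (yp_ rho) v)); split=> //; left.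
have [d dN /has_dimP[|b gb _]] := dim (n0 + N)%N; first exact: (k_singular_subspace _ _ _).1.
apply/not_existsP => no.
(* With the bound [N] itself as total degree there are [N + 1] such vectors of weight [n0 + N];
   their [g]-weights increase by 3 with [i], so if none vanished they would be independent in a
   space of dimension at most [N]. *)
pose w (i : 'I_N.+1) := iter i (xp_ rho) (iter (N - i) (yp_ rho) v).
have Nw (i : 'I_N.+1) : (N - i + i)%N = N by rewrite subnK // -ltnS.
have kw i : k_singular S (n0 + N) (w i).
  have [ei hi _] := xpk i (N - i)%N; split=> //.
  by rewrite /w hi -addrA -natrD Nw natrD.
suff /(free_generates_leq gb kw) : free_family w by rewrite leqNgt ltnS dN.
apply: (@eigen_free _ _ (g_ rho) _ _ (fun i => c - (2 * (N - i))%:R + i%:R)).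
- move=> i j; rewrite -!addrA => /addrI E; apply: ord_inj.
  have := ltn_ord i; have := ltn_ord j; move=> jN iN.
  have {}E : (i + 2 * (N - j))%:R = (j + 2 * (N - i))%:R :> C.
    rewrite natrD [in RHS]natrD; apply/eqP; rewrite -subr_eq0; apply/eqP.
    by move/eqP: E; rewrite -subr_eq0 => /eqP E; rewrite -[RHS]E; ring.
  by move/eqP: E; rewrite eqr_nat => /eqP E; lia.
- by move=> i; apply/eqP => wi; apply: (no i); exists (N - i)%N.
- by move=> i; have [_ _ gi] := xpk i (N - i)%N.
Qed.

Lemma xp_singular_iso n c w : ~ finite_dim [set: M] ->
  w != 0 -> singular rho n c w -> xp_ rho w = 0 ->
  exists (a : nat) (b : C), ~ int_ge 0 b /\ iso M (L_plus D a b).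
Proof.
move=> infM w0 ws xpw; have [a [b [u [u0 uhw fu]]]] := xp_singular_hw w0 ws xpw.
exists a, b; split; last exact: (L_plus_iso (S := S) M_simple u0 uhw fu).
move=> [z z0 bE]; apply: infM.
have fnil : exists r, iter r (f_ rho) u = 0 by exists a.+1.
apply: (dominant_finite_dim uhw (simple_rep M_simple) u0 fnil (m := `|z|%N)).
by rewrite bE -[in LHS](gez0_abs z0).
Qed.

End Bounded.

(** * Reduction of the minus case to the plus case *)

Section Opposite.
Variables (C : numClosedFieldType) (D : cartan_data (sl C 3)) (S : standard_form D).
Local Notation L := (sl C 3).
Local Notation Phi := (Phi S).
Local Notation h := (cartan D).
Local Notation a1 := (alpha1 D).
Local Notation a2 := (alpha2 D).

Lemma root_Phi be : Defs.root h be -> exists i j : 'I_3, i != j /\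
  forall s, h s -> be s = Phi s i i - Phi s j j.
Proof.
move=> rbe; apply: (root_entry (@Phi_linear _ _ S) (Phi_inj (s := S)) (Phi_lie S) _ rbe).
by move=> s hs; apply: (cartan_Phi S s).1.
Qed.

Lemma opposite_root_Phi s : h s -> (- a1 - a2) s = Phi s i2 i2 - Phi s i0 i0.
Proof.
move=> hs; rewrite (_ : (- a1 - a2) s = - a1 s - a2 s) // (alpha1_Phi S hs) (alpha2_Phi S hs).
ring.
Qed.
Lemma neg_opposite_root_Phi s : h s -> (- (- a1 - a2)) s = Phi s i0 i0 - Phi s i2 i2.
Proof. by move=> hs; rewrite -[RHS]opprB -(opposite_root_Phi hs). Qed.

Fact opposite_coroot_value : Phi (bh_ S + bg_ S) = mE C i0 i0 - mE C i2 i2.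
Proof. by rewrite PhiD !Phi_b; vect_with false C 'M[C]_3. Qed.

Lemma opposite_rootsP : simple_roots2 h a1 (- a1 - a2).
Proof.
have [r1 [l2 _ _] indep _] := alphaP D; have [l1 _ _] := r1.
split=> //.
- split.
  + move=> c x y hx hy; rewrite (_ : (- a1 - a2) (c *: x + y) = - a1 (c *: x + y) - a2 (c *: x + y)) //.
    rewrite l1 // l2 //; rewrite (_ : (- a1 - a2) x = - a1 x - a2 x) //.
    rewrite (_ : (- a1 - a2) y = - a1 y - a2 y) //; ring.
  + exists (bh_ S); first exact: cartan_bh.
    rewrite (opposite_root_Phi (cartan_bh S)) Phi_bh !mxE !mE_E !ord3_eqE !eqxx /=.
    by rewrite subrr sub0r oppr_eq0 subr0 oner_eq0.
  + exists (bym_ S).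
      by apply/(@root_space_Phi _ _ S _ i2 i0) => // [s|]; [apply: opposite_root_Phi|rewrite Phi_bym mE_E scale1r].
    apply/eqP => /(congr1 (fun x => Phi x i2 i0))/eqP.
    by rewrite Phi0 Phi_bym mE_E mxE oner_eq0.
- move=> c d cd; have [|c0 d0] := indep (c - d) (- d).
    move=> t ht; rewrite -[RHS](cd t ht) (_ : (- a1 - a2) t = - a1 t - a2 t) //; ring.
  by move/eqP: d0; rewrite oppr_eq0 => /eqP d0; rewrite d0 subr0 in c0.
move=> be /root_Phi[i [j [ij beE]]].
have A1 t : h t -> a1 t = Phi t i0 i0 - Phi t i1 i1 by apply: alpha1_Phi.
have A2 := opposite_root_Phi.
case: (ord3P i) ij beE => ->; case: (ord3P j) => -> // _ beE.
- by exists 1%N, 0%N; left=> t ht; rewrite beE // A1 // A2 //; ring.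
- by exists 0%N, 1%N; right=> t ht; rewrite beE // A1 // A2 //; ring.
- by exists 1%N, 0%N; right=> t ht; rewrite beE // A1 // A2 //; ring.
- by exists 1%N, 1%N; right=> t ht; rewrite beE // A1 // A2 //; ring.
- by exists 0%N, 1%N; left=> t ht; rewrite beE // A1 // A2 //; ring.
- by exists 1%N, 1%N; left=> t ht; rewrite beE // A1 // A2 //; ring.
Qed.

Lemma opposite_coroot : coroot h (- a1 - a2) (- (h1 D + h2 D)).
Proof.
rewrite (h1E S) (h2E S); split; last first.
  have hb : h (- (bh_ S + bg_ S)).
    by apply/(subspaceN (cartan_subspace D))/(subspaceD (cartan_subspace D)); [apply: cartan_bh|apply: cartan_bg].
  rewrite opposite_root_Phi // PhiN opposite_coroot_value !mxE !mE_E !ord3_eqE !eqxx /=; ring.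
apply: smallest_mem; exists (bym_ S).
  by apply/(@root_space_Phi _ _ S _ i2 i0) => // [s|]; [apply: opposite_root_Phi|rewrite Phi_bym mE_E scale1r].
exists (bxp_ S).
  by apply/(@root_space_Phi _ _ S _ i0 i2) => // [s|]; [apply: neg_opposite_root_Phi|rewrite Phi_bxp mE_E scale1r].
apply: (Phi_inj (s := S)); rewrite PhiN opposite_coroot_value Phi_lie !Phi_b.
by rewrite !delta_mulE ?ord3_eqE !eqxx; vect_with false C 'M[C]_3.
Qed.

Fact opposite_omega_linear : linear_on h (omega1 D - omega2 D) /\ linear_on h (- omega2 D).
Proof.
have [l1 l2] := omega_linear D; split=> c x y hx hy.
  rewrite (_ : (omega1 D - omega2 D) (c *: x + y) = omega1 D (c *: x + y) - omega2 D (c *: x + y)) //.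
  rewrite l1 // l2 // (_ : (omega1 D - omega2 D) x = omega1 D x - omega2 D x) //.
  rewrite (_ : (omega1 D - omega2 D) y = omega1 D y - omega2 D y) //; ring.
rewrite (_ : (- omega2 D) (c *: x + y) = - omega2 D (c *: x + y)) // l2 //.
rewrite (_ : (- omega2 D) x = - omega2 D x) // (_ : (- omega2 D) y = - omega2 D y) //; ring.
Qed.

Fact omega_opposite_coroot om : linear_on h om -> om (- (h1 D + h2 D)) = - om (h1 D) - om (h2 D).
Proof.
move=> l; have sh := cartan_subspace D.
have hh : h (h1 D) by rewrite (h1E S); apply: cartan_bh.
have hg : h (h2 D) by rewrite (h2E S); apply: cartan_bg.
have o0 : om 0 = 0.
  have := l 1 0 0 sh.1 sh.1; rewrite scale1r addr0 mul1r => /eqP.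
  by rewrite -subr_eq subrr eq_sym => /eqP.
rewrite (_ : - (h1 D + h2 D) = (-1) *: h1 D + ((-1) *: h2 D + 0)); last by vect C (sl C 3).
by rewrite !l // ?o0; [ring|apply: sh.1|rewrite addr0; apply: (subspaceZ sh)].
Qed.

Fact opposite_omega1P : (omega1 D - omega2 D) (h1 D) = 1 /\
  (omega1 D - omega2 D) (- (h1 D + h2 D)) = 0.
Proof.
have [l1 l2] := omega_linear D; have [o11 o12] := omega1P D; have [o21 o22] := omega2P D.
have E x : (omega1 D - omega2 D) x = omega1 D x - omega2 D x by [].
by rewrite !E (omega_opposite_coroot l1) (omega_opposite_coroot l2) o11 o12 o21 o22; split; ring.
Qed.
Fact opposite_omega2P : (- omega2 D) (h1 D) = 0 /\ (- omega2 D) (- (h1 D + h2 D)) = 1.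
Proof.
have [l1 l2] := omega_linear D; have [o21 o22] := omega2P D.
have E x : (- omega2 D) x = - omega2 D x by [].
by rewrite !E (omega_opposite_coroot l2) o21 o22; split; ring.
Qed.

(** The Cartan subalgebra and [alpha1] are kept, so [k_sub] is the same by conversion, and with it
    [bounded], [V_k] and [c_eq]. *)
Definition opposite : cartan_data (sl C 3) :=
  CartanData (cartanP D) opposite_rootsP (h1P D) opposite_coroot
    opposite_omega_linear opposite_omega1P opposite_omega2P.

(** An equality and not only an isomorphism: positive roots, weight and parabolic subalgebra
    coincide. With the new fundamental weights [omega1 - omega2] and [- omega2], the coefficients
    [a] and [- a - b] give back [a omega1 + b omega2]. *)
Lemma L_minusE a b : L_minus D a b = L_plus opposite a (- a%:R - b).
Proof.
have aE : a1 + (- a1 - a2) = - a2 by rewrite addrA subrr add0r.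
pose G pos lam q := simple_quotient (ind (fin_simple h pos lam q)).
have GE pos pos' lam lam' q q' : pos = pos' -> lam = lam' -> q = q' -> G pos lam q = G pos' lam' q'.
  by move=> -> -> ->.
apply: GE.
- by rewrite /pos_plus /= aE.
- apply/funext => t; rewrite /weight /=.
  have E x : (omega1 D - omega2 D) x = omega1 D x - omega2 D x by [].
  have E2 x : (- omega2 D) x = - omega2 D x by [].
  by rewrite E E2; ring.
- rewrite /p_plus /p_minus /= aE; congr (lspan _).
  by rewrite -!setUA; congr (_ `|` (_ `|` _)); apply: setUC.
Qed.

End Opposite.

(** * Classification and the explicit multiplicities *)

Section MainResults.
Variables (C : numClosedFieldType) (D : cartan_data (sl C 3)).

(** [S'] is an arbitrary standard form, unrelated to [S]. The root spaces are lines, so its [e] and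
    [xp] are multiples of [e] and [yp] for [S]; the coroots are canonical, so its [h] and [g] are
    [h] and [- (h + g)]. *)
Lemma singular_opposite (S : standard_form D) (S' : standard_form (opposite S))
    (M : liemod [set: sl C 3]) n c (w : M) :
  singular (rep_of S M) n c w -> yp_ (rep_of S M) w = 0 ->
  singular (rep_of S' M) n (- (n + c)) w /\ xp_ (rep_of S' M) w = 0.
Proof.
move=> [ew hw gw] ypw.
have Z x d v : act x w = v -> act (d *: x) w = d *: v :> M by move=> <-; apply: opZ.
split; first split.
- rewrite [LHS](_ : _ = act (be_ S') w) // (root_space_be S (root_be S')).
  by rewrite (Z _ _ _ ew) scaler0.
- by rewrite [LHS](_ : _ = act (bh_ S') w) // -(h1E S') /= (h1E S).
- rewrite [LHS](_ : _ = act (bg_ S') w) // -(h2E S') /= (h1E S) (h2E S) -scaleN1r.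
  rewrite (Z _ _ ((n + c) *: w)); first by vect C M.
  by rewrite act_add // [act (bh_ S) w]hw [act (bg_ S) w]gw; vect C M.
- rewrite [LHS](_ : _ = act (bxp_ S') w) //; have rx := root_bxp S'.
  have aE : alpha1 D + (- alpha1 D - alpha2 D) = - alpha2 D by rewrite addrA subrr add0r.
  rewrite /= aE in rx.
  have nE s : cartan D s -> (- alpha2 D) s = Phi S s i2 i2 - Phi S s i1 i1.
    by move=> hs; rewrite -[RHS]opprB -(alpha2_Phi S hs).
  move/(@root_space_Phi _ _ S _ i2 i1 _ isT nE): rx => xE.
  rewrite (_ : bxp_ S' = Phi S (bxp_ S') i2 i1 *: byp_ S); last first.
    by apply: (Phi_inj (s := S)); rewrite PhiZ Phi_byp.
  by rewrite (Z _ _ _ ypw) scaler0.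
Qed.

Lemma bounded_classification (S : standard_form D) (M : liemod [set: sl C 3]) :
  simple_mod M -> ~ finite_dim [set: M] -> gk_module D M -> bounded D M ->
  (exists (a : nat) (b : C), ~ int_ge 0 b /\ iso M (L_plus D a b)) \/
  (exists (a : nat) (b : C), ~ int_ge 0 (- a%:R - b) /\ iso M (L_minus D a b)).
Proof.
move=> simM infM [finM _] bM.
have [n [c [w [w0 ws [xpw|ypw]]]]] := bounded_singular S simM finM bM.
  by left; apply: (xp_singular_iso simM finM infM w0 ws xpw).
right; have [S' _] := standard_form_exists (opposite S).
have [ws' xpw] := singular_opposite S' ws ypw.
have [a [b [nb Mb]]] := xp_singular_iso (S := S') simM finM infM w0 ws' xpw.
(* The substitution of [- a - b] for [b] is an involution. *)
exists a, (- a%:R - b).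
have bE : - a%:R - (- a%:R - b) = b by ring.
by rewrite (L_minusE S) bE.
Qed.

Lemma stairsE p a : (p <= a)%N -> stairs p a = fun n => (a.+1 - p - (a - n))%N.
Proof.
move=> pa; apply/funext => n; rewrite /stairs.
by case: (ltnP n p) => ?; [lia|case: (ltnP n a) => ?; lia].
Qed.

Lemma L_plus_c_generic a (b : C) : ~ int_ge 0 b ->
  ~ (int_ge 2 (- b) /\ int_ge (-1) (a%:R + b)) ->
  c_eq D (L_plus D a b) (stairs 0 a).
Proof.
move=> nb nab; have [S _] := standard_form_exists D.
(* Here [J = a + 1]: [a + b + 2 = j] with [0 < j <= a] is exactly the excluded case. *)
rewrite stairsE // subn0; apply: (L_plus_c S) => //.
- by rewrite ltnSn.
- move=> i; apply/eqP => bi; apply: nb; exists i%:Z => //.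
- move=> j /andP[j0 ja]; apply/eqP => jE; apply: nab; split.
    exists (a%:Z + 2 - j%:Z); first by lia.
    by rewrite rmorphB rmorphD /= -!pmulrn -jE; ring.
  exists (j%:Z - 2); first by lia.
  by rewrite rmorphB /= -!pmulrn -jE; ring.
- by rewrite ltnn.
Qed.

Lemma L_plus_c_special a (b : C) (p : nat) : int_ge (-1) (a%:R + b) -> p%:R = - b - 1 ->
  c_eq D (L_plus D a b) (stairs p a).
Proof.
move=> [z z1 zE] pE; have [S _] := standard_form_exists D.
have bE : b = - p.+1%:R by rewrite -(nat1r p) pE; ring.
have pa : (p <= a)%N.
  have : (a%:Z - p%:Z - 1)%:~R = z%:~R :> C.
    by rewrite -zE bE rmorphB rmorphB /= -!pmulrn -(nat1r p); ring.
  by move/intr_inj; lia.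
(* Here [J = a + 1 - p = a + b + 2]. *)
rewrite stairsE //; apply: (L_plus_c S).
- by apply/andP; split; lia.
- move=> i; apply/eqP => bi; have : (p.+1 + i)%:R = 0 :> C by rewrite natrD -bi bE; ring.
  by move/eqP; rewrite pnatr_eq0.
- move=> j /andP[j0 ja]; apply/eqP => jE.
  have : (a.+1)%:R = (p + j)%:R :> C by rewrite natrD -jE bE -(nat1r p) -(nat1r a); ring.
  by move/eqP; rewrite eqr_nat => /eqP; lia.
- by move=> _; rewrite natrB ?(leqW pa) // bE -(nat1r p) -(nat1r a); ring.
Qed.

End MainResults.

Section MinusResults.
Variables (C : numClosedFieldType) (D : cartan_data (sl C 3)).

Lemma L_minus_c (S : standard_form D) a b c :
  c_eq (opposite S) (L_plus (opposite S) a (- a%:R - b)) c -> c_eq D (L_minus D a b) c.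
Proof. by rewrite (L_minusE S). Qed.

Lemma L_minus_c_generic a (b : C) : ~ int_ge 0 (- a%:R - b) ->
  ~ (int_ge 2 (a%:R + b) /\ int_ge (-1) (- b)) ->
  c_eq D (L_minus D a b) (stairs 0 a).
Proof.
have [S _] := standard_form_exists D.
move=> nb nab; apply: (@L_minus_c S); apply: L_plus_c_generic => //.
have -> : - (- a%:R - b) = a%:R + b by ring.
by have -> : a%:R + (- a%:R - b) = - b by ring.
Qed.

Lemma L_minus_c_special a (b : C) (p : nat) : int_ge (-1) (- b) -> p%:R = a%:R + b - 1 ->
  c_eq D (L_minus D a b) (stairs p a).
Proof.
have [S _] := standard_form_exists D.
move=> nb pE; apply: (@L_minus_c S); apply: L_plus_c_special.
  by have -> : a%:R + (- a%:R - b) = - b by ring.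
by have -> : - (- a%:R - b) = a%:R + b by ring.
Qed.

End MinusResults.

Theorem theorem9p2 (R : realType) (D : cartan_data (sl R[i] 3)) :
  (forall M : liemod [set: sl R[i] 3],
     simple_mod M -> ~ finite_dim [set: M] ->
     gk_module D M -> bounded D M ->
     (exists (a : nat) (b : R[i]),
        ~ int_ge 0 b /\ iso M (L_plus D a b)) \/
     (exists (a : nat) (b : R[i]),
        ~ int_ge 0 (- a%:R - b) /\ iso M (L_minus D a b)))
  /\
  ((forall (a : nat) (b : R[i]),
      ~ int_ge 0 b ->
      ~ (int_ge 2 (- b) /\ int_ge (-1) (a%:R + b)) ->
      c_eq D (L_plus D a b) (stairs 0 a)) /\
   (forall (a : nat) (b : R[i]),
      ~ int_ge 0 (- a%:R - b) ->
      ~ (int_ge 2 (a%:R + b) /\ int_ge (-1) (- b)) ->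
      c_eq D (L_minus D a b) (stairs 0 a)))
  /\
  ((forall (a : nat) (b : R[i]),
      int_ge 2 (- b) -> int_ge (-1) (a%:R + b) ->
      forall p : nat, p%:R = - b - 1 ->
      c_eq D (L_plus D a b) (stairs p a)) /\
   (forall (a : nat) (b : R[i]),
      int_ge 2 (a%:R + b) -> int_ge (-1) (- b) ->
      forall p : nat, p%:R = a%:R + b - 1 ->
      c_eq D (L_minus D a b) (stairs p a))).
Proof.
split; first by have [S _] := standard_form_exists D; move=> M; apply: bounded_classification S M.
split; split=> a b.
- exact: L_plus_c_generic.
- exact: L_minus_c_generic.
- by move=> _ nb p pE; apply: L_plus_c_special.
- by move=> _ nb p pE; apply: L_minus_c_special.
Qed.
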